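(* Let $n\in\mathbb N$ and let $f\in C_b^{(n)}(\mathcal P_2(\mathbb R^d);\mathbb R^e)$. Then for any $\mu,\nu\in\mathcal P_{n+1}(\mathbb R^d)$ and any probability measure $\Pi^{\mu,\nu}$ on $\mathbb R^d\times\mathbb R^d$ with marginals $\mu$ and $\nu$, $$f(\nu)-f(\mu)=\sum_{k=1}^n\sum_{a\in A_k}\frac{\mathbf D^af(\mu)[\Pi^{\mu,\nu}]}{k!}+R_n^{\Pi^{\mu,\nu}}(f),$$ where $$R_n^{\Pi^{\mu,\nu}}(f)=\frac1{(n-1)!}\sum_{a\in A_n}\int_{(\mathbb R^d\times\mathbb R^d)^{m[a]}} f^{a,\mu,\nu}\cdot\bigotimes_{i=1}^n(v_{a_i}-u_{a_i})\,d\Pi^{\mu,\nu}(u_1,v_1)\cdots d\Pi^{\mu,\nu}(u_{m[a]},v_{m[a]})$$ and $$f^{a,\mu,\nu}=\int_0^1\Big(\partial_af\big(\Pi^{\mu,\nu}_\xi,u_1+\xi(v_1-u_1),\dots,u_{m[a]}+\xi(v_{m[a]}-u_{m[a]})\big)-\partial_af(\mu,u_1,\dots,u_{m[a]})\Big)(1-\xi)^{n-1}d\xi .$$ Further, the remainder satisfies $$\big|R_n^{\Pi^{\mu,\nu}}(f)\big|\le C\int_{\mathbb R^d\times\mathbb R^d}|u-v|^{n+1}\,d\Pi^{\mu,\nu}(u,v)$$ for a constant $C$ depending only on the bounds for $f$ and its derivatives (including the Lipschitz bounds).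
   Context: $\mathcal P_p(\mathbb R^d)$ is the set of Borel probability measures on $\mathbb R^d$ with finite $p$-th moment; $\mathbb W^{(p)}(\mu,\nu)=\inf_\Pi(\int|x-y|^pd\Pi(x,y))^{1/p}$ (infimum over couplings of $\mu,\nu$) is the $p$-Wasserstein distance. $\mathrm{Lin}(U,V)$ is the space of linear maps $U\to V$. Partition sequences: for $n\in\mathbb N$, $A_n$ is the set of sequences $a=(a_1,\dots,a_n)$ with $a_1=1$ and $a_k\in\{1,\dots,1+\max_{l<k}a_l\}$ for $2\le k\le n$. For $a\in A_n$, $|a|=n$ and $m[a]=\max_i a_i$. Lions derivative: $f:\mathcal P_2(\mathbb R^d)\to\mathbb R^e$ is Lions differentiable at $\mu$ if the lift $F(X)=f(\mathbb P\circ X^{-1})$ on $L^2(\Omega,\mathbb P;\mathbb R^d)$ is Fréchet differentiable at some $X$ with law $\mu$; then $DF(X)=\partial_\mu f(\mu)(X)$, with $\partial_\mu f(\mu)(\cdot):\mathbb R^d\to\mathrm{Lin}(\mathbb R^d,\mathbb R^e)$. $f:\mathcal P_2(\mathbb R^d)\to\mathbb R^e$ belongs to $C_b^{(n)}(\mathcal P_2(\mathbb R^d);\mathbb R^e)$ if there are functions $(\partial_af)_{a\in\cup_{k=1}^nA_k}$ such that: (1) for $a\in A_k$, $\partial_af:\mathcal P_2(\mathbb R^d)\times(\mathbb R^d)^{m[a]}\to\mathrm{Lin}((\mathbb R^d)^{\otimes k},\mathbb R^e)$, $(\mu,v_1,\dots,v_{m[a]})\mapsto\partial_af(\mu,v_1,\dots,v_{m[a]})$;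 $f$ is Lions differentiable and $\partial_{(1)}f=\partial_\mu f$; (2) for $1\le k\le n$ and $a\in A_k$, $\partial_af$ is bounded and Lipschitz continuous, $\mathcal P_2(\mathbb R^d)$ being equipped with $\mathbb W^{(1)}$; (3) for $1\le k\le n-1$ and $a\in A_k$, $\partial_af$ is differentiable in $(v_1,\dots,v_{m[a]})$ with $\partial_{v_j}\partial_af=\partial_{(a_1,\dots,a_k,j)}f$; (4) for $1\le k\le n-1$ and $a\in A_k$, $\partial_af$ is (Lions) differentiable in $\mu$ with $\partial_\mu\partial_af=\partial_{(a_1,\dots,a_k,m[a]+1)}f$ (the new free variable being $v_{m[a]+1}$). For $a\in A_k$, $$\mathbf D^af(\mu)[\Pi^{\mu,\nu}]=\int_{(\mathbb R^d\times\mathbb R^d)^{m[a]}}\partial_af(\mu,u_1,\dots,u_{m[a]})\cdot\bigotimes_{i=1}^k(v_{a_i}-u_{a_i})\,d\Pi^{\mu,\nu}(u_1,v_1)\cdots d\Pi^{\mu,\nu}(u_{m[a]},v_{m[a]}).$$ For $\xi\in[0,1]$, $\Pi^{\mu,\nu}_\xi$ is the law on $\mathbb R^d$ of $u+\xi(v-u)$ under $\Pi^{\mu,\nu}(du,dv)$. *)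

(* Defs.v *)
From HB Require Import structures.
From mathcomp Require Import all_boot all_order all_algebra.
From mathcomp Require Import all_classical all_reals all_analysis.
From mathcomp Require Import measurable_realfun.
From mathcomp Require Export mxtens.

Set Implicit Arguments.
Unset Strict Implicit.
Unset Printing Implicit Defensive.

Import Order.TTheory GRing.Theory Num.Theory.
Import numFieldNormedType.Exports.

Local Open Scope classical_set_scope.
Local Open Scope ring_scope.

(* The Borel sigma-algebra; R^dim is 'rV[R]_dim. *)
HB.instance Definition _ (R : realType) (m n : nat) :=
  @isMeasurable.Build (sigma_display (@open 'M[R]_(m, n))) 'M[R]_(m, n)
    <<s @open 'M[R]_(m, n) >> (@sigma_algebra0 _ setT _) (@sigma_algebraC _ _)
    (@sigma_algebra_bigcup _ setT _).

Section measurable_matrix.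
Context {R : realType} {m n : nat}.

Lemma measurable_coord (i : 'I_m) (j : 'I_n) :
  measurable_fun [set: 'M[R]_(m, n)] (fun A => A i j).
Proof.
apply: (measurability _ (RGenOInfty.measurableE R)).
move=> _ [_ [x ->] <-]; rewrite setTI; apply: sub_sigma_algebra.
apply: (@open_comp _ _ (fun A : 'M[R]_(m, n) => A i j)).
  by move=> A _; exact: coord_continuous.
exact: interval_open.
Qed.

Lemma measurable_fun_mx d (T : measurableType d) (f : T -> 'M[R]_(m, n)) :
  (forall i j, measurable_fun [set: T] (fun x => f x i j)) ->
  measurable_fun [set: T] f.
Proof.
move=> mf; apply: (@measurability _ _ _ _ _ _ (@open 'M[R]_(m, n))) => //.
move=> _ [U oU <-]; rewrite setTI.
pose box (q : 'M[rat]_(m, n) * 'M[rat]_(m, n)) : set 'M[R]_(m, n) :=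
  [set A | forall i j, `]ratr (q.1 i j), ratr (q.2 i j)[%classic (A i j)].
have mbox q : measurable (f @^-1` box q).
  rewrite (_ : _ @^-1` _ = \bigcap_(i in [set: 'I_m]) \bigcap_(j in [set: 'I_n])
      ([set: T] `&` (fun x => f x i j) @^-1` `]ratr (q.1 i j), ratr (q.2 i j)[)).
    apply: fin_bigcap_measurable => // i _.
    by apply: fin_bigcap_measurable => // j _; exact: mf.
  apply/seteqP; split => [x fx i _ j _|x fx i j]; first by split => //; exact: fx.
  by have [] := fx i I j I.
rewrite (_ : _ @^-1` _ =
    \bigcup_q (if `[< box q `<=` U >] then f @^-1` box q else set0)).
  apply: countable_bigcupT_measurable => // q.
  by case: ifPn => // _; exact: measurable0.
apply/seteqP; split => [x Ufx|x [q _]]; last first.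
  by case: ifPn => // /asboolP qU /qU.
have /nbhs_ballP[e /= e0 eU] : nbhs (f x) U by exact: open_nbhs_nbhs.
have rat_lt (a b : R) : exists q : rat, a < b -> a < ratr q < b.
  have [ab|ab] := boolP (a < b); last by exists 0.
  by have [q] := rat_in_itvoo ab; rewrite in_itv/=; exists q.
have [lo loP] := choice (fun ij : 'I_m * 'I_n =>
  rat_lt (f x ij.1 ij.2 - e) (f x ij.1 ij.2)).
have [hi hiP] := choice (fun ij : 'I_m * 'I_n =>
  rat_lt (f x ij.1 ij.2) (f x ij.1 ij.2 + e)).
pose q := (\matrix_(i, j) lo (i, j), \matrix_(i, j) hi (i, j)).
have loE i j : f x i j - e < ratr (q.1 i j) < f x i j.
  by rewrite mxE; apply: (loP (i, j)); rewrite ltrBlDr ltrDl.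
have hiE i j : f x i j < ratr (q.2 i j) < f x i j + e.
  by rewrite mxE; apply: (hiP (i, j)); rewrite ltrDl.
exists q => //; rewrite ifT.
  move=> i j /=; rewrite in_itv/=.
  by have /andP[_ ->] := loE i j; have /andP[-> _] := hiE i j.
apply/asboolP => A qA; apply: eU; split => // i j.
have := qA i j; rewrite /= in_itv/= => /andP[loA hiA].
have /andP[lo1 _] := loE i j; have /andP[_ hi1] := hiE i j.
rewrite /ball/= ltr_distlC; apply/andP; split.
  exact: lt_trans lo1 loA.
exact: lt_trans hiA hi1.
Qed.
End measurable_matrix.

(* Euclidean (Hilbert-Schmidt) norm, in contrast with the sup norm `|A| of    *)
(* the library.                                                               *)
Definition enorm (R : realType) (m n : nat) (A : 'M[R]_(m, n)) : R :=
  Num.sqrt (\sum_i \sum_j A i j ^+ 2).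

Definition mxint d (T : measurableType d) (R : realType)
    (mu : {measure set T -> \bar R}) (D : set T) (p q : nat)
    (F : T -> 'M[R]_(p, q)) : 'M[R]_(p, q) :=
  \matrix_(i, j) (\int[mu]_(x in D) F x i j).

Section power_probability.
Context d (T : measurableType d) (R : realType).

Definition tcons n (z : T * n.-tuple T) : n.+1.-tuple T :=
  [the n.+1.-tuple T of z.1 :: z.2].

Lemma measurable_tcons n : measurable_fun [set: T * n.-tuple T] (@tcons n).
Proof. by apply: measurable_cons. Qed.

HB.instance Definition _ n :=
  isMeasurableFun.Build _ _ _ _ (@tcons n) (@measurable_tcons n).

Fixpoint power_prob (P : probability T R) n : probability (n.-tuple T) R :=
  match n with
  | 0 => \d_([tuple])
  | n'.+1 => distribution (P \x power_prob P n')%E (@tcons n')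
  end.

End power_probability.

Section wasserstein.
Context {R : realType} {dim : nat}.
Local Notation V := 'rV[R]_dim.

(* mu belongs to P_p(R^dim) *)
Definition finite_moment (p : nat) (mu : probability V R) : Prop :=
  (\int[mu]_x (enorm x ^+ p)%:E < +oo)%E.

(* Measures are functions on all of [set V] whose values outside the          *)
(* measurable sets are irrelevant: this is the equality of Borel measures.    *)
Definition eq_borel (mu nu : probability V R) : Prop :=
  forall A, measurable A -> mu A = nu A.

Definition coupling (mu nu : probability V R) (Pi : probability (V * V)%type R)
  : Prop :=
  (forall A, measurable A -> Pi (A `*` setT) = mu A) /\
  (forall B, measurable B -> Pi (setT `*` B) = nu B).

Definition wasserstein (p : nat) (mu nu : probability V R) : \bar R :=
  ereal_inf [set ((\int[Pi]_z (enorm (z.1 - z.2) ^+ p)%:E) `^ p%:R^-1)%E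
            | Pi in coupling mu nu].

Definition interp (xi : R) (z : V * V) : V := z.1 + xi *: (z.2 - z.1).

Lemma measurable_interp xi : measurable_fun [set: V * V] (interp xi).
Proof.
apply: measurable_fun_mx => i j.
rewrite (_ : (fun _ => _) = fun z : V * V =>
    z.1 i j + xi * (z.2 i j - z.1 i j)); last first.
  by apply/funext => z; rewrite !mxE.
have m1 : measurable_fun [set: V * V] (fun z => z.1 i j).
  exact: (measurableT_comp (measurable_coord i j) measurable_fst).
have m2 : measurable_fun [set: V * V] (fun z => z.2 i j).
  exact: (measurableT_comp (measurable_coord i j) measurable_snd).
apply: measurable_funD => //; apply: measurable_funM => //.
exact: measurable_funB.
Qed.

HB.instance Definition _ xi :=
  isMeasurableFun.Build _ _ _ _ (interp xi) (@measurable_interp xi).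

(* Pi_xi, the law of u + xi (v - u) under Pi(du, dv) *)
Definition interp_law (Pi : probability (V * V)%type R) (xi : R)
  : probability V R := distribution Pi (interp xi).

End wasserstein.

(* (R^dim)^{(x) k} is 'rV[R]_(tdim dim k) and Lin((R^dim)^{(x) k}, R^e) is    *)
(* 'M[R]_(tdim dim k, e), a matrix L acting by t |-> t *m L. The dimension    *)
(* dim ^ k is defined by recursion so that, by conversion, the tensor product *)
(* [t *t h] of a k-tensor t and a vector h is a (k + 1)-tensor.               *)
Fixpoint tdim (dim k : nat) : nat :=
  if k is k'.+1 then (tdim dim k' * dim)%N else 1%N.

(* x 0 (x) x 1 (x) ... (x) x (k - 1) *)
Fixpoint tensor (R : realType) (dim k : nat) (x : nat -> 'rV[R]_dim)
  : 'rV[R]_(tdim dim k) :=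
  if k is k'.+1 then tensor k' x *t x k' else 1%:M.

(* Lin(U (x) R^dim, R^e) -> Lin(R^dim, Lin(U, R^e)), L |-> h |-> L(. (x) h):  *)
(* a derivative is taken in the last tensor slot.                             *)
Definition slot (R : realType) (p dim e : nat) (L : 'M[R]_(p * dim, e))
    (h : 'rV[R]_dim) : 'M[R]_(p, e) :=
  \matrix_(i < p) (((delta_mx 0 i : 'rV[R]_p) *t h) *m L).

Definition mseq (a : seq nat) : nat := \max_(i <- a) i.

(* membership in A_k; [nth 0 a i] is a_{i+1} *)
Definition is_partseq (k : nat) (a : k.-tuple nat) : bool :=
  [forall i : 'I_k,
    if i == 0 :> nat then nth 0 a i == 1
    else 1 <= nth 0 a i <= (\max_(l < i) nth 0 a l).+1]%N.

(* The values of a sequence in A_k are at most k, so A_k is enumerated by     *)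
(* filtering {0, ..., k}^k (see mem_partseqs).                                *)
Definition partseqs (k : nat) : seq (k.-tuple nat) :=
  [seq a <- [seq map_tuple (@nat_of_ord k.+1) t | t : k.-tuple 'I_k.+1]
  | is_partseq a].

Lemma uniq_partseqs k : uniq (partseqs k).
Proof.
rewrite filter_uniq// map_inj_uniq ?enum_uniq// => s t /(congr1 val)/= st.
by apply/val_inj/(inj_map val_inj).
Qed.

Lemma mem_partseqs k (a : k.-tuple nat) : (a \in partseqs k) = is_partseq a.
Proof.
rewrite mem_filter andb_idr// => /forallP aP.
have a_le i : (i < k)%N -> (nth 0 a i <= i.+1)%N.
  elim/ltn_ind: i => i IH ik.
  move: (aP (Ordinal ik)) => /=; case: eqP => [i0 /eqP -> //|_ /andP[_ ai]].
  apply: (leq_trans ai); rewrite ltnS; apply/bigmax_leqP => l _.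
  by apply: (leq_trans (IH _ _ (ltn_trans _ ik))).
pose t : k.-tuple 'I_k.+1 := [tuple inord (nth 0%N a i) | i < k].
apply/mapP; exists t; first by rewrite mem_enum.
apply: eq_from_tnth => i; rewrite tnth_map tnth_mktuple inordK.
  by rewrite (tnth_nth 0%N).
by rewrite ltnS (leq_trans (a_le _ _)).
Qed.

Lemma mseq1 : mseq [tuple 1%N] = 1%N.
Proof. by rewrite /mseq big_seq1. Qed.

Lemma mseq_old k (a : k.-tuple nat) (j : 'I_(mseq a)) :
  mseq (rcons_tuple a j.+1) = mseq a.
Proof.
by rewrite /mseq /= -cats1 big_cat big_seq1; apply/maxn_idPl/(ltn_ord j).
Qed.

Lemma mseq_new k (a : k.-tuple nat) :
  mseq (rcons_tuple a (mseq a).+1) = (mseq a + 1)%N.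
Proof.
by rewrite /mseq /= -cats1 big_cat big_seq1 addn1; apply/maxn_idPr/leqnSn.
Qed.

(* (Omega, P) supports random vectors of every law: the usual richness        *)
(* assumption on the space of the lift (equivalently, P has no atoms).        *)
Definition rich d (Omega : measurableType d) (R : realType)
    (P : probability Omega R) : Prop :=
  forall (k : nat) (mu : probability 'rV[R]_k R),
    exists X : {mfun Omega >-> 'rV[R]_k}, eq_borel (distribution P X) mu.

Definition L2norm d (Omega : measurableType d) (R : realType)
    (P : probability Omega R) (dim : nat) (X : Omega -> 'rV[R]_dim) : R :=
  Num.sqrt (\int[P]_w (enorm (X w) ^+ 2)).

(* The map phi on P_2(R^dim) is Lions differentiable at mu with derivative    *)
(* g = d_mu phi(mu)(.), valued in Lin(R^dim, 'M_(p, e)) = 'M_(p * dim, e):    *)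
(* at some X of law mu the lift Y |-> phi(law of Y) on L^2(Omega; R^dim) is   *)
(* Frechet differentiable, with derivative g(X), that is H |-> E[g(X) . H].   *)
(* Here H = Y - X.                                                            *)
Definition is_lions_derivative d (Omega : measurableType d) (R : realType)
    (P : probability Omega R) (dim p e : nat)
    (phi : probability 'rV[R]_dim R -> 'M[R]_(p, e))
    (mu : probability 'rV[R]_dim R)
    (g : 'rV[R]_dim -> 'M[R]_(p * dim, e)) : Prop :=
  [/\ measurable_fun setT g,
      (\int[mu]_x (enorm (g x) ^+ 2)%:E < +oo)%E &
      exists2 X : {mfun Omega >-> 'rV[R]_dim}, eq_borel (distribution P X) mu &
        forall eps : R, 0 < eps -> exists2 delta : R, 0 < delta &
          forall Y : {mfun Omega >-> 'rV[R]_dim},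
            finite_moment 2 (distribution P Y) ->
            L2norm P (Y \- X) <= delta ->
            enorm (phi (distribution P Y) - phi (distribution P X)
                   - mxint P setT (fun w => slot (g (X w)) (Y w - X w)))
            <= eps * L2norm P (Y \- X)].

(* The functions d_a f; the point (v_1, ..., v_{m[a]}) of (R^dim)^{m[a]} is   *)
(* the matrix with rows v_i. Only a in A_k with 1 <= k <= n, and measures in  *)
(* P_2(R^dim), are ever relevant.                                             *)
Definition derivatives (R : realType) (dim e : nat) : Type :=
  forall (k : nat) (a : k.-tuple nat),
    probability 'rV[R]_dim R -> 'M[R]_(mseq a, dim) -> 'M[R]_(tdim dim k, e).

Section Cb.
Context {R : realType} {dim e : nat}.
Implicit Types Df : derivatives R dim e.

Definition bounded_by Df (K : R) k (a : k.-tuple nat) : Prop :=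
  forall mu v, finite_moment 2 mu -> enorm (Df k a mu v) <= K.

Definition lipschitz_by Df (K : R) k (a : k.-tuple nat) : Prop :=
  forall mu nu u v, finite_moment 2 mu -> finite_moment 2 nu ->
    ((enorm (Df k a mu u - Df k a nu v))%:E <=
     K%:E * (wasserstein 1 mu nu
             + (\sum_(i < mseq a) enorm (row i u - row i v))%:E))%E.

(* f is in C_b^(n)(P_2(R^dim); R^e) with derivatives Df. The first clause     *)
(* says that f is a function of Borel measures (see eq_borel).                *)
Definition Cb d (Omega : measurableType d) (P : probability Omega R) (n : nat)
    (f : probability 'rV[R]_dim R -> 'rV[R]_e) Df : Prop :=
  [/\ forall mu nu, finite_moment 2 mu -> eq_borel mu nu -> f mu = f nu,
      forall mu, finite_moment 2 mu ->
        is_lions_derivative P f mu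
          (fun x => Df 1 [tuple 1%N] mu (castmx (esym mseq1, erefl) x)),
      forall k (a : k.-tuple nat), (1 <= k <= n)%N -> is_partseq a ->
        exists K, bounded_by Df K a /\ lipschitz_by Df K a,
      forall k (a : k.-tuple nat), (1 <= k <= n.-1)%N -> is_partseq a ->
        forall mu v, finite_moment 2 mu ->
          differentiable (Df k a mu) v /\
          forall (j : 'I_(mseq a)) (h : 'rV[R]_dim),
            'd (Df k a mu) v (delta_mx j 0 *m h) =
            slot (Df k.+1 (rcons_tuple a j.+1) mu
                     (castmx (esym (mseq_old j), erefl) v)) h &
      forall k (a : k.-tuple nat), (1 <= k <= n.-1)%N -> is_partseq a ->
        forall mu v, finite_moment 2 mu ->
          is_lions_derivative P (fun mu' => Df k a mu' v) mu
            (fun x => Df k.+1 (rcons_tuple a (mseq a).+1) mu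
                         (castmx (esym (mseq_new a), erefl) (col_mx v x)))].

End Cb.

Section Taylor.
Context {R : realType} {dim e : nat}.
Local Notation V := 'rV[R]_dim.
Implicit Types (Df : derivatives R dim e) (Pi : probability (V * V)%type R).

(* (x)_{i=1}^k (v_{a_i} - u_{a_i}), for w = ((u_1, v_1), ..., (u_m, v_m)) *)
Definition increment k (a : k.-tuple nat) (w : (mseq a).-tuple (V * V))
  : 'rV[R]_(tdim dim k) :=
  tensor k (fun i => let z := nth (0, 0) w (nth 0%N a i).-1 in z.2 - z.1).

Definition points m (w : m.-tuple (V * V)) (xi : R) : 'M[R]_(m, dim) :=
  \matrix_(i < m) interp xi (tnth w i).

Definition starts m (w : m.-tuple (V * V)) : 'M[R]_(m, dim) :=
  \matrix_(i < m) (tnth w i).1.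

(* D^a f(mu)[Pi] *)
Definition Dint Df k (a : k.-tuple nat) (mu : probability V R) Pi
  : 'rV[R]_e :=
  mxint (power_prob Pi (mseq a)) setT
    (fun w => increment w *m Df k a mu (starts w)).

(* f^{a, mu, nu}, for a in A_n *)
Definition fint Df n (a : n.-tuple nat) (mu : probability V R) Pi
    (w : (mseq a).-tuple (V * V)) : 'M[R]_(tdim dim n, e) :=
  mxint (@lebesgue_measure R) `[0, 1]
    (fun xi => (1 - xi) ^+ n.-1 *:
       (Df n a (interp_law Pi xi) (points w xi) - Df n a mu (starts w))).

Definition remainder Df n (mu : probability V R) Pi : 'rV[R]_e :=
  (n.-1`!%:R)^-1 *:
  \sum_(a <- partseqs n)
    mxint (power_prob Pi (mseq a)) setT
      (fun w => increment w *m fint Df mu Pi w).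

End Taylor.

(* Main.v *)
Require Import Defs.
From HB Require Import structures.
From mathcomp Require Import all_boot all_order all_algebra.
From mathcomp Require Import all_classical all_reals all_analysis.
From mathcomp Require Import measurable_realfun ring lra.

(** The expansion is Taylor's formula for the function [t |-> f (Pi_t)] of one
    real variable, where [Pi_t] is the law of [u + t (v - u)] under [Pi].

    Its [k]-th derivative is the sum over the partition sequences [a] of length
    [k] of the integrals [flow_int a t] of [d_a f (Pi_t, x_1, ..., x_m)] against
    the increments [v - u], the points [x_i = u_i + t (v_i - u_i)] being moved
    along independent pairs of law [Pi]. Indeed, in [flow_int a t] the time
    enters through the points, whose motion produces the sequences [(a, j)] with
    [j <= m[a]], and through the law [Pi_t], whose motion produces one more
    independent pair and the sequence [(a, m[a] + 1)]; these are exactly the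
    partition sequences that extend [a] ([sum_partseqsS]). The derivatives are
    obtained from quadratic estimates that are uniform in time
    ([flow_int_expansion], [zeroth_expansion]).

    The heart of the matter is the motion of the law ([lions_expansion]): if the
    Lions derivative [g] of [phi] is bounded by [K] and [K]-Lipschitz, then for
    every coupling of [U] and [W]
    [phi (law W) - phi (law U) - E (g (law U) (U) . (W - U))]
    is at most [K ((E |W - U|)^2 + E |W - U|^2)]. Differentiability of the lift is
    known at a single variable [X] of the given law on a single space [Omega], and
    not at [U]. When [U] and [W] have finitely many values this does not matter:
    [Omega] has no atoms, so the values of [W] can be distributed over the level
    sets of [X] with the required probabilities ([exists_labelling]); the straight
    path from [U] to [W] is thus transported to [Omega], where it can be
    differentiated, and the mean value theorem concludes. As the constants do not
    depend on the number of values, rounding [U] and [W] to finer and finer grids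
    gives the general case.

    Taylor's formula with integral remainder ([taylor_integral]) and Fubini's
    theorem ([remainder_fubini]) then give the stated remainder. In it the
    Lipschitz bound controls the difference of the two values of [d_a f] by
    [K (E |v - u| + |v_1 - u_1| + ... + |v_m - u_m|)], so that the integrand is a
    sum of products of [n + 1] displacements. Such a product is at most the sum of
    the [n + 1]-st powers of its factors, and each of these integrates to the same
    moment of [Pi] ([enorm_remainder_term]). *)

Set Implicit Arguments.
Unset Strict Implicit.
Unset Printing Implicit Defensive.

Import Order.TTheory GRing.Theory Num.Theory.
Import numFieldNormedType.Exports.

Local Open Scope classical_set_scope.
Local Open Scope ring_scope.

(** * The Euclidean norm and the slots of a tensor *)

Section euclidean_norm.
Context {R : realType}.

Lemma enorm_ge0 m n (A : 'M[R]_(m, n)) : 0 <= enorm A.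
Proof. exact: sqrtr_ge0. Qed.

Lemma enorm_sqr m n (A : 'M[R]_(m, n)) :
  enorm A ^+ 2 = \sum_i \sum_j A i j ^+ 2.
Proof.
by rewrite sqr_sqrtr//; do 2 (apply: sumr_ge0 => ? _); exact: sqr_ge0.
Qed.

Lemma enorm0 m n : enorm (0 : 'M[R]_(m, n)) = 0.
Proof.
rewrite /enorm big1 ?sqrtr0// => i _; rewrite big1// => j _.
by rewrite mxE expr0n.
Qed.

Lemma enormZ m n (c : R) (A : 'M[R]_(m, n)) : enorm (c *: A) = `|c| * enorm A.
Proof.
rewrite -sqrtr_sqr -sqrtrM ?sqr_ge0//; congr Num.sqrt.
rewrite mulr_sumr; apply: eq_bigr => i _; rewrite mulr_sumr.
by apply: eq_bigr => j _; rewrite mxE exprMn.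
Qed.

Lemma enormN m n (A : 'M[R]_(m, n)) : enorm (- A) = enorm A.
Proof. by rewrite -scaleN1r enormZ normrN1 mul1r. Qed.

Lemma enormB m n (A B : 'M[R]_(m, n)) : enorm (A - B) = enorm (B - A).
Proof. by rewrite -enormN opprB. Qed.

Lemma ler_norm_enorm m n (A : 'M[R]_(m, n)) i j : `|A i j| <= enorm A.
Proof.
rewrite -sqrtr_sqr ler_wsqrtr// (bigD1 i)//= (bigD1 j)//= -!addrA lerDl.
apply: addr_ge0; first by apply: sumr_ge0 => ? _; exact: sqr_ge0.
by do 2 (apply: sumr_ge0 => ? _); exact: sqr_ge0.
Qed.

Lemma sum_sqr_ge0 (I : finType) (a : I -> R) : 0 <= \sum_i a i ^+ 2.
Proof. by apply: sumr_ge0 => ? _; exact: sqr_ge0. Qed.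

(** The discriminant of the nonnegative polynomial [sum_i (B a_i - C b_i)^2]
    with [B = sum b_i^2] and [C = sum a_i b_i]. *)
Lemma cauchy_schwarz_sum (I : finType) (a b : I -> R) :
  (\sum_i a i * b i) ^+ 2 <= (\sum_i a i ^+ 2) * (\sum_i b i ^+ 2).
Proof.
set A := \sum_i a i ^+ 2; set B := \sum_i b i ^+ 2; set C := \sum_i a i * b i.
have B0 : 0 <= B by exact: sum_sqr_ge0.
have : 0 <= \sum_i (B * a i - C * b i) ^+ 2 by exact: sum_sqr_ge0.
rewrite (eq_bigr (fun i => B ^+ 2 * a i ^+ 2 - 2 * B * C * (a i * b i)
  + C ^+ 2 * b i ^+ 2)); last by move=> i _; ring.
rewrite big_split/= sumrB -!mulr_sumr -/A -/B -/C => H.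
have {}H : 0 <= B * (A * B - C ^+ 2).
  by rewrite (le_trans H)// le_eqVlt; apply/orP; left; apply/eqP; ring.
have [B_gt0|] := ltP 0 B; first by rewrite pmulr_rge0 // subr_ge0 in H.
move=> B_le0; have {}B0 : B = 0 by apply/eqP; rewrite eq_le B_le0 B0.
have b0 i : b i = 0.
  apply/eqP; rewrite -sqrf_eq0.
  by rewrite (psumr_eq0P _ B0)// => ? _; exact: sqr_ge0.
by rewrite /C big1 ?expr0n//= ?B0 ?mulr0// => i _; rewrite b0 mulr0.
Qed.

Lemma enorm_pair m n (A : 'M[R]_(m, n)) :
  enorm A = Num.sqrt (\sum_(p : 'I_m * 'I_n) A p.1 p.2 ^+ 2).
Proof. by rewrite /enorm pair_bigA. Qed.

Lemma cauchy_schwarz m n (A B : 'M[R]_(m, n)) :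
  \sum_i \sum_j A i j * B i j <= enorm A * enorm B.
Proof.
rewrite pair_bigA/= !enorm_pair -sqrtrM ?sum_sqr_ge0//.
rewrite (le_trans (ler_norm _))// -sqrtr_sqr ler_wsqrtr//.
exact: cauchy_schwarz_sum.
Qed.

Lemma ler_enormD m n (A B : 'M[R]_(m, n)) : enorm (A + B) <= enorm A + enorm B.
Proof.
rewrite -(@ler_pXn2r _ 2)// ?nnegrE ?addr_ge0 ?enorm_ge0//.
rewrite sqrrD !enorm_sqr.
rewrite (eq_bigr (fun i => \sum_j A i j ^+ 2 + \sum_j (A i j * B i j) *+ 2
   + \sum_j B i j ^+ 2)); last first.
  by move=> i _; rewrite -!big_split/=; apply: eq_bigr => j _; rewrite mxE sqrrD.
rewrite !big_split/= lerD2r lerD2l.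
rewrite (eq_bigr (fun i => (\sum_j A i j * B i j) *+ 2)); last first.
  by move=> i _; rewrite sumrMnl.
by rewrite sumrMnl lerMn2r cauchy_schwarz.
Qed.

Lemma ler_enorm_sum m n (I : Type) (r : seq I) (A : I -> 'M[R]_(m, n)) :
  enorm (\sum_(i <- r) A i) <= \sum_(i <- r) enorm (A i).
Proof.
elim: r => [|i r IH]; first by rewrite !big_nil enorm0.
by rewrite !big_cons (le_trans (ler_enormD _ _))// lerD2l.
Qed.

Lemma ler_enormB m n (A B : 'M[R]_(m, n)) : enorm (A - B) <= enorm A + enorm B.
Proof. by rewrite (le_trans (ler_enormD _ _))// enormN. Qed.

Lemma ler_dist_enorm m n (A B : 'M[R]_(m, n)) :
  `|enorm A - enorm B| <= enorm (A - B).
Proof.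
rewrite ler_norml; apply/andP; split.
  have := ler_enormD (B - A) A; rewrite subrK enormB => BA.
  by rewrite lerBrDr addrC lerBlDr addrC.
by have := ler_enormD (A - B) B; rewrite subrK lerBlDr.
Qed.

Lemma enorm_delta m n (i : 'I_m) (j : 'I_n) :
  enorm (delta_mx i j : 'M[R]_(m, n)) = 1.
Proof.
rewrite /enorm (bigD1 i)//= (bigD1 j)//= !mxE !eqxx/= expr1n.
rewrite big1 ?addr0 => [|k kj]; last by rewrite mxE (negbTE kj) andbF expr0n.
rewrite big1 ?addr0 ?sqrtr1// => k ki; rewrite big1// => l _.
by rewrite mxE (negbTE ki) expr0n.
Qed.

Lemma ler_enorm_l1 m n (A : 'M[R]_(m, n)) :
  enorm A <= \sum_i \sum_j `|A i j|.
Proof.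
rewrite {1}(matrix_sum_delta A) (le_trans (ler_enorm_sum _ _))//.
apply: ler_sum => i _; rewrite (le_trans (ler_enorm_sum _ _))//.
by apply: ler_sum => j _; rewrite enormZ enorm_delta mulr1.
Qed.

Lemma enorm_le_coord m n (A : 'M[R]_(m, n)) (c : R) :
  (forall i j, `|A i j| <= c) -> enorm A <= (m * n)%:R * c.
Proof.
move=> Ac; rewrite (le_trans (ler_enorm_l1 _))//.
have -> : (m * n)%:R * c = \sum_(i < m) \sum_(j < n) c.
  by rewrite !sumr_const !card_ord -mulrnA mulnC mulr_natl.
by apply: ler_sum => i _; exact: ler_sum.
Qed.

Lemma enorm_mulmx m n p (A : 'M[R]_(m, n)) (B : 'M[R]_(n, p)) :
  enorm (A *m B) <= enorm A * enorm B.
Proof.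
rewrite -sqrtrM; last by apply: sumr_ge0 => ? _; exact: sum_sqr_ge0.
rewrite ler_wsqrtr// mulr_suml; apply: ler_sum => i _.
rewrite exchange_big/= mulr_sumr; apply: ler_sum => k _.
by rewrite mxE; exact: cauchy_schwarz_sum.
Qed.

Lemma tens_rowE p q (a : 'rV[R]_p) (b : 'rV[R]_q) k :
  (a *t b : 'rV_(p * q)) 0 k
  = a 0 (mxtens_unindex k).1 * b 0 (mxtens_unindex k).2.
Proof. by rewrite mxE !(ord1 (_ : 'I_1)). Qed.

Lemma enorm_tens p q (a : 'rV[R]_p) (b : 'rV[R]_q) :
  enorm (a *t b : 'rV_(p * q)) = enorm a * enorm b.
Proof.
rewrite -sqrtrM; last by apply: sumr_ge0 => ? _; exact: sum_sqr_ge0.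
congr Num.sqrt; rewrite !big_ord1 mulr_sum; apply: eq_bigr => k _.
by rewrite tens_rowE exprMn.
Qed.

(** The defining property of [slot], that filling the last slot of [L] with [h]
    and then applying it to [t] is applying [L] to the tensor of [t] and [h]. *)
Lemma mul_slot p q e (t : 'rV[R]_p) (L : 'M[R]_(p * q, e)) (h : 'rV[R]_q) :
  t *m slot L h = (t *t h : 'rV_(p * q)) *m L.
Proof.
have -> : (t *t h : 'rV_(p * q)) =
    \sum_i t 0 i *: ((delta_mx 0 i : 'rV[R]_p) *t h : 'rV_(p * q)).
  apply/rowP => k; rewrite summxE tens_rowE (bigD1 (mxtens_unindex k).1)//=.
  rewrite big1 ?addr0; first by rewrite mxE tens_rowE mxE !eqxx mul1r.
  move=> i ik; rewrite mxE tens_rowE mxE eq_sym andbC (negbTE ik).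
  by rewrite mul0r mulr0.
rewrite mulmx_suml mulmx_sum_row; apply: eq_bigr => i _.
by rewrite -scalemxAl /slot rowK.
Qed.

Lemma slot_row p q e (L : 'M[R]_(p * q, e)) (h : 'rV[R]_q) i :
  row i (slot L h) = ((delta_mx 0 i : 'rV[R]_p) *t h : 'rV_(p * q)) *m L.
Proof. by rewrite rowE mul_slot. Qed.

(** In coordinates [slot L h] is linear in [L] and in [h]; this also gives its
    measurability when [L] and [h] vary. *)
Lemma slotE p q e (L : 'M[R]_(p * q, e)) (h : 'rV[R]_q) i j :
  slot L h i j = \sum_l h 0 l * L (mxtens_index (i, l)) j.
Proof.
have -> : slot L h i j = row i (slot L h) 0 j by rewrite [RHS]mxE.
rewrite slot_row mxE (reindex (@mxtens_index p q))/=; last first.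
  exists (@mxtens_unindex p q) => x _; first exact: mxtens_indexK.
  exact: mxtens_unindexK.
pose G i' l := (delta_mx 0 i : 'rV[R]_p) 0 i' * h 0 l
  * L (mxtens_index (i', l)) j.
rewrite (eq_bigr (fun x => G x.1 x.2)); last first.
  by move=> [i' l] _; rewrite tens_rowE mxtens_indexK.
rewrite -(pair_bigA _ G)/= (bigD1 i)//= [X in _ + X]big1 ?addr0; last first.
  by move=> k ki; rewrite big1// => l _; rewrite /G mxE (negbTE ki) andbF !mul0r.
by apply: eq_bigr => l _; rewrite /G mxE !eqxx mul1r.
Qed.

Lemma enorm_slot_coord p q e (L : 'M[R]_(p * q, e)) (h : 'rV[R]_q) i j :
  `|slot L h i j| <= enorm L * enorm h.
Proof.
have -> : slot L h i j = row i (slot L h) 0 j by rewrite [RHS]mxE.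
rewrite slot_row (le_trans (ler_norm_enorm _ _ _))//.
by rewrite (le_trans (enorm_mulmx _ _))// enorm_tens enorm_delta mul1r mulrC.
Qed.

Lemma slotZ p q e (L : 'M[R]_(p * q, e)) (c : R) (h : 'rV[R]_q) :
  slot L (c *: h) = c *: slot L h.
Proof.
apply/matrixP => i j; rewrite slotE [RHS]mxE slotE mulr_sumr.
by apply: eq_bigr => l _; rewrite mxE mulrA.
Qed.

Lemma slotBl p q e (L L' : 'M[R]_(p * q, e)) (h : 'rV[R]_q) :
  slot (L - L') h = slot L h - slot L' h.
Proof.
apply/matrixP => i j; rewrite slotE [RHS]mxE [X in _ = _ + X]mxE !slotE -sumrB.
by apply: eq_bigr => l _; rewrite !mxE mulrBr.
Qed.

Lemma slotBr p q e (L : 'M[R]_(p * q, e)) (h h' : 'rV[R]_q) :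
  slot L (h - h') = slot L h - slot L h'.
Proof.
apply/matrixP => i j; rewrite slotE [RHS]mxE [X in _ = _ + X]mxE !slotE -sumrB.
by apply: eq_bigr => l _; rewrite !mxE mulrBl.
Qed.

End euclidean_norm.

(** * Power inequalities and integrals of matrices *)

Section real_inequalities.
Context {R : realType}.

Lemma ler_addX (a b : R) p : 0 <= a -> 0 <= b ->
  (a + b) ^+ p <= 2 ^+ p * (a ^+ p + b ^+ p).
Proof.
move=> a0 b0; wlog ab : a b a0 b0 / a <= b.
  move=> H; have [ab|ba] := leP a b; first exact: H.
  by rewrite [a + b]addrC [a ^+ p + _]addrC H// ltW.
rewrite (@le_trans _ _ ((2 * b) ^+ p))//.
  by rewrite lerXn2r// ?nnegrE ?addr_ge0 ?mulr_ge0//; lra.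
by rewrite exprMn ler_wpM2l ?exprn_ge0// lerDr exprn_ge0.
Qed.

Lemma ler_expr1D (x : R) p q : 0 <= x -> (p <= q)%N -> x ^+ p <= 1 + x ^+ q.
Proof.
move=> x0 pq; have [x1|x1] := leP x 1.
  by rewrite (le_trans (exprn_ile1 _ x0 x1))// lerDl exprn_ge0.
by rewrite (le_trans (ler_weXn2l _ pq)) ?ltW// ltrDr.
Qed.

(** Every factor is at most the largest one, whose [n]-th power is a term of the sum. *)
Lemma prod_le_sumX n (x : 'I_n -> R) : (0 < n)%N -> (forall i, 0 <= x i) ->
  \prod_i x i <= \sum_i x i ^+ n.
Proof.
case: n x => // n x _ x0; pose i0 := [arg max_(i > ord0 : 'I_n.+1) x i]%O.
have x_le i : x i <= x i0.
  by rewrite /i0; case: arg_maxP => // j _ jmax; exact: jmax.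
rewrite (@le_trans _ _ (x i0 ^+ n.+1))//.
  rewrite -[X in _ ^+ X](card_ord n.+1) -prodr_const.
  by apply: ler_prod => i _; rewrite x0 x_le.
by rewrite (bigD1 i0)//= lerDl sumr_ge0// => i _; rewrite exprn_ge0.
Qed.

End real_inequalities.

Section real_integrals.
Context d (T : measurableType d) (R : realType) (mu : {measure set T -> \bar R}).
Implicit Types (f g : T -> R) (D : set T).

Lemma integrable_dominated D f g : measurable D -> measurable_fun D f ->
  (forall x, D x -> `|f x| <= g x) -> mu.-integrable D (EFin \o g) ->
  mu.-integrable D (EFin \o f).
Proof.
move=> mD mf fg; apply: le_integrable => //; first exact/measurable_EFinP.
by move=> x Dx /=; rewrite lee_fin (le_trans (fg _ Dx))// ler_norm.
Qed.

Lemma EFin_Rintegral D f : measurable D -> mu.-integrable D (EFin \o f) ->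
  (\int[mu]_(x in D) f x)%:E = (\int[mu]_(x in D) (f x)%:E)%E.
Proof. by move=> mD fi; rewrite fineK//; exact: integrable_fin_num. Qed.

Lemma integrable_sumr D (I : Type) (r : seq I) (f : I -> T -> R) :
  measurable D ->
  (forall i, mu.-integrable D (EFin \o f i)) ->
  mu.-integrable D (EFin \o (fun x => \sum_(i <- r) f i x)).
Proof.
move=> mD fi; rewrite (_ : _ \o _ = fun x => (\sum_(i <- r) (f i x)%:E)%E).
  by apply: integrable_sum => // i _; exact: fi.
by apply/funext => x /=; rewrite sumEFin.
Qed.

Lemma Rintegral_sum D (I : Type) (r : seq I) (f : I -> T -> R) :
  measurable D ->
  (forall i, mu.-integrable D (EFin \o f i)) ->
  \int[mu]_(x in D) (\sum_(i <- r) f i x) = \sum_(i <- r) \int[mu]_(x in D) f i x.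
Proof.
move=> mD fi; elim: r => [|i r IH].
  rewrite big_nil; under eq_Rintegral do rewrite big_nil.
  by rewrite Rintegral_cst// mul0r.
rewrite big_cons -IH -RintegralD//; last exact: integrable_sumr.
by under eq_Rintegral do rewrite big_cons.
Qed.

Lemma integrable_mulr D f (c : R) : measurable D -> mu.-integrable D (EFin \o f) ->
  mu.-integrable D (EFin \o (fun x => c * f x)).
Proof. by move=> mD /(integrableZl mD c); apply: eq_integrable. Qed.

Lemma integrable_addr D f g : measurable D ->
  mu.-integrable D (EFin \o f) -> mu.-integrable D (EFin \o g) ->
  mu.-integrable D (EFin \o (fun x => f x + g x)).
Proof. by move=> mD fi gi; have := integrableD mD fi gi; apply: eq_integrable. Qed.

Lemma integrable_subr D f g : measurable D ->
  mu.-integrable D (EFin \o f) -> mu.-integrable D (EFin \o g) ->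
  mu.-integrable D (EFin \o (fun x => f x - g x)).
Proof. by move=> mD fi gi; have := integrableB mD fi gi; apply: eq_integrable. Qed.

Lemma measurable_enorm m n D (F : T -> 'M[R]_(m, n)) :
  measurable D ->
  (forall i j, measurable_fun D (fun x => F x i j)) ->
  measurable_fun D (fun x => enorm (F x)).
Proof.
move=> mD mF; have ms : measurable_fun [set: R] Num.sqrt.
  by apply: continuous_measurable_fun; exact: sqrt_continuous.
rewrite /enorm; apply: (measurableT_comp ms).
by apply: measurable_sum => i; apply: measurable_sum => j; exact: measurable_funX.
Qed.

Lemma integrable_coord m n D (F : T -> 'M[R]_(m, n)) i j : measurable D ->
  (forall i j, measurable_fun D (fun x => F x i j)) ->
  mu.-integrable D (EFin \o (fun x => enorm (F x))) ->
  mu.-integrable D (EFin \o (fun x => F x i j)).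
Proof.
move=> mD mF; apply: integrable_dominated => // x _; exact: ler_norm_enorm.
Qed.

(** Test the integral against its own direction: the squared norm of
    [I = mxint F] is the integral of the inner product of [I] with [F]. *)
Lemma enorm_mxint m n D (F : T -> 'M[R]_(m, n)) : measurable D ->
  (forall i j, measurable_fun D (fun x => F x i j)) ->
  mu.-integrable D (EFin \o (fun x => enorm (F x))) ->
  enorm (mxint mu D F) <= \int[mu]_(x in D) enorm (F x).
Proof.
move=> mD mF iF; set I := mxint mu D F.
have iFij i j : mu.-integrable D (EFin \o (fun x => F x i j)).
  exact: integrable_coord.
have iI i j : mu.-integrable D (EFin \o (fun x => I i j * F x i j)).
  by apply: integrable_mulr => //; exact: iFij.
have iIi i : mu.-integrable D (EFin \o (fun x => \sum_j I i j * F x i j)).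
  by apply: integrable_sumr => // j; exact: iI.
have : enorm I ^+ 2 <= enorm I * \int[mu]_(x in D) enorm (F x).
  have -> : enorm I ^+ 2 = \int[mu]_(x in D) (\sum_i \sum_j I i j * F x i j).
    rewrite enorm_sqr Rintegral_sum//; apply: eq_bigr => i _.
    rewrite Rintegral_sum//; apply: eq_bigr => j _.
    by rewrite RintegralZl// expr2 {2}/I mxE.
  rewrite -RintegralZl//; apply: le_Rintegral => //.
  - exact: integrable_sumr.
  - exact: integrable_mulr.
  - by move=> x _; exact: cauchy_schwarz.
have [->|I0] := eqVneq (enorm I) 0.
  by move=> _; apply: Rintegral_ge0 => x _; exact: enorm_ge0.
by rewrite expr2 ler_pM2l// lt_def I0 enorm_ge0.
Qed.

End real_integrals.

Section lipschitz_functions.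
Context {R : realType}.

(** The topology on matrices comes from the maximum of the coordinates, so that
    control by the l1 distance of the coordinates gives continuity. *)
Lemma continuous_coords m n (h : 'M[R]_(m, n) -> R) (c : R) :
  (forall A B, `|h A - h B| <= c * \sum_i \sum_j `|A i j - B i j|) ->
  continuous h.
Proof.
move=> hc A; have FA : Filter (nbhs A) by exact: nbhs_filter.
apply/cvgrPdist_le => e e0.
have s0 B : 0 <= \sum_i \sum_j `|A i j - B i j| by do 2 apply: sumr_ge0 => ? _.
pose e' := e / (`|c| * (m * n)%:R + 1).
have e'0 : 0 < e' by rewrite divr_gt0// ltr_wpDl// mulr_ge0.
suff : nbhs A [set B | `|h A - h B| <= e] by [].
apply/nbhs_ballP; exists e' => // B [_ AB].
rewrite /= (le_trans (hc _ _))// (@le_trans _ _ (`|c| * ((m * n)%:R * e')))//.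
  rewrite (@le_trans _ _ (`|c| * \sum_i \sum_j `|A i j - B i j|))//.
    by rewrite ler_wpM2r// ler_norm.
  rewrite ler_wpM2l//.
  have -> : (m * n)%:R * e' = \sum_(i < m) \sum_(j < n) e'.
    by rewrite !sumr_const !card_ord -mulrnA mulnC mulr_natl.
  do 2 (apply: ler_sum => ? _); exact/ltW/AB.
rewrite mulrA mulrCA ger_pMr// ler_pdivrMr ?mul1r ?ltr_wpDl ?mulr_ge0//.
by rewrite lerDl.
Qed.

Lemma measurable_continuous_mx d (T : measurableType d) m n
    (h : 'M[R]_(m, n) -> R) (F : T -> 'M[R]_(m, n)) :
  continuous h -> (forall i j, measurable_fun setT (fun x => F x i j)) ->
  measurable_fun setT (h \o F).
Proof.
move=> ch mF; apply: measurableT_comp; last exact: measurable_fun_mx.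
apply: (measurability _ (RGenOInfty.measurableE R)).
move=> _ [_ [x ->] <-]; rewrite setTI; apply: sub_sigma_algebra.
apply: (@open_comp _ _ h); first by move=> A _; exact: ch.
exact: interval_open.
Qed.

End lipschitz_functions.

(** * Powers of a probability measure *)

Section power_probability.
Context d (T : measurableType d) (R : realType) (P : probability T R).
Local Open Scope ereal_scope.

Definition trcons n (w : n.-tuple T * T) : n.+1.-tuple T :=
  [tuple of rcons w.1 w.2].

Lemma measurable_trcons n : measurable_fun [set: n.-tuple T * T] (@trcons n).
Proof.
apply/measurable_fun_tnthP => i /=.
have [lein|ltin] := ltnP i n.
  rewrite (_ : _ \o _ = (@tnth _ T ^~ (Ordinal lein)) \o fst).
    by apply: measurableT_comp => //; exact: measurable_tnth.
  apply/funext => w /=; rewrite (tnth_nth w.2) (tnth_nth w.2)/=.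
  by rewrite nth_rcons size_tuple lein.
rewrite (_ : _ \o _ = snd) //; apply/funext => w /=.
rewrite (tnth_nth w.2)/= nth_rcons size_tuple.
have -> : (i = n :> nat) by apply/eqP; rewrite eqn_leq ltin -ltnS ltn_ord.
by rewrite ltnn eqxx.
Qed.

HB.instance Definition _ n :=
  isMeasurableFun.Build _ _ _ _ (@trcons n) (@measurable_trcons n).

Lemma ge0_integral_power_cons n (h : n.+1.-tuple T -> \bar R) :
  measurable_fun setT h -> (forall w, 0 <= h w) ->
  \int[power_prob P n.+1]_w h w =
  \int[P]_z \int[power_prob P n]_w h (tcons (z, w)).
Proof.
move=> mh h0; rewrite ge0_integral_distribution// fubini_tonelli1//.
  by apply: measurableT_comp => //; exact: measurable_tcons.
by move=> z; exact: h0.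
Qed.

Lemma ge0_integral_power_tnth n (i : 'I_n) (h : T -> \bar R) :
  measurable_fun setT h -> (forall z, 0 <= h z) ->
  \int[power_prob P n]_w h (tnth w i) = \int[P]_z h z.
Proof.
move=> mh h0; elim: n i => [|n IH] i; first by case: i.
rewrite ge0_integral_power_cons//; last first.
  by apply: measurableT_comp => //; exact: measurable_tnth.
case: (unliftP ord0 i) => [j ->|->]; last first.
  apply: eq_integral => z _.
  have := @integral_cst _ _ _ (power_prob P n) setT measurableT (h z).
  rewrite /cst => ->; rewrite -[RHS]mule1; congr (_ * _).
  exact: probability_setT.
transitivity (\int[P]_z \int[P]_z' h z').
  apply: eq_integral => z _; rewrite -(IH j); apply: eq_integral => w _.
  by congr h; rewrite !(tnth_nth z).
have := @integral_cst _ _ _ P setT measurableT (\int[P]_z h z).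
rewrite /cst => ->; rewrite -[RHS]mule1; congr (_ * _).
exact: probability_setT.
Qed.

(** The product measure is built by adding variables in front, whereas a new
    partition block adds a variable at the end: Tonelli's theorem moves the last
    variable across the first ones. *)
Lemma ge0_integral_power_rcons n (h : n.+1.-tuple T -> \bar R) :
  measurable_fun setT h -> (forall w, 0 <= h w) ->
  \int[power_prob P n.+1]_w h w =
  \int[power_prob P n]_w \int[P]_z h (trcons (w, z)).
Proof.
elim: n h => [|n IH] h mh h0.
  rewrite ge0_integral_power_cons//= integral_dirac//; last first.
    apply: (@measurable_fun_fubini_tonelli_F _ _ _ _ _ P
      (fun w => h (trcons w))) => //.
    exact: measurableT_comp.
  rewrite diracT mul1e; apply: eq_integral => z _.
  rewrite integral_dirac// ?diracT ?mul1e; last first.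
    apply: measurableT_comp => //.
    by apply: (@measurable_fun_pair2 _ _ _ _ _ _ (@tcons _ _ 0)).
  by congr h; apply/val_inj.
rewrite ge0_integral_power_cons//.
pose k (w : n.+1.-tuple T) := \int[P]_z h (trcons (w, z)).
have mk : measurable_fun setT k.
  apply: (@measurable_fun_fubini_tonelli_F _ _ _ _ _ P
    (fun w => h (trcons w))) => //.
  exact: measurableT_comp.
rewrite [RHS](@ge0_integral_power_cons n k) => //; last first.
  by move=> w; apply: integral_ge0.
apply: eq_integral => z _; rewrite IH//; last first.
  apply: measurableT_comp => //.
  exact: (@measurable_fun_pair2 _ _ _ _ _ _ (@tcons _ _ n.+1)).
apply: eq_integral => w _; apply: eq_integral => z' _.
by congr h; apply/val_inj.
Qed.

Lemma power_probSE n A : measurable A ->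
  power_prob P n.+1 A = (power_prob P n \x P) (@trcons n @^-1` A).
Proof.
move=> mA.
have mA' : measurable (@trcons n @^-1` A).
  by rewrite -[_ @^-1` _]setTI; exact: measurable_trcons.
have := @ge0_integral_power_rcons n (fun w => (\1_A w)%:E).
rewrite integral_indic// setIT => ->//; last first.
  exact/measurable_EFinP.
rewrite -(@fubini_tonelli1 _ _ _ _ _ _ P (fun w => (\1_A (trcons w))%:E))//.
  by rewrite (eq_integral (fun w => (\1_(@trcons n @^-1` A) w)%:E))// integral_indic// setIT.
by apply/measurable_EFinP; apply: measurableT_comp => //.
Qed.

(** The law of [trcons] under the product of [power_prob P n] and [P] is
    [power_prob P n.+1], so that integrability transfers as well. *)
Lemma integral_power_rcons n (h : n.+1.-tuple T -> R) :
  (power_prob P n.+1).-integrable setT (EFin \o h) ->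
  (power_prob P n \x P).-integrable setT (EFin \o (fun w => h (trcons w))) /\
  \int[power_prob P n.+1]_w (h w)%:E =
    \int[power_prob P n \x P]_w (h (trcons w))%:E.
Proof.
move=> hi.
have e g : \int[power_prob P n.+1]_w g w =
    \int[distribution (power_prob P n \x P) (@trcons n)]_w g w.
  by apply: eq_measure_integral => A mA _; exact: power_probSE.
have mh := measurable_int _ hi.
have hi' : (power_prob P n \x P).-integrable setT
    (EFin \o (fun w => h (trcons w))).
  apply/integrableP; split; first exact: (measurableT_comp mh (@measurable_trcons n)).
  case/integrableP: hi => _; rewrite e ge0_integral_distribution//.
  exact: measurableT_comp.
by split=> //; rewrite e integral_distribution.
Qed.

End power_probability.

(** * Laws, moments and the Wasserstein distance *)

Section laws.
Context {R : realType} {dim : nat}.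
Local Notation V := 'rV[R]_dim.

Definition mk_mfun d (Z : measurableType d) (f : Z -> V)
    (mf : measurable_fun [set: Z] f) : {mfun Z >-> V} :=
  HB.pack f (isMeasurableFun.Build _ _ _ _ f mf).

Lemma measurable_mfun_coord d (Z : measurableType d) (X : {mfun Z >-> V}) i j :
  measurable_fun setT (fun z => X z i j).
Proof.
exact: (measurableT_comp (measurable_coord i j) (@measurable_funPT _ _ _ _ X)).
Qed.

Lemma measurable_lin d (Z : measurableType d) (X Y : {mfun Z >-> V}) (a b : R) :
  measurable_fun setT (fun z => a *: X z + b *: Y z).
Proof.
apply: measurable_fun_mx => i j.
rewrite (_ : (fun _ => _) = fun z => a * X z i j + b * Y z i j); last first.
  by apply/funext => z; rewrite !mxE.
by apply: measurable_funD; apply: measurable_funM => //;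
  exact: measurable_mfun_coord.
Qed.

Lemma measurable_distX d (Z : measurableType d) (X Y : {mfun Z >-> V}) p :
  measurable_fun setT (fun z => enorm (X z - Y z) ^+ p).
Proof.
apply/measurable_funX/measurable_enorm => // i j.
rewrite (_ : (fun _ => _) = fun z => X z i j - Y z i j).
  by apply: measurable_funB; exact: measurable_mfun_coord.
by apply/funext => z; rewrite !mxE.
Qed.

Lemma measurable_enormX d (Z : measurableType d) (X : {mfun Z >-> V}) p :
  measurable_fun setT (fun z => enorm (X z) ^+ p).
Proof.
by apply/measurable_funX/measurable_enorm => // i j; exact: measurable_mfun_coord.
Qed.

Lemma measurable_enormX_id p :
  measurable_fun [set: V] (fun x => enorm x ^+ p).
Proof.
by apply/measurable_funX/measurable_enorm => // i j; exact: measurable_coord.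
Qed.

Lemma integrable_enormX d (Z : measurableType d) (Q : probability Z R)
    (X : {mfun Z >-> V}) p :
  Q.-integrable setT (EFin \o (fun z => enorm (X z) ^+ p)) <->
  (\int[Q]_z (enorm (X z) ^+ p)%:E < +oo)%E.
Proof.
have -> : (\int[Q]_z (enorm (X z) ^+ p)%:E =
    \int[Q]_z `|(EFin \o (fun z => enorm (X z) ^+ p)%R) z|)%E.
  by apply: eq_integral => z _ /=; rewrite ger0_norm ?exprn_ge0 ?enorm_ge0.
split=> [/integrableP[]//|h]; apply/integrableP; split => //.
by apply/measurable_EFinP; exact: measurable_enormX.
Qed.

Lemma finite_moment_law d (Z : measurableType d) (Q : probability Z R)
    (X : {mfun Z >-> V}) p :
  finite_moment p (distribution Q X) <->
  Q.-integrable setT (EFin \o (fun z => enorm (X z) ^+ p)).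
Proof.
rewrite /finite_moment ge0_integral_distribution; last 2 first.
- apply/measurable_EFinP; exact: measurable_enormX_id.
- by move=> y; rewrite lee_fin exprn_ge0 ?enorm_ge0.
exact: iff_sym (integrable_enormX Q X p).
Qed.

(** On a probability space [x ^+ p <= 1 + x ^+ q] bounds lower moments by higher ones. *)
Lemma integrable_expW d (Z : measurableType d) (Q : probability Z R)
    (f : Z -> R) p q : (p <= q)%N -> measurable_fun setT f ->
  (forall z, 0 <= f z) ->
  Q.-integrable setT (EFin \o (fun z => f z ^+ q)) ->
  Q.-integrable setT (EFin \o (fun z => f z ^+ p)).
Proof.
move=> pq mf f0 qi.
apply: (@integrable_dominated _ _ _ _ _ _ (fun z => 1 + f z ^+ q)) => //.
- exact: measurable_funX.
- by move=> z _; rewrite ger0_norm ?exprn_ge0// ler_expr1D.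
- by apply: integrable_addr => //; exact: finite_measure_integrable_cst.
Qed.

Lemma finite_momentW p q (mu : probability V R) :
  (p <= q)%N -> finite_moment q mu -> finite_moment p mu.
Proof.
pose X := mk_mfun (@measurable_id _ V setT).
move=> pq /(integrable_enormX mu X q) h; apply/(integrable_enormX mu X p).
apply: (@integrable_expW _ _ mu (fun x => enorm x) p q) => //.
- exact: (@measurable_enormX_id 1).
- by move=> z; exact: enorm_ge0.
Qed.

Lemma integrable_lin d (Z : measurableType d) (Q : probability Z R)
    (X Y : {mfun Z >-> V}) (a b : R) p :
  finite_moment p (distribution Q X) -> finite_moment p (distribution Q Y) ->
  Q.-integrable setT (EFin \o (fun z => enorm (a *: X z + b *: Y z) ^+ p)).
Proof.
move=> /finite_moment_law iX /finite_moment_law iY.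
apply: (@integrable_dominated _ _ _ _ _ _ (fun z =>
  2 ^+ p * (`|a| ^+ p * enorm (X z) ^+ p + `|b| ^+ p * enorm (Y z) ^+ p))) => //.
- exact: (measurable_enormX (mk_mfun (measurable_lin X Y a b))).
- move=> z _; rewrite ger0_norm ?exprn_ge0 ?enorm_ge0//.
  rewrite -!exprMn -!enormZ.
  rewrite (le_trans _ (ler_addX _ (enorm_ge0 _) (enorm_ge0 _)))//.
  by rewrite lerXn2r ?nnegrE ?addr_ge0 ?enorm_ge0// ler_enormD.
- by apply: integrable_mulr => //; apply: integrable_addr => //; exact: integrable_mulr.
Qed.

Lemma finite_moment_lin d (Z : measurableType d) (Q : probability Z R)
    (X Y : {mfun Z >-> V}) (a b : R) p :
  finite_moment p (distribution Q X) -> finite_moment p (distribution Q Y) ->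
  finite_moment p (distribution Q (mk_mfun (measurable_lin X Y a b))).
Proof. by move=> iX iY; apply/finite_moment_law; exact: integrable_lin. Qed.

Lemma integrable_dist d (Z : measurableType d) (Q : probability Z R)
    (X Y : {mfun Z >-> V}) p :
  finite_moment p (distribution Q X) -> finite_moment p (distribution Q Y) ->
  Q.-integrable setT (EFin \o (fun z => enorm (X z - Y z) ^+ p)).
Proof.
move=> iX iY; have := integrable_lin 1 (-1) iX iY.
by apply: eq_integrable => // z _ /=; rewrite scale1r scaleN1r.
Qed.

Lemma eq_borel_finite_moment (mu nu : probability V R) p :
  eq_borel mu nu -> finite_moment p mu -> finite_moment p nu.
Proof.
rewrite /finite_moment => munu; apply: le_lt_trans.
rewrite le_eqVlt; apply/orP; left; apply/eqP.
by apply: eq_measure_integral => A mA _; exact/esym/munu.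
Qed.

Lemma eq_borel_sym (mu nu : probability V R) : eq_borel mu nu -> eq_borel nu mu.
Proof. by move=> h A mA; rewrite h. Qed.

Lemma eq_borel_law d (Z : measurableType d) (Q : probability Z R)
    (X Y : {mfun Z >-> V}) :
  X =1 Y -> eq_borel (distribution Q X) (distribution Q Y).
Proof.
move=> XY A mA; rewrite /distribution /pushforward/=; congr (Q _).
by apply/seteqP; split=> z /=; rewrite XY.
Qed.

(** Equality in law is kept by a common measurable map, even between variables
    that live on different spaces. *)
Lemma eq_borel_law_comp d d' (Z : measurableType d) (Z' : measurableType d')
    (Q : probability Z R) (Q' : probability Z' R)
    (X : {mfun Z >-> V}) (X' : {mfun Z' >-> V}) (T : V -> V)
    (mT : measurable_fun setT T) (Y : {mfun Z >-> V}) (Y' : {mfun Z' >-> V}) :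
  eq_borel (distribution Q X) (distribution Q' X') ->
  Y =1 T \o X -> Y' =1 T \o X' ->
  eq_borel (distribution Q Y) (distribution Q' Y').
Proof.
move=> XX' YX YX' A mA.
have mTA : measurable (T @^-1` A) by rewrite -[_ @^-1` _]setTI; exact: mT.
transitivity (distribution Q X (T @^-1` A)).
  rewrite /distribution /pushforward/=; congr (Q _).
  by apply/seteqP; split=> z /=; rewrite YX.
rewrite XX'//.
rewrite /distribution /pushforward/=; congr (Q' _).
by apply/seteqP; split=> z /=; rewrite YX'.
Qed.

(** The joint law of two random vectors couples their laws. *)
Lemma wasserstein1_law d (Z : measurableType d) (Q : probability Z R)
    (X Y : {mfun Z >-> V}) :
  (wasserstein 1 (distribution Q X) (distribution Q Y) <=
   \int[Q]_z (enorm (X z - Y z))%:E)%E.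
Proof.
have mXY : measurable_fun setT (fun z => (X z, Y z)).
  by apply: measurable_fun_pair.
pose XY : {mfun Z >-> (V * V)%type} :=
  HB.pack (fun z => (X z, Y z)) (isMeasurableFun.Build _ _ _ _ _ mXY).
have -> : (\int[Q]_z (enorm (X z - Y z))%:E =
    (\int[distribution Q XY]_z (enorm (z.1 - z.2) ^+ 1)%:E) `^ 1%:R^-1)%E.
  rewrite ge0_integral_distribution.
  - rewrite invr1 poweRe1//.
    by apply: integral_ge0 => z _; rewrite lee_fin exprn_ge0 ?enorm_ge0.
  - apply/measurable_EFinP/measurable_funX/measurable_enorm => // i j.
    rewrite (_ : (fun _ => _) = fun z : V * V => z.1 i j - z.2 i j).
      by apply: measurable_funB;
       apply: (measurableT_comp (measurable_coord i j)).
    by apply/funext => z; rewrite !mxE.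
  - by move=> z; rewrite lee_fin exprn_ge0 ?enorm_ge0.
apply: ereal_inf_lbound; exists (distribution Q XY) => //.
split=> A mA; rewrite /distribution /pushforward/=; congr (Q _).
  by apply/seteqP; split=> z //= -[].
by apply/seteqP; split=> z //= -[].
Qed.

Lemma wasserstein1_eq_borel (mu nu : probability V R) :
  eq_borel mu nu -> (wasserstein 1 mu nu <= 0)%E.
Proof.
move=> munu; pose X := mk_mfun (@measurable_id _ V setT).
have -> : wasserstein 1 mu nu =
    wasserstein 1 (distribution mu X) (distribution mu X).
  rewrite /wasserstein.
  suff -> : coupling mu nu =
            coupling (distribution mu X) (distribution mu X) by [].
  apply/funext => Pi; apply/propext; rewrite /coupling.
  split=> -[h k]; split=> A mA; rewrite ?h ?k//.
  - exact/esym/munu.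
  - exact: munu.
apply: le_trans (wasserstein1_law _ _ _) _.
by under eq_integral do rewrite subrr enorm0; rewrite integral0.
Qed.

End laws.

(** * Rich spaces have no atoms *)

Section atomless.
Context d (Omega : measurableType d) (R : realType) (P : probability Omega R).
Hypothesis rP : rich P.

(** The uniform variable on the unit interval that a rich space carries enters
    only through the growth of its distribution function. *)
Lemma rich_uniform : exists U : Omega -> R,
  [/\ measurable_fun setT U,
      forall a b, a <= b -> (P (U @^-1` `]a, b]) <= (b - a)%:E)%E,
      P (U @^-1` `]-oo, 0]) = 0%E & P (U @^-1` `]-oo, 1]) = 1%E].
Proof.
have mc : measurable_fun [set: measurableTypeR R]
    (fun x : measurableTypeR R => const_mx x : 'rV[R]_1).
  apply: measurable_fun_mx => i j.
  rewrite (_ : (fun _ => _) = id); last by apply/funext => x; rewrite mxE.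
  by move=> _ B mB; rewrite setTI; exact: mB.
pose c := mk_mfun mc.
have [X XE] := rP (distribution (uniform_prob (@ltr01 R)) c).
pose U w := X w 0 0.
have mU : measurable_fun setT U by exact: measurable_mfun_coord.
have UE B : measurable B -> P (U @^-1` B) = uniform_prob (@ltr01 R) B.
  move=> mB; pose B' := [set r : 'rV[R]_1 | B (r 0 0)].
  have mB' : measurable B'.
    by rewrite -[B']setTI; exact: (@measurable_coord R 1 1 0 0).
  etransitivity; first exact: XE mB'.
  rewrite /distribution /pushforward/=.
  by congr (uniform_prob _ _); apply/seteqP; split=> x /=; rewrite /B'/= mxE.
exists U; split => //.
- move=> a b ab; rewrite UE//.
  rewrite (_ : (b - a)%:E = lebesgue_measure `]a, b]%classic); last first.
    rewrite lebesgue_measure_itv/= lte_fin; case: ltP => //= ba.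
    by rewrite (_ : b = a) ?subrr//; apply/eqP; rewrite eq_le ba ab.
  rewrite -(mul1e (lebesgue_measure _)) -integral_cst//=.
  apply: ge0_le_integral => //.
  + by move=> x _; rewrite lee_fin uniform_pdf_ge0.
  + apply/measurable_EFinP; apply: measurable_funTS.
    exact: measurable_uniform_pdf.
  + move=> x _; rewrite lee_fin /uniform_pdf; case: ifP => // _.
    by rewrite subr0 invr1.
- rewrite UE// /uniform_prob integral_uniform_pdf.
  rewrite (_ : _ `&` _ = [set 0]) ?integral_set1//.
  apply/seteqP; split=> [x [/=]|x /= ->]; rewrite !in_itv/=.
    by move=> x0 /andP[x1 _]; apply/eqP; rewrite eq_le x0 x1.
  by rewrite lexx ler01.
- rewrite UE// /uniform_prob integral_uniform_pdf1//.
  by move=> x /=; rewrite !in_itv/= => /andP[].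
Qed.

(** A rich space has no atoms: the probability of [A] intersected with
    [U <= t], for [U] uniform, is a continuous function of [t]. *)
Lemma exists_subset_prob A (p : R) : measurable A -> 0 <= p ->
  (p%:E <= P A)%E -> exists B, [/\ measurable B, B `<=` A & P B = p%:E].
Proof.
move=> mA p0 pA; have [U [mU UL U0 U1]] := rich_uniform.
have mUi (i : interval R) : measurable (U @^-1` [set` i]).
  by rewrite -[_ @^-1` _]setTI; exact: mU.
pose E t := A `&` U @^-1` `]-oo, t]; pose c t := fine (P (E t)).
have mE t : measurable (E t) by exact: measurableI.
have cE t : (c t)%:E = P (E t) by rewrite fineK// fin_num_measure.
have step s t : s <= t -> 0 <= c t - c s <= t - s.
  move=> st; pose G := A `&` U @^-1` `]s, t].
  have mG : measurable G by exact: measurableI.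
  have EG : E t = E s `|` G.
    rewrite /E /G -setIUr -preimage_setU; congr (_ `&` _ @^-1` _).
    by rewrite -itv_bndbnd_setU.
  have -> : c t = c s + fine (P G).
    apply: EFin_inj; rewrite EFinD !cE fineK ?fin_num_measure// EG measureU//.
    apply/seteqP; split=> w // -[[_ a] [_ b]]; move: a b => /=.
    by rewrite !in_itv/= => a; rewrite ltNge a.
  rewrite addrAC subrr add0r fine_ge0//= -lee_fin fineK ?fin_num_measure//.
  by rewrite (le_trans _ (UL _ _ st))// le_measure ?inE//; exact: subIsetr.
have c0 : c 0 = 0.
  apply: EFin_inj; rewrite cE; apply/eqP; rewrite eq_le measure_ge0 andbT.
  apply: (@le_trans _ _ (P (U @^-1` `]-oo, 0]))); last by rewrite U0.
  by rewrite le_measure ?inE//; exact: subIsetr.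
have c1 : (c 1)%:E = P A.
  rewrite cE; apply/eqP; rewrite eq_le le_measure ?inE//=; last first.
    exact: subIsetl.
  have n0 : P (~` (U @^-1` `]-oo, 1])) = 0%E.
    by rewrite probability_setC// U1 subee.
  rewrite -[leRHS]adde0 -n0.
  rewrite (le_trans _ (measureU2 _ _ _))//; last exact: measurableC.
  rewrite le_measure ?inE//; first by apply: measurableU => //; exact: measurableC.
  by move=> w Aw; have [h|h] := pselect ((U @^-1` `]-oo, 1]) w); [left|right].
have [|||t _ ct] := @IVT R c 0 1 p.
- exact: ler01.
- apply: continuous_subspaceT => s; apply/cvgrPdist_le => e e0.
  near=> t; have ts : `|s - t| <= e.
    by near: t; apply: (@cvgr_dist_le _ _ _ (nbhs s) _ id s).
  apply: le_trans ts; have [st|ts] := leP s t.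
    have /andP[a b] := step _ _ st.
    by rewrite distrC ger0_norm// distrC ger0_norm ?subr_ge0.
  have /andP[a b] := step _ _ (ltW ts).
  by rewrite ger0_norm// ger0_norm// subr_ge0 ltW.
- have pc : p <= c 1 by rewrite -lee_fin c1.
  by rewrite c0 min_l ?max_r ?p0 ?pc// (le_trans p0 pc).
- by exists (E t); split => //; [exact: subIsetl|rewrite -cE ct].
Unshelve. all: by end_near.
Qed.

Lemma probability_bigU (S : choiceType) (B : S -> set Omega) (s : seq S) :
  (forall i, measurable (B i)) -> (forall i j w, B i w -> B j w -> i = j) ->
  uniq s -> P (\big[setU/set0]_(i <- s) B i) = (\sum_(i <- s) P (B i))%E.
Proof.
move=> mB tB; elim: s => [_|i s IH /= /andP[iNs us]].
  by rewrite !big_nil measure0.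
rewrite !big_cons measureU; first by congr (_ + _)%E; exact: IH.
- exact: mB.
- by apply: bigsetU_measurable => j _; exact: mB.
apply/seteqP; split=> w // -[Bi]; rewrite -bigcup_seq => -[j /= js Bj].
by move: iNs; rewrite (tB _ _ _ Bi Bj) js.
Qed.

(** Events of prescribed probabilities are cut out of the events [A (x i)] one
    index at a time; several indices may share the same point [x i]. *)
Lemma exists_labels (S : finType) (V : eqType) (x : S -> V) (A : V -> set Omega)
    (q : S -> R) (s : seq S) :
  (forall v, measurable (A v)) -> (forall i, 0 <= q i) ->
  (forall v, ((\sum_(i | x i == v) q i)%:E <= P (A v))%E) ->
  (forall u v w, A u w -> A v w -> u = v) -> uniq s ->
  exists B : S -> set Omega,
    [/\ forall i, measurable (B i), forall i, i \in s -> P (B i) = (q i)%:E,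
        forall i, B i `<=` A (x i), forall i, i \notin s -> B i = set0 &
        forall i j w, B i w -> B j w -> i = j].
Proof.
move=> mA q0 qA tA; elim: s => [_|i s IH /= /andP[iNs us]].
  by exists (fun=> set0); split => // i; exact: sub0set.
have [B [mB BP BA B0 tB]] := IH us.
pose C := \big[setU/set0]_(j <- s | x j == x i) B j.
have mC : measurable C by apply: bigsetU_measurable => j _; exact: mB.
have CA : C `<=` A (x i).
  rewrite /C -bigcup_seq_cond => w [j /= /andP[_ /eqP <-]]; exact: BA.
have PC : P C = (\sum_(j <- s | x j == x i) q j)%:E.
  rewrite /C -big_filter probability_bigU ?filter_uniq// -sumEFin -[RHS]big_filter.
  by apply: eq_big_seq => j; rewrite mem_filter => /andP[_ js]; exact: BP.
have mD : measurable (A (x i) `\` C) by exact: measurableD.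
have PD : (P (A (x i) `\` C) = P (A (x i)) - P C)%E.
  rewrite measureD//; first by rewrite (setIidr CA).
  by rewrite (le_lt_trans (probability_le1 _ _))// ltry.
have [|Bi [mBi BiD PBi]] := exists_subset_prob mD (q0 i).
  rewrite PD PC leeBrDr// -EFinD (le_trans _ (qA (x i)))// lee_fin.
  have -> : q i + \sum_(j <- s | x j == x i) q j =
      \sum_(j <- i :: s | x j == x i) q j by rewrite big_cons eqxx.
  have us' : uniq (i :: s) by rewrite /= iNs.
  rewrite -big_filter big_uniq ?filter_uniq// [leLHS]big_mkcond.
  rewrite [leRHS]big_mkcond; apply: ler_sum => j _; rewrite mem_filter.
  by case: (x j == x i) => //=; case: ifP.
exists (fun j => if j == i then Bi else B j); split.
- by move=> j; case: ifP.
- move=> j; rewrite inE; case: ifPn => [/eqP -> _//|_ /=]; exact: BP.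
- by move=> j; case: ifPn => [/eqP ->|_]; [move=> w /BiD[]|exact: BA].
- by move=> j; rewrite inE negb_or => /andP[/negbTE ->]; exact: B0.
- have H j w : Bi w -> B j w -> False.
    move=> /BiD[Aiw nC] Bj; apply: nC; rewrite /C -bigcup_seq_cond.
    exists j => //=; apply/andP; split; last first.
      by apply/eqP; exact: tA (BA _ _ Bj) Aiw.
    by apply: contraPT Bj => /B0 ->.
  move=> j k w; case: ifPn => [/eqP ->|ji]; case: ifPn => [/eqP ->|ki]//.
  + by move=> b /(H _ _ b).
  + by move=> /[swap] b /(H _ _ b).
  + exact: tB.
Qed.
End atomless.

(** * Random vectors with finitely many values *)

Section labels.
Context {R : realType} (S : finType).

(** A random variable with values in the finite type [S], which carries no
    sigma-algebra of its own. *)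
Definition labelling d (Z : measurableType d) (s : Z -> S) : Prop :=
  forall i, measurable (s @^-1` [set i]).

Lemma measurable_label d d' (Z : measurableType d) (Z' : measurableType d')
    (s : Z -> S) (h : S -> Z') : labelling s -> measurable_fun setT (h \o s).
Proof.
move=> ms _ B mB; rewrite setTI.
rewrite (_ : _ @^-1` _ = \bigcup_(i in [set i | B (h i)]) s @^-1` [set i]).
  by apply: fin_bigcup_measurable => // i _; exact: ms.
by apply/seteqP; split=> [z hB|z [i /= Bi ->]//]; exists (s z).
Qed.

Definition weight d (Z : measurableType d) (Q : probability Z R) (s : Z -> S) i :=
  fine (Q (s @^-1` [set i])).

Lemma weight_ge0 d (Z : measurableType d) (Q : probability Z R) (s : Z -> S) i :
  0 <= weight Q s i.
Proof. by rewrite fine_ge0. Qed.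

Lemma label_indic d (Z : measurableType d) (s : Z -> S) (h : S -> R) z :
  h (s z) = \sum_i h i * \1_(s @^-1` [set i]) z.
Proof.
rewrite (bigD1 (s z))//= indicE mem_set//= mulr1 big1 ?addr0// => i iz.
rewrite indicE memNset ?mulr0//= => /esym e; move: iz; rewrite e eqxx.
by [].
Qed.

(** A function of the label is a combination of the indicators of the labels. *)
Lemma integral_label d (Z : measurableType d) (Q : probability Z R)
    (s : Z -> S) (h : S -> R) : labelling s ->
  Q.-integrable setT (EFin \o (fun z => h (s z))) /\
  \int[Q]_z h (s z) = \sum_i h i * weight Q s i.
Proof.
move=> ms.
have i1 i : Q.-integrable setT (EFin \o \1_(s @^-1` [set i])).
  apply/integrableP; split; first exact/measurable_EFinP/measurable_indic.
  under eq_integral do rewrite /= ger0_norm//.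
  by rewrite integral_indic// setIT (le_lt_trans (probability_le1 _ _))// ltry.
have i2 i : Q.-integrable setT (EFin \o (fun z => h i * \1_(s @^-1` [set i]) z)).
  exact: integrable_mulr.
have -> : (fun z => h (s z)) = (fun z => \sum_i h i * \1_(s @^-1` [set i]) z).
  by apply/funext => z; exact: label_indic.
split; first exact: integrable_sumr.
rewrite Rintegral_sum//; apply: eq_bigr => i _; rewrite RintegralZl//.
by congr (_ * _); rewrite /Rintegral /= integral_indic// setIT.
Qed.

Lemma probability_label d (Z : measurableType d) (Q : probability Z R)
    (s : Z -> S) (B : set S) : labelling s ->
  Q (s @^-1` B) = (\sum_i \1_B i * weight Q s i)%:E.
Proof.
move=> ms; have mB : measurable (s @^-1` B).
  rewrite (_ : _ @^-1` _ = \bigcup_(i in B) s @^-1` [set i]).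
    by apply: fin_bigcup_measurable => // i _; exact: ms.
  by apply/seteqP; split=> [z hB|z [i /= Bi ->]//]; exists (s z).
have [iB <-] := integral_label Q \1_B ms.
rewrite EFin_Rintegral//= -[in LHS](setIT (s @^-1` B)) -integral_indic//.
Qed.

Lemma eq_borel_label d d' (Z : measurableType d) (Z' : measurableType d')
    (Q : probability Z R) (Q' : probability Z' R) (s : Z -> S) (s' : Z' -> S)
    dim (x : S -> 'rV[R]_dim) (X : {mfun Z >-> 'rV[R]_dim})
    (X' : {mfun Z' >-> 'rV[R]_dim}) :
  labelling s -> labelling s' -> weight Q s =1 weight Q' s' ->
  X =1 x \o s -> X' =1 x \o s' ->
  eq_borel (distribution Q X) (distribution Q' X').
Proof.
move=> ms ms' ss' Xs Xs' A mA.
transitivity (Q (s @^-1` (x @^-1` A))).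
  rewrite /distribution /pushforward/=; congr (Q _).
  by apply/seteqP; split=> z /=; rewrite Xs.
transitivity (Q' (s' @^-1` (x @^-1` A))); last first.
  rewrite /distribution /pushforward/=; congr (Q' _).
  by apply/seteqP; split=> z /=; rewrite Xs'.
rewrite !probability_label//; congr (_%:E).
by apply: eq_bigr => i _; rewrite ss'.
Qed.

End labels.

(** A random vector [X] with the law of [x \o s] factors almost surely through
    a labelling of its own probability space: when several labels share the
    same point, the event [X = point] is split with the help of the richness. *)
Lemma exists_labelling d (Omega : measurableType d) (R : realType)
    (P : probability Omega R) d' (Z : measurableType d') (Q : probability Z R)
    (S : finType) (s : Z -> S) dim (x : S -> 'rV[R]_dim)
    (X : {mfun Omega >-> 'rV[R]_dim}) (U : {mfun Z >-> 'rV[R]_dim}) :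
  rich P -> labelling s -> U =1 x \o s ->
  eq_borel (distribution P X) (distribution Q U) ->
  exists t : Omega -> S,
    [/\ labelling t, weight P t =1 weight Q s &
        {ae P, forall w, X w = x (t w)}].
Proof.
move=> rP ms Us XU.
have mpt (v : 'rV[R]_dim) : measurable [set v].
  rewrite (_ : [set v] = \bigcap_(j in [set: 'I_dim])
      ([set: 'rV_dim] `&` (fun r : 'rV[R]_dim => r 0 j) @^-1` [set v 0 j])).
    apply: fin_bigcap_measurable => // j _; apply: measurable_coord => //.
  apply/seteqP; split=> [r /= -> j _|r /= h]; first by split.
  by apply/rowP => j; have [] := h j I.
have mX v : measurable (X @^-1` [set v]).
  by rewrite -[_ @^-1` _]setTI; exact: (@measurable_funPT _ _ _ _ X).
have [||||B [mB BP BX _ tB]] := @exists_labels _ _ _ P rP S _ x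
  (fun v => X @^-1` [set v]) (weight Q s) (enum S) mX.
- by move=> i; exact: weight_ge0.
- move=> v; rewrite le_eqVlt; apply/orP; left; apply/eqP.
  have -> : P (X @^-1` [set v]) = Q (U @^-1` [set v]) by exact: (XU _ (mpt v)).
  rewrite (_ : U @^-1` _ = s @^-1` [set i | x i == v]); last first.
    by apply/seteqP; split=> z /=; rewrite Us => /eqP.
  rewrite probability_label// big_mkcond/=; congr (_%:E); apply: eq_bigr => i _.
  rewrite indicE; case: ifPn => xi; first by rewrite mem_set ?mul1r.
  by rewrite memNset ?mul0r//; exact/negP.
- by move=> u v w /= -> ->.
- exact: enum_uniq.
have PB i : P (B i) = (weight Q s i)%:E by rewrite BP ?mem_enum.
have [z0] : exists z : Z, True.
  apply: contrapT => nZ; have : Q setT = 0%E.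
    rewrite (_ : setT = set0) ?measure0//.
    by apply/seteqP; split=> z // _; apply: nZ; exists z.
  by rewrite probability_setT => /eqP; rewrite onee_eq0.
move=> _; pose i0 := s z0.
pose N := ~` (\bigcup_(i in [set: S]) B i).
have mC : measurable (\bigcup_(i in [set: S]) B i) by exact: fin_bigcup_measurable.
have mN : measurable N by exact: measurableC.
have PN : P N = 0%E.
  rewrite probability_setC//.
  rewrite (_ : \bigcup_(i in setT) B i = \big[setU/set0]_(i <- enum S) B i).
    rewrite probability_bigU ?enum_uniq// (eq_bigr _ (fun i _ => PB i)) sumEFin.
    rewrite big_enum/= -(@probability_setT _ _ _ Q).
    rewrite -(preimage_setT s) probability_label// -EFinB -sumrB big1// => i _.
    by rewrite indicE in_setT mul1r subrr.
  rewrite -bigcup_seq; apply/seteqP; split=> w [i _ Bi]; exists i => //=.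
  by rewrite mem_enum.
have ex w : exists i, B i w \/ (N w /\ i = i0).
  have [[i _ Bi]|nw] := pselect ((\bigcup_(i in [set: S]) B i) w).
    by exists i; left.
  by exists i0; right.
have [t tB'] := choice ex.
have tE i : t @^-1` [set i] = if i == i0 then B i `|` N else B i.
  apply/seteqP; split=> w /=.
    move=> <-; have [Bt|[Nw ->]] := tB' w; first by case: ifP => // _; left.
    by rewrite eqxx; right.
  have aux : B i w -> t w = i.
    move=> Bi; have [Bt|[Nw _]] := tB' w; first exact: tB Bt Bi.
    by exfalso; apply: Nw; exists i.
  case: ifPn => [/eqP ii0|_]; last exact: aux.
  case=> [|Nw]; first exact: aux.
  rewrite ii0; have [Bt|[_ ->//]] := tB' w.
  by exfalso; apply: Nw; exists (t w).
exists t; split.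
- by move=> i; rewrite tE; case: ifP => // _; exact: measurableU.
- move=> i; rewrite /weight tE; case: ifP => _; last by rewrite PB.
  rewrite measureU//.
    transitivity (fine (P (B i) + P N)%E) => //.
    by rewrite PN PB addr0.
  by apply/seteqP; split=> w // -[Bi]; apply; exists i.
- exists N; split => //= w /=; apply: contra_notP => Nw.
  have [Bt|[] //] := tB' w; exact: BX Bt.
Qed.

(** * First-order expansions in one real variable *)

Section one_variable.
Context {R : realType}.

Lemma is_derive_approx (f : R -> R) (t l : R) :
  (forall e, 0 < e -> exists2 dl : R, 0 < dl &
     forall s, `|s - t| <= dl -> `|f s - f t - (s - t) * l| <= e * `|s - t|) ->
  is_derive t 1 f l.
Proof.
move=> H; suff fl : h^-1 *: (f (h *: 1 + t) - f t) @[h --> 0^'] --> l.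
  have df : derivable f t 1 by apply/cvg_ex; exists l.
  by apply: DeriveDef => //; exact/cvg_lim.
apply/cvgrPdist_le => e e0; have [dl dl0 Hdl] := H _ e0.
near=> h; have h0 : h != 0 by near: h; exact: nbhs_dnbhs_neq.
have hdl : `|h| <= dl by near: h; apply: dnbhs0_le.
have := Hdl (h + t); rewrite addrK => /(_ hdl); rewrite distrC => le1.
have -> : l - h^-1 *: (f (h *: 1 + t) - f t) =
   h^-1 * (h * l - (f (h + t) - f t)).
  by rewrite mulrBr mulrA mulVf// mul1r; congr (_ - _); rewrite /GRing.scale/= mulr1.
by rewrite normrM normfV ler_pdivrMl ?normr_gt0// [leRHS]mulrC.
Unshelve. all: by end_near.
Qed.

(** The iterated integrals below are differentiated in this form: uniform quadratic
    estimates pass through integrals, unlike pointwise differentiability. *)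
Lemma is_derive_quadratic (f : R -> R) (t l C : R) :
  (forall s, `|f s - f t - (s - t) * l| <= C * (s - t) ^+ 2) ->
  is_derive t 1 f l.
Proof.
move=> H; apply: is_derive_approx => e e0.
have C0 : 0 < `|C| + 1 by rewrite ltr_wpDl.
exists (e / (`|C| + 1)); first exact: divr_gt0.
move=> s; rewrite ler_pdivlMr// => sdl; apply: le_trans (H s) _.
rewrite -real_normK ?num_real// expr2 mulrA ler_wpM2r//.
rewrite (le_trans _ sdl)// mulrC ler_wpM2l// (le_trans (ler_norm C))//.
by rewrite lerDl.
Qed.

(** The mean value theorem replaces the increment by the derivative at an
    intermediate point. *)
Lemma taylor1_bound (f df : R -> R) (L : R) :
  (forall t : R, is_derive t (1 : R) f (df t)) ->
  (forall t, 0 <= t <= 1 -> `|df t - df 0| <= L) ->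
  `|f 1 - f 0 - df 0| <= L.
Proof.
move=> fd dfL; have fc : {within `[0, 1], continuous f}.
  by apply: derivable_within_continuous => t _; have [] := fd t.
have [c] := @MVT R f df 0 1 ltr01 (fun t _ => fd t) fc.
rewrite in_itv/= => /andP[c0 c1] ->; rewrite subr0 mulr1.
by apply: dfL; rewrite !ltW.
Qed.

End one_variable.

Section ae_label.
Context {R : realType} (S : finType).

Lemma ae_Rintegral_label d (Z : measurableType d) (Q : probability Z R)
    (s : Z -> S) (h : Z -> R) (h' : S -> R) : labelling s ->
  measurable_fun setT h -> {ae Q, forall z, h z = h' (s z)} ->
  \int[Q]_z h z = \sum_i h' i * weight Q s i.
Proof.
move=> ms mh hh'; have [ih' <-] := integral_label Q h' ms.
congr fine; apply: ae_eq_integral => //.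
- exact/measurable_EFinP.
- exact: measurable_int ih'.
- by apply: filterS hh' => z -> _.
Qed.

End ae_label.

(** * Moving a measure of finite support *)

Section lions_expansion.
Context d (Omega : measurableType d) (R : realType) (P : probability Omega R).
Context (dim p e : nat).
Local Notation V := 'rV[R]_dim.
Context (phi : probability V R -> 'M[R]_(p, e)).
Context (g : probability V R -> V -> 'M[R]_(p * dim, e)) (K : R).
Hypothesis rP : rich P.
Hypothesis phi_borel : forall mu nu,
  finite_moment 2 mu -> eq_borel mu nu -> phi mu = phi nu.
Hypothesis phi_lions : forall mu,
  finite_moment 2 mu -> is_lions_derivative P phi mu (g mu).
Hypothesis g_bound : forall mu x, finite_moment 2 mu -> enorm (g mu x) <= K.
Hypothesis K_ge0 : 0 <= K.
Hypothesis g_lip : forall mu nu x y, finite_moment 2 mu -> finite_moment 2 nu ->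
  ((enorm (g mu x - g nu y))%:E <=
   K%:E * (wasserstein 1 mu nu + (enorm (x - y))%:E))%E.

(** The joint law of two variables is a coupling, so the Wasserstein distance in
    the Lipschitz bound is at most a mean distance. *)
Lemma g_lip_law d' (Z : measurableType d') (Q : probability Z R)
    (X Y : {mfun Z >-> V}) x y :
  finite_moment 2 (distribution Q X) -> finite_moment 2 (distribution Q Y) ->
  enorm (g (distribution Q X) x - g (distribution Q Y) y) <=
  K * (\int[Q]_z enorm (X z - Y z) + enorm (x - y)).
Proof.
move=> mX mY; rewrite -lee_fin (le_trans (g_lip _ _ mX mY))//.
rewrite EFinM lee_wpmul2l ?lee_fin// EFinD leeD2r// EFin_Rintegral//.
  exact: wasserstein1_law.
exact: (integrable_dist (finite_momentW (isT : (1 <= 2)%N) mX)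
                        (finite_momentW (isT : (1 <= 2)%N) mY)).
Qed.

Lemma measurable_slot d' (Z : measurableType d') mu (X Y : {mfun Z >-> V}) i j :
  finite_moment 2 mu ->
  measurable_fun setT (fun z => slot (g mu (X z)) (Y z - X z) i j).
Proof.
move=> mmu; have [mg _ _] := phi_lions mmu.
under eq_fun do rewrite slotE.
apply: measurable_sum => l; apply: measurable_funM.
  rewrite (_ : (fun _ => _) = fun z => Y z 0 l - X z 0 l).
    by apply: measurable_funB; exact: measurable_mfun_coord.
  by apply/funext => z; rewrite !mxE.
apply: (measurableT_comp (measurable_coord _ _)).
exact: (measurableT_comp mg (@measurable_funPT _ _ _ _ X)).
Qed.

Lemma slot_bound mu x h i j : finite_moment 2 mu ->
  `|slot (g mu x) h i j| <= K * enorm h.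
Proof.
move=> mmu; rewrite (le_trans (enorm_slot_coord _ _ _ _))//.
by rewrite ler_wpM2r ?enorm_ge0// g_bound.
Qed.

Section finite_support.
Context d' (Z : measurableType d') (Q : probability Z R) (S : finType).
Context (s : Z -> S) (x y : S -> V).
Hypothesis ms : labelling s.

Let path t k : V := x k + t *: (y k - x k).
Let U t : {mfun Z >-> V} := mk_mfun (measurable_label (path t) ms).
Let m2 t : finite_moment 2 (distribution Q (U t)).
Proof.
apply/finite_moment_law.
by have [] := integral_label Q (fun k => enorm (path t k) ^+ 2) ms.
Qed.
Let q := weight Q s.
Let Psi t i j :=
  \sum_k slot (g (distribution Q (U t)) (path t k)) (y k - x k) i j * q k.

Let pathB t u k : path t k - path u k = (t - u) *: (y k - x k).
Proof. by rewrite /path opprD addrACA subrr add0r -scalerBl. Qed.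

(** The straight path between two labelled configurations is differentiable in
    [t]. The lift is only known to be differentiable at one variable [X] of the
    given law, on the space [Omega]; by richness [X] is, almost surely, a function
    of a labelling [tau] with the same weights, and moving the points along [tau]
    gives a path through [X] that has the same laws. *)
Let path_derive (t : R) i j :
  is_derive t (1 : R) (fun u : R => phi (distribution Q (U u)) i j) (Psi t i j).
Proof.
apply: is_derive_approx => eps eps0.
have [mg _ [X XU DX]] := phi_lions (m2 t).
have [tau [mtau tauq Xtau]] :=
  @exists_labelling _ _ _ P _ _ Q _ _ _ _ _ (U t) rP ms (fun=> erefl) XU.
pose Y u : {mfun Omega >-> V} := mk_mfun (measurable_label (path u) mtau).
have YU u : eq_borel (distribution P (Y u)) (distribution Q (U u)).
  exact: (@eq_borel_label _ _ _ _ _ _ _ _ tau s).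
have m2Y u : finite_moment 2 (distribution P (Y u)).
  by apply: eq_borel_finite_moment (m2 u); exact: eq_borel_sym.
have m2X : finite_moment 2 (distribution P X).
  by apply: eq_borel_finite_moment (m2 t); exact: eq_borel_sym.
pose N := Num.sqrt (\sum_k enorm (y k - x k) ^+ 2 * q k).
have L2E u : L2norm P (Y u \- X) = `|u - t| * N.
  rewrite /L2norm -sqrtr_sqr -sqrtrM ?sqr_ge0//; congr Num.sqrt.
  rewrite (ae_Rintegral_label (h' := fun k => enorm (path u k - path t k) ^+ 2)
    mtau).
  - rewrite mulr_sumr; apply: eq_bigr => k _; rewrite tauq mulrA; congr (_ * _).
    by rewrite pathB enormZ exprMn real_normK ?num_real.
  - exact: measurable_distX.
  - by apply: filterS Xtau => w /= ->.
have [dl dl0 Hdl] := DX (eps / (N + 1)) (divr_gt0 eps0 (ltr_wpDl (sqrtr_ge0 _) ltr01)).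
have N1 : 0 < N + 1 by rewrite ltr_wpDl// sqrtr_ge0.
exists (dl / (N + 1)); first exact: divr_gt0.
move=> u; rewrite ler_pdivlMr// => udl.
have {}udl : L2norm P (Y u \- X) <= dl.
  by rewrite L2E (le_trans _ udl)// ler_wpM2l// lerDl.
have := Hdl (Y u) (m2Y u) udl.
rewrite (phi_borel (m2Y u) (YU u)) (phi_borel m2X XU) L2E => bound.
have := le_trans (ler_norm_enorm _ i j) bound.
rewrite !mxE (ae_Rintegral_label (h' := fun k =>
   slot (g (distribution Q (U t)) (path t k)) (path u k - path t k) i j) mtau).
- have -> : \sum_k slot (g (distribution Q (U t)) (path t k))
       (path u k - path t k) i j * weight P tau k = (u - t) * Psi t i j.
    rewrite mulr_sumr; apply: eq_bigr => k _.
    by rewrite pathB slotZ mxE tauq mulrA.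
  move/le_trans; apply; rewrite mulrCA [leRHS]mulrC ler_wpM2l//.
  by rewrite mulrAC -mulrA ger_pMr// ler_pdivrMr// mul1r lerDl.
- exact: measurable_slot.
- by apply: filterS Xtau => w /= ->.
Qed.

Let M k := \int[Q]_z enorm (y (s z) - x (s z)) ^+ k.

Let ME k : M k = \sum_l enorm (y l - x l) ^+ k * q l.
Proof. by have [_] := integral_label Q (fun l => enorm (y l - x l) ^+ k) ms. Qed.

Let Psi_lip t i j : 0 <= t <= 1 ->
  `|Psi t i j - Psi 0 i j| <= K * (M 1 ^+ 2 + M 2).
Proof.
move=> /andP[t0 t1]; rewrite -sumrB (le_trans (ler_norm_sum _ _ _))//.
apply: (@le_trans _ _ (\sum_l K * (M 1 * (enorm (y l - x l) ^+ 1 * q l) +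
    enorm (y l - x l) ^+ 2 * q l))); last first.
  by rewrite -mulr_sumr big_split/= -mulr_sumr -!ME expr2.
apply: ler_sum => l _; rewrite -mulrBl normrM (ger0_norm (weight_ge0 _ _ _)).
rewrite mulrA -mulrDl mulrA; apply: ler_wpM2r; first exact: weight_ge0.
have -> : slot (g (distribution Q (U t)) (path t l)) (y l - x l) i j -
     slot (g (distribution Q (U 0)) (path 0 l)) (y l - x l) i j =
  slot (g (distribution Q (U t)) (path t l) -
        g (distribution Q (U 0)) (path 0 l)) (y l - x l) i j.
  by rewrite slotBl !mxE.
rewrite (le_trans (enorm_slot_coord _ _ _ _))//.
rewrite expr1 expr2 -mulrDl mulrA ler_wpM2r ?enorm_ge0//.
rewrite (le_trans (g_lip_law _ _ (m2 _) (m2 _)))//.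
rewrite ler_wpM2l// pathB subr0 enormZ ger0_norm//.
apply: lerD; last by rewrite ler_piMl ?enorm_ge0.
have -> : \int[Q]_z enorm (U t z - U 0 z) = t * M 1.
  have [i1 _] := integral_label Q (fun l => enorm (y l - x l) ^+ 1) ms.
  rewrite -RintegralZl//; apply: eq_Rintegral => z _ /=.
  by rewrite pathB subr0 enormZ ger0_norm.
by rewrite ler_piMl// /M Rintegral_ge0// => z _; rewrite exprn_ge0 ?enorm_ge0.
Qed.

(** The Lipschitz bound on [g] makes the derivative of the path Lipschitz in time,
    so the mean value theorem yields a quadratic remainder. *)
Lemma expansion_finite (A B : {mfun Z >-> V}) i j :
  A =1 x \o s -> B =1 y \o s ->
  `|(phi (distribution Q B) - phi (distribution Q A) -
     mxint Q setT (fun z => slot (g (distribution Q A) (A z)) (B z - A z))) i j|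
  <= K * ((\int[Q]_z enorm (B z - A z)) ^+ 2
          + \int[Q]_z enorm (B z - A z) ^+ 2).
Proof.
move=> As Bs.
have AU : A =1 U 0 by move=> z; rewrite As /= /path scale0r addr0.
have BU : B =1 U 1 by move=> z; rewrite Bs /= /path scale1r addrC subrK.
have -> : phi (distribution Q B) = phi (distribution Q (U 1)).
  apply/esym/phi_borel => //; apply: eq_borel_law => z; exact/esym/BU.
have lawA : eq_borel (distribution Q (U 0)) (distribution Q A).
  by apply: eq_borel_law => z; exact/esym/AU.
rewrite -(phi_borel (m2 0) lawA).
have m2A := eq_borel_finite_moment lawA (m2 0).
have gA v : g (distribution Q A) v = g (distribution Q (U 0)) v.
  apply/eqP; rewrite -subr_eq0; apply/eqP/matrixP => i' j'; rewrite [RHS]mxE.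
  apply/eqP; rewrite -normr_le0 (le_trans (ler_norm_enorm _ _ _))//.
  rewrite (le_trans (g_lip_law _ _ m2A (m2 0)))// subrr enorm0 addr0.
  rewrite (_ : (fun z => _) = cst 0) ?Rintegral_cst// ?mul0r ?mulr0//.
  by apply/funext => z; rewrite AU subrr enorm0.
have -> : \int[Q]_z enorm (B z - A z) = M 1.
  by apply: eq_Rintegral => z _; rewrite As Bs expr1.
have -> : \int[Q]_z enorm (B z - A z) ^+ 2 = M 2.
  by apply: eq_Rintegral => z _; rewrite As Bs.
have -> : (phi (distribution Q (U 1)) - phi (distribution Q (U 0)) -
     mxint Q setT (fun z => slot (g (distribution Q A) (A z)) (B z - A z))) i j =
   phi (distribution Q (U 1)) i j - phi (distribution Q (U 0)) i j - Psi 0 i j.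
  rewrite !mxE; congr (_ - _ - _); rewrite /Psi /q.
  have [_ <-] := integral_label Q (fun k =>
    slot (g (distribution Q (U 0)) (path 0 k)) (y k - x k) i j) ms.
  by apply: eq_Rintegral => z _; rewrite gA As Bs /path scale0r addr0.
exact: (taylor1_bound (fun t => path_derive t i j) (fun t h => Psi_lip i j h)).
Qed.

End finite_support.
End lions_expansion.

(** * Rounding to a finite grid *)

Section rounding.
Context {R : realType}.

(** The grid of mesh [1 / (n + 1)] in [[- (n + 1), n + 1]]. [inord] sends
    everything outside of this range to the first point of the grid, which keeps the
    rounding error of order [1 + |y|] everywhere. *)
Definition round_index n (y : R) : 'I_(2 * n.+1 * n.+1).+1 :=
  inord (Num.truncn ((y + n.+1%:R) * n.+1%:R)).

Definition round_value n (i : 'I_(2 * n.+1 * n.+1).+1) : R :=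
  i%:R / n.+1%:R - n.+1%:R.

Lemma labelling_round_index n : labelling (@round_index n).
Proof.
move=> i; pose w (y : R) := (y + n.+1%:R) * n.+1%:R.
have mw : measurable_fun setT w.
  by apply: measurable_funM => //; apply: measurable_funD.
have mlt k : measurable [set y | (Num.truncn (w y) < k)%N].
  case: k => [|k]; first by rewrite (_ : [set _ | _] = set0)//; apply/seteqP; split.
  rewrite (_ : [set _ | _] = w @^-1` `]-oo, k.+1%:R[%classic).
    by rewrite -[_ @^-1` _]setTI; exact: mw.
  by apply/seteqP; split=> y /=; rewrite in_itv/= ltnS truncn_le_nat.
rewrite (_ : _ @^-1` _ = \bigcup_(k in [set k : nat | inord k = i])
    ([set y | (Num.truncn (w y) < k.+1)%N] `\`
     [set y | (Num.truncn (w y) < k)%N])).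
  by apply: bigcup_measurable => k _; exact: measurableD.
apply/seteqP; split=> [y /= yi|y [k /= ki [yk ky]]].
  by exists (Num.truncn (w y)) => //=; split=> //=; rewrite ltnn.
rewrite /round_index -/(w y) -ki; congr inord; apply/eqP.
by rewrite eqn_leq -ltnS yk leqNgt; exact/negP.
Qed.

Lemma round_value_le n i : `|@round_value n i| <= n.+1%:R.
Proof.
have n0 : 0 < n.+1%:R :> R by [].
rewrite ler_norml /round_value lerBrDr addNr lerBlDr divr_ge0//=.
rewrite ler_pdivrMr// -!natrD -natrM ler_nat.
by rewrite (leq_trans (leq_ord i))// mul2n addnn leq_mul// leqnn.
Qed.

Lemma round_close n (y : R) : `|y| < n.+1%:R ->
  `|round_value (round_index n y) - y| <= n.+1%:R^-1.
Proof.
have n0 : 0 < n.+1%:R :> R by [].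
rewrite ltr_norml => /andP[y1 y2].
have y0 : 0 <= y + n.+1%:R by rewrite -lerBlDr sub0r ltW.
set w := (y + n.+1%:R) * n.+1%:R.
have w0 : 0 <= w by rewrite mulr_ge0// ltW.
have /andP[t1 t2] := truncn_itv w0.
rewrite /round_value /round_index -/w inordK; last first.
  rewrite ltnS -ltnS truncn_lt_nat// (@lt_trans _ _ (2 * n.+1 * n.+1)%:R)//.
    by rewrite natrM ltr_pM2r// natrM mulr_natl mulr2n ltrD2r.
  by rewrite ltr_nat.
have -> : (Num.truncn w)%:R / n.+1%:R - n.+1%:R - y =
   ((Num.truncn w)%:R - w) / n.+1%:R.
  by rewrite mulrBl /w mulfK ?gt_eqF// opprD addrA [RHS]addrAC.
rewrite normrM (@gtr0_norm _ n.+1%:R^-1) ?invr_gt0//.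
rewrite -[leRHS]mul1r ler_wpM2r ?invr_ge0 ?(ltW n0)//.
rewrite distrC ger0_norm ?subr_ge0// lerBlDl ltW// (lt_le_trans t2)//.
by rewrite -natr1.
Qed.

Lemma round_le n (y : R) : `|round_value (round_index n y) - y| <= 1 + 2 * `|y|.
Proof.
have [yn|ny] := ltP `|y| n.+1%:R.
  rewrite (le_trans (round_close yn))// (@le_trans _ _ 1)//.
    by rewrite invf_le1// ler1n.
  by rewrite lerDl mulr_ge0.
rewrite (le_trans (ler_normB _ _))// (@le_trans _ _ (`|y| + `|y|))//.
  by rewrite lerD2r (le_trans (round_value_le _)).
by rewrite mulr_natl mulr2n lerDr.
Qed.

Context {dim : nat}.
Local Notation V := 'rV[R]_dim.

Definition label n (v : V) : {ffun 'I_dim -> 'I_(2 * n.+1 * n.+1).+1} :=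
  [ffun j => round_index n (v 0 j)].

Definition label_point n (a : {ffun 'I_dim -> 'I_(2 * n.+1 * n.+1).+1}) : V :=
  \row_j round_value (a j).

Definition discretize n (v : V) : V := label_point (label n v).

Lemma labelling_label n d (Z : measurableType d) (X : {mfun Z >-> V}) :
  labelling (fun z => label n (X z)).
Proof.
move=> a; rewrite (_ : _ @^-1` _ = \bigcap_(j in [set: 'I_dim])
    (setT `&` (fun z => X z 0 j) @^-1` (@round_index n @^-1` [set a j]))).
  apply: fin_bigcap_measurable => // j _; apply: measurable_mfun_coord => //.
  exact: labelling_round_index.
apply/seteqP; split=> [z /= <- j _|z /= h].
  by split => //=; rewrite ffunE.
by apply/ffunP => j; rewrite ffunE; have [] := h j I.
Qed.

(** The grid is the same for both vectors, so rounding a pair gives again a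
    labelled configuration of couples of points. *)
Lemma labelling_pair n d (Z : measurableType d) (X Y : {mfun Z >-> V}) :
  labelling (fun z => (label n (X z), label n (Y z))).
Proof.
move=> [a b].
rewrite (_ : _ @^-1` _ = (fun z => label n (X z)) @^-1` [set a] `&`
                         (fun z => label n (Y z)) @^-1` [set b]).
  by apply: measurableI; exact: labelling_label.
by apply/seteqP; split=> z /= [-> ->].
Qed.

Lemma measurable_discretize n d (Z : measurableType d) (X : {mfun Z >-> V}) :
  measurable_fun setT (discretize n \o X).
Proof. exact: (@measurable_label _ _ _ Z V _ (@label_point n)
  (@labelling_label n _ _ X)). Qed.

Definition discretized n d (Z : measurableType d) (X : {mfun Z >-> V}) :
  {mfun Z >-> V} := mk_mfun (measurable_discretize n X).

Lemma discretize_le n (v : V) :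
  enorm (discretize n v - v) <= dim%:R * (1 + 2 * enorm v).
Proof.
rewrite -[dim in dim%:R]mul1n; apply: enorm_le_coord => i j.
rewrite !mxE ffunE ord1 (le_trans (round_le _ _))// lerD2l ler_wpM2l//.
exact: ler_norm_enorm.
Qed.

Lemma discretize_cvg (v : V) :
  enorm (discretize n v - v) @[n --> \oo] --> (0 : R).
Proof.
apply: (@squeeze_cvgr _ _ _ _ (cst 0) (fun n => dim%:R * n.+1%:R^-1)).
- near=> n; rewrite enorm_ge0/= -[dim in dim%:R]mul1n.
  apply: enorm_le_coord => i j; rewrite !mxE ffunE ord1; apply: round_close.
  apply: le_lt_trans (ler_norm_enorm v 0 j) _.
  near: n; exists (Num.truncn (enorm v)) => // n /= vn.
  by rewrite -truncn_le_nat.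
- exact: cvg_cst.
- by rewrite -[X in _ --> X](mulr0 dim%:R); apply: cvgMl_tmp; exact: cvg_harmonic.
Unshelve. all: by end_near.
Qed.

End rounding.

(** The bound [b] also makes the limit integrable, so that dominated convergence
    passes to the real-valued integrals. *)
Lemma Rintegral_cvg d (T : measurableType d) (R : realType)
    (mu : {measure set T -> \bar R}) (f_ : nat -> T -> R) (f b : T -> R) :
  (forall n, measurable_fun setT (f_ n)) ->
  (forall x, f_ n x @[n --> \oo] --> f x) ->
  mu.-integrable setT (EFin \o b) ->
  (forall n x, `|f_ n x| <= b x) ->
  \int[mu]_x f_ n x @[n --> \oo] --> \int[mu]_x f x.
Proof.
move=> mf ff ib fb; apply: fine_cvg.
have mlim : measurable_fun setT f.
  by apply: (measurable_fun_cvg mf) => x _; exact: ff.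
rewrite fineK; last first.
  apply: integrable_fin_num => //.
  apply: integrable_dominated ib => // x _.
  apply: (@ler_cvg_to _ \oo _ R (fun n => `|f_ n x|) (cst (b x))).
  - exact: (cvg_norm (ff x)).
  - exact: cvg_cst.
  - by apply: nearW => n; exact: fb.
apply: (@dominated_cvg _ _ _ mu setT measurableT (fun n x => (f_ n x)%:E)
   (fun x => (f x)%:E) (fun x => (b x)%:E)) => //.
- by move=> n; exact/measurable_EFinP.
- by move=> x _; apply/fine_cvgP; split; [exact: nearW|exact: ff].
- by move=> n x _; rewrite lee_fin.
Qed.

(** * Moving a measure along a coupling *)

Lemma cvg_expn (R : realType) (u : nat -> R) (l : R) k :
  u n @[n --> \oo] --> l -> u n ^+ k @[n --> \oo] --> l ^+ k.
Proof.
move=> ul; apply: (cvg_comp u (fun x : R => x ^+ k) ul).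
exact: exprn_continuous.
Qed.

Lemma cvg_sqrt (R : realType) (u : nat -> R) (l : R) :
  u n @[n --> \oo] --> l -> Num.sqrt (u n) @[n --> \oo] --> Num.sqrt l.
Proof.
move=> ul; apply: (cvg_comp u (fun x : R => Num.sqrt x) ul).
exact: sqrt_continuous.
Qed.

Lemma cvg_dist_le (R : realType) (u b : nat -> R) (l : R) :
  (forall n, `|l - u n| <= b n) -> b n @[n --> \oo] --> (0 : R) ->
  u n @[n --> \oo] --> l.
Proof.
move=> ub b0; apply/cvgrPdist_le => eps eps0; near=> n.
apply: le_trans (ub n) _; have : `|0 - b n| <= eps.
  by near: n; exact: cvgr_dist_le.
by rewrite distrC subr0; apply: le_trans; exact: ler_norm.
Unshelve. all: by end_near.
Qed.

Section lions_expansion_general.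
Context d (Omega : measurableType d) (R : realType) (P : probability Omega R).
Context (dim p e : nat).
Local Notation V := 'rV[R]_dim.
Context (phi : probability V R -> 'M[R]_(p, e)).
Context (g : probability V R -> V -> 'M[R]_(p * dim, e)) (K : R).
Hypothesis rP : rich P.
Hypothesis phi_borel : forall mu nu,
  finite_moment 2 mu -> eq_borel mu nu -> phi mu = phi nu.
Hypothesis phi_lions : forall mu,
  finite_moment 2 mu -> is_lions_derivative P phi mu (g mu).
Hypothesis g_bound : forall mu x, finite_moment 2 mu -> enorm (g mu x) <= K.
Hypothesis K_ge0 : 0 <= K.
Hypothesis g_lip : forall mu nu x y, finite_moment 2 mu -> finite_moment 2 nu ->
  ((enorm (g mu x - g nu y))%:E <=
   K%:E * (wasserstein 1 mu nu + (enorm (x - y))%:E))%E.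

Section discretized.
Context d' (Z : measurableType d') (Q : probability Z R).
Implicit Types U W : {mfun Z >-> V}.

Lemma finite_moment_discretized n U :
  finite_moment 2 (distribution Q (discretized n U)).
Proof.
apply/finite_moment_law; have [] := integral_label Q
  (fun a => enorm (@label_point R dim n a) ^+ 2) (@labelling_label _ _ n _ _ U).
by [].
Qed.

Lemma integrable_discretize_bound U k : finite_moment k (distribution Q U) ->
  Q.-integrable setT
    (EFin \o (fun z => (dim%:R * (1 + 2 * enorm (U z))) ^+ k)).
Proof.
move=> mU.
apply: (@integrable_dominated _ _ _ _ _ _
  (fun z => dim%:R ^+ k * (2 ^+ k * (1 + 2 ^+ k * enorm (U z) ^+ k)))) => //.
- apply: measurable_funX; apply: measurable_funM => //.
  apply: measurable_funD => //; apply: measurable_funM => //.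
  exact: (measurable_enormX U 1).
- move=> z _; have u0 := enorm_ge0 (U z).
  have u1 : 0 <= 1 + 2 * enorm (U z) by rewrite addr_ge0 ?mulr_ge0.
  rewrite ger0_norm ?exprn_ge0 ?mulr_ge0// exprMn ler_wpM2l ?exprn_ge0//.
  by rewrite (le_trans (ler_addX _ _ _)) ?mulr_ge0// expr1n exprMn.
- do 2 apply: integrable_mulr => //; apply: integrable_addr => //.
    exact: finite_measure_integrable_cst.
  by apply: integrable_mulr => //; exact/finite_moment_law.
Qed.

Lemma cvg_dist_discretized U k : (0 < k)%N ->
  finite_moment k (distribution Q U) ->
  \int[Q]_z enorm (discretized n U z - U z) ^+ k @[n --> \oo] --> (0 : R).
Proof.
move=> k0 mU.
have -> : (0 : R) = \int[Q]_z (cst 0 z) by rewrite Rintegral_cst// mul0r.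
apply: (@Rintegral_cvg _ _ _ Q (fun n z => enorm (discretized n U z - U z) ^+ k)
  (cst 0) _ _ _ (integrable_discretize_bound mU)).
- by move=> n; exact: measurable_distX.
- move=> z; have <- : (0 : R) ^+ k = 0 by rewrite expr0n gtn_eqF.
  by apply: cvg_expn; exact: discretize_cvg.
- move=> n z; rewrite ger0_norm ?exprn_ge0 ?enorm_ge0//.
  rewrite lerXn2r ?nnegrE ?enorm_ge0 ?mulr_ge0 ?addr_ge0// ?mulr_ge0 ?enorm_ge0//.
  exact: discretize_le.
Qed.

End discretized.

(** A Lions differentiable map is continuous along rounding: the rounding of [X],
    where [X] is the variable at which the lift is differentiable, has the law of
    the rounded [U], and converges to [X] in mean square. *)
Lemma phi_discretized_cvg d' (Z : measurableType d') (Q : probability Z R)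
    (U : {mfun Z >-> V}) i j : finite_moment 2 (distribution Q U) ->
  phi (distribution Q (discretized n U)) i j @[n --> \oo] -->
  phi (distribution Q U) i j.
Proof.
move=> mU; have [mg _ [X XU DX]] := phi_lions mU.
have mX : finite_moment 2 (distribution P X).
  by apply: eq_borel_finite_moment mU; exact: eq_borel_sym.
have mX1 := finite_momentW (isT : (1 <= 2)%N) mX.
pose Y n := discretized n X.
have mY n : finite_moment 2 (distribution P (Y n)).
  exact: finite_moment_discretized.
have YU n : eq_borel (distribution P (Y n)) (distribution Q (discretized n U)).
  apply: (@eq_borel_law_comp _ _ _ _ _ _ P Q X U (discretize n) _ (Y n)
    (discretized n U)) => //.
  exact: (measurable_discretize n (mk_mfun (@measurable_id _ V setT))).
pose a n := \int[P]_w enorm (Y n w - X w) ^+ 1.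
have a0 : a n @[n --> \oo] --> (0 : R) by exact: cvg_dist_discretized.
have b0 : L2norm P (Y n \- X) @[n --> \oo] --> (0 : R).
  rewrite -[X in _ --> X]sqrtr0; apply: cvg_sqrt.
  exact: cvg_dist_discretized.
have [dl dl0 Hdl] := DX 1 ltr01.
apply/cvgrPdist_le => eps eps0.
pose eps1 := Num.min dl (eps / 2); pose eps2 := eps / (2 * (K + 1)).
have K1 : 0 < K + 1 by rewrite ltr_wpDl.
have eps10 : 0 < eps1 by rewrite /eps1 lt_min dl0 divr_gt0.
have eps20 : 0 < eps2 by rewrite /eps2 divr_gt0// mulr_gt0.
near=> n.
have an : a n <= eps2.
  have : `|0 - a n| <= eps2 by near: n; exact: cvgr_dist_le.
  by rewrite distrC subr0; apply: le_trans; exact: ler_norm.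
have bn : L2norm P (Y n \- X) <= eps1.
  have : `|0 - L2norm P (Y n \- X)| <= eps1 by near: n; exact: cvgr_dist_le.
  by rewrite distrC subr0; apply: le_trans; exact: ler_norm.
have bdl : L2norm P (Y n \- X) <= dl.
  by rewrite (le_trans bn)// /eps1 ge_min lexx.
have := Hdl (Y n) (mY n) bdl; rewrite mul1r => bound.
have := le_trans (ler_norm_enorm _ i j) bound.
rewrite (phi_borel (mY n) (YU n)) (phi_borel mX XU) !mxE.
set I := Rintegral _ _ _ => H.
have HI : `|I| <= eps / 2.
  apply: (@le_trans _ _ (K * a n)).
    rewrite /a -RintegralZl//; last exact: integrable_dist (finite_momentW _ (mY n)) mX1.
    have iK : P.-integrable setT (EFin \o (fun w => K * enorm (Y n w - X w) ^+ 1)).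
      by apply: integrable_mulr => //; exact: integrable_dist (finite_momentW _ (mY n)) mX1.
    have msl := measurable_slot phi_lions X (Y n) i j mU.
    have bsl w : `|slot (g (distribution Q U) (X w)) (Y n w - X w) i j| <=
        K * enorm (Y n w - X w) ^+ 1 by exact: slot_bound.
    have isl := integrable_dominated measurableT msl (fun w _ => bsl w) iK.
    rewrite (le_trans (le_normr_Rintegral _ isl))// le_Rintegral//.
    apply: integrable_dominated iK => //; first exact: measurableT_comp.
    by move=> w _; rewrite normr_id.
  apply: (@le_trans _ _ ((K + 1) * eps2)).
    rewrite ler_pM//; first by apply: Rintegral_ge0 => w _; rewrite exprn_ge0 ?enorm_ge0.
    by rewrite lerDl.
  rewrite le_eqVlt; apply/orP; left; apply/eqP; rewrite /eps2; field.
  by rewrite gt_eqF.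
have bn2 : L2norm P (Y n \- X) <= eps / 2.
  by rewrite (le_trans bn)// /eps1 ge_min lexx orbT.
rewrite distrC [eps]splitr.
rewrite -[X in `|X|](subrK I) (le_trans (ler_normD _ _))// lerD//.
by rewrite (le_trans H).
Unshelve. all: by end_near.
Qed.

(** The estimate for labelled variables has constants that do not depend on the
    number of labels, so it passes to the limit along the rounded pairs. The
    coupling [(U, W)] is arbitrary: the derivative only depends on laws, not on
    the variable at which the lift was differentiated. *)
Lemma lions_expansion d' (Z : measurableType d') (Q : probability Z R)
    (U W : {mfun Z >-> V}) i j :
  finite_moment 2 (distribution Q U) -> finite_moment 2 (distribution Q W) ->
  `|(phi (distribution Q W) - phi (distribution Q U) -
     mxint Q setT (fun z => slot (g (distribution Q U) (U z)) (W z - U z))) i j|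
  <= K * ((\int[Q]_z enorm (W z - U z)) ^+ 2
          + \int[Q]_z enorm (W z - U z) ^+ 2).
Proof.
move=> mU mW.
have mU1 := finite_momentW (isT : (1 <= 2)%N) mU.
have mW1 := finite_momentW (isT : (1 <= 2)%N) mW.
pose b k z : R := 2 ^+ k * (2 ^+ k * ((dim%:R * (1 + 2 * enorm (U z))) ^+ k
  + (dim%:R * (1 + 2 * enorm (W z))) ^+ k) + enorm (W z - U z) ^+ k).
have ib k : finite_moment k (distribution Q U) ->
    finite_moment k (distribution Q W) -> Q.-integrable setT (EFin \o b k).
  move=> mUk mWk; apply: integrable_mulr => //; apply: integrable_addr => //.
    apply: integrable_mulr => //; apply: integrable_addr => //;
    exact: integrable_discretize_bound.
  exact: integrable_dist.
pose Un n := discretized n U; pose Wn n := discretized n W.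
(* A difference of rounded vectors splits into the rounding errors and the
   difference of the vectors, which gives an integrable bound uniform in n. *)
have dE (a1 a2 a3 a4 : V) : a1 - a2 = ((a1 - a3) - (a2 - a4)) + (a3 - a4).
  by apply/rowP => l; rewrite !mxE; ring.
have dB n z k : enorm (Wn n z - Un n z) ^+ k <= b k z.
  have A0 v : 0 <= dim%:R * (1 + 2 * enorm v) :> R.
    by rewrite mulr_ge0// addr_ge0// mulr_ge0// enorm_ge0.
  rewrite (@le_trans _ _ ((dim%:R * (1 + 2 * enorm (U z)) +
      dim%:R * (1 + 2 * enorm (W z)) + enorm (W z - U z)) ^+ k))//.
    rewrite lerXn2r ?nnegrE ?enorm_ge0 ?addr_ge0 ?A0 ?enorm_ge0//.
    rewrite (dE _ _ (W z) (U z)) (le_trans (ler_enormD _ _))// lerD2r.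
    by rewrite (le_trans (ler_enormB _ _))// addrC lerD// discretize_le.
  rewrite (le_trans (ler_addX _ _ _)) ?addr_ge0 ?A0 ?enorm_ge0//.
  by rewrite ler_wpM2l// lerD2r ler_addX.
have dist0 (X : {mfun Z >-> V}) z :
    enorm (discretized n X z - X z) @[n --> \oo] --> (0 : R).
  exact: discretize_cvg.
have dist00 z : enorm (Wn n z - W z) + enorm (Un n z - U z)
    @[n --> \oo] --> (0 : R).
  by rewrite -[X in _ --> X]addr0; apply: cvgD; exact: dist0.
have dd n z : enorm ((W z - U z) - (Wn n z - Un n z)) <=
    enorm (Wn n z - W z) + enorm (Un n z - U z).
  rewrite (dE (Wn n z) _ (W z) (U z)) opprD addrCA subrr addr0 enormN.
  exact: ler_enormB.
have dcvg z : enorm (Wn n z - Un n z) @[n --> \oo] --> enorm (W z - U z).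
  apply: cvg_dist_le (dist00 z) => n; rewrite (le_trans _ (dd n z))//.
  exact: ler_dist_enorm.
have Mcvg k : finite_moment k (distribution Q U) ->
    finite_moment k (distribution Q W) ->
  \int[Q]_z enorm (Wn n z - Un n z) ^+ k @[n --> \oo] -->
  \int[Q]_z enorm (W z - U z) ^+ k.
  move=> mUk mWk; apply: (@Rintegral_cvg _ _ _ Q
    (fun n z => enorm (Wn n z - Un n z) ^+ k) _ (b k)).
  - by move=> n; exact: measurable_distX.
  - by move=> z; apply: cvg_expn; exact: dcvg.
  - exact: ib.
  - by move=> n z; rewrite ger0_norm ?exprn_ge0 ?enorm_ge0.
have Dcvg : \int[Q]_z slot (g (distribution Q (Un n)) (Un n z))
      (Wn n z - Un n z) i j @[n --> \oo] -->
    \int[Q]_z slot (g (distribution Q U) (U z)) (W z - U z) i j.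
  apply: (@Rintegral_cvg _ _ _ Q (fun n z => slot (g (distribution Q (Un n))
      (Un n z)) (Wn n z - Un n z) i j) _ (fun z => K * b 1 z)).
  - by move=> n; apply: (measurable_slot phi_lions); exact: finite_moment_discretized.
  - move=> z; apply: (@cvg_dist_le _ _ (fun n =>
      K * (\int[Q]_z enorm (Un n z - U z) ^+ 1 + enorm (Un n z - U z))
        * enorm (W z - U z) +
      K * (enorm (Wn n z - W z) + enorm (Un n z - U z)))); last first.
      rewrite (_ : 0 = K * (0 + 0) * enorm (W z - U z) + K * 0 :> R); last first.
        by rewrite addr0 mulr0 mul0r addr0.
      apply: cvgD; last by apply: cvgMl_tmp; exact: dist00.
      apply: cvgMr_tmp; apply: cvgMl_tmp; apply: cvgD; last exact: dist0.
      exact: cvg_dist_discretized.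
    move=> n; have mUn : finite_moment 2 (distribution Q (Un n)).
      exact: finite_moment_discretized.
    set D := slot (g (distribution Q U) (U z)) (W z - U z) i j.
    set Dn := slot _ _ i j.
    pose Dm := slot (g (distribution Q (Un n)) (Un n z)) (W z - U z) i j.
    have -> : D - Dn = (D - Dm) + (Dm - Dn) by ring.
    rewrite (le_trans (ler_normD _ _))// lerD//.
      have -> : D - Dm = slot (g (distribution Q U) (U z) -
          g (distribution Q (Un n)) (Un n z)) (W z - U z) i j.
        by rewrite slotBl [RHS]mxE [X in _ = _ + X]mxE.
      rewrite (le_trans (enorm_slot_coord _ _ _ _))//.
      rewrite ler_wpM2r ?enorm_ge0// enormB.
      exact: (g_lip_law K_ge0 g_lip _ _ mUn mU).
    have -> : Dm - Dn = slot (g (distribution Q (Un n)) (Un n z))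
        ((W z - U z) - (Wn n z - Un n z)) i j.
      by rewrite slotBr [RHS]mxE [X in _ = _ + X]mxE.
    rewrite (le_trans (slot_bound g_bound _ _ _ _ mUn))//.
    by rewrite ler_wpM2l// dd.
  - by apply: integrable_mulr => //; exact: ib.
  - move=> n z; rewrite (le_trans (slot_bound g_bound _ _ _ _ _))//.
      exact: finite_moment_discretized.
    by rewrite ler_wpM2l// -[enorm _]expr1.
have En n := @expansion_finite _ _ _ _ _ _ _ phi g K rP phi_borel phi_lions
  K_ge0 g_lip _ _ Q _ _ (fun a => label_point a.1) (fun a => label_point a.2)
  (@labelling_pair _ _ n _ _ U W) (Un n) (Wn n) i j (fun=> erefl) (fun=> erefl).
apply: (@ler_cvg_to _ \oo _ R _ _ _ _ _ _ (nearW _ En)).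
  apply: cvg_norm.
  rewrite !mxE; under eq_fun do rewrite !mxE.
  apply: cvgB; last exact: Dcvg.
  by apply: cvgB; exact: phi_discretized_cvg.
apply: cvgMl_tmp; apply: cvgD; last exact: Mcvg.
apply: cvg_expn; exact: (Mcvg 1%N mU1 mW1).
Qed.

End lions_expansion_general.

(** * Partition sequences and tensor powers *)

Section partition_sequences.

Lemma mseqE k (a : k.-tuple nat) : mseq a = (\max_(l < k) nth 0 a l)%N.
Proof. by rewrite /mseq (big_nth 0%N) size_tuple big_mkord. Qed.

(** The condition on the last entry only involves the maximum of the others. *)
Lemma is_partseq_rcons k (a : k.+1.-tuple nat) x :
  is_partseq (rcons_tuple a x) = is_partseq a && (0 < x <= (mseq a).+1)%N.
Proof.
have nthr i : (i < k.+1)%N -> nth 0%N (rcons a x) i = nth 0%N a i.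
  by move=> ik; rewrite nth_rcons size_tuple ik.
have maxr i : (i <= k.+1)%N ->
    (\max_(l < i) nth 0 (rcons a x) l = \max_(l < i) nth 0 a l)%N.
  by move=> ik; apply: eq_bigr => l _; rewrite nthr// (leq_trans (ltn_ord l)).
apply/forallP/andP => [h|[/forallP h hx] i] /=.
  split; last first.
    have := h ord_max; rewrite /= nth_rcons size_tuple ltnn eqxx.
    by rewrite maxr// mseqE.
  apply/forallP => i; have := h (widen_ord (leqnSn _) i).
  by rewrite /= nthr// maxr// ltnW.
case: (ltnP i k.+1) => [ik|ki].
  by rewrite nthr// maxr ?(ltnW ik)//; exact: (h (Ordinal ik)).
have -> : (i : nat) = k.+1 by apply/eqP; rewrite eqn_leq ki -ltnS ltn_ord.
by rewrite /= nth_rcons size_tuple ltnn eqxx maxr// -mseqE.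
Qed.

Lemma partseq_entry k (a : k.-tuple nat) i : is_partseq a -> (i < k)%N ->
  (0 < nth 0 a i <= mseq a)%N.
Proof.
move=> /forallP h ik; apply/andP; split.
  by have := h (Ordinal ik) => /=; case: ifP => _; [move/eqP ->|move/andP => []].
by rewrite /mseq (big_nth 0%N) size_tuple (bigD1_seq i) ?mem_index_iota ?iota_uniq
  //= leq_maxl.
Qed.

Lemma rcons_tupleP k (b : k.+1.-tuple nat) :
  exists (a : k.-tuple nat) x, b = rcons_tuple a x.
Proof.
have sz : size (take k b) == k by rewrite size_take size_tuple ltnS leqnn.
exists (Tuple sz), (nth 0%N b k); apply/val_inj => /=.
by rewrite -take_nth ?size_tuple// take_oversize ?size_tuple.
Qed.

(** A partition sequence of length [k + 2] extends a unique one [a] of length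
    [k + 1] by an old value or by the new value [mseq a + 1]. *)
Lemma sum_partseqsS (G : nmodType) k (F : k.+2.-tuple nat -> G) :
  \sum_(b <- partseqs k.+2) F b =
  \sum_(a <- partseqs k.+1) \sum_(j < (mseq a).+1) F (rcons_tuple a j.+1).
Proof.
pose L := [seq rcons_tuple a x | a <- partseqs k.+1, x <- iota 1 (mseq a).+1].
have rconsI (a a' : k.+1.-tuple nat) x x' :
    rcons_tuple a x = rcons_tuple a' x' -> a = a' /\ x = x'.
  by move/(congr1 val) => /= /rcons_inj[/val_inj -> ->].
have perm : perm_eq (partseqs k.+2) L.
  apply: uniq_perm; first exact: uniq_partseqs.
    apply: allpairs_uniq_dep; first exact: uniq_partseqs.
      by move=> a _; exact: iota_uniq.
    by move=> [a x] [a' x'] _ _ /= /rconsI[-> ->].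
  move=> b; have [a [x ->]] := rcons_tupleP b.
  rewrite mem_partseqs is_partseq_rcons; apply/andP/allpairsPdep.
    move=> [aP xP]; exists a, x; split; rewrite ?mem_partseqs//.
    by rewrite mem_iota add1n ltnS.
  move=> [a' [x' [a'P x'P /rconsI[-> ->]]]]; move: a'P x'P.
  by rewrite mem_partseqs mem_iota add1n ltnS.
rewrite (perm_big _ perm) big_allpairs_dep; apply: eq_bigr => a _.
have -> : iota 1 (mseq a).+1 = index_iota 1 (mseq a).+2.
  by rewrite /index_iota subn1.
by rewrite big_add1/= big_mkord.
Qed.

Lemma partseqs1 : partseqs 1 = [:: [tuple 1%N]].
Proof.
have mem1 b : (b \in partseqs 1) = (b == [tuple 1%N]).
  rewrite mem_partseqs; apply/forallP/eqP => [/(_ ord0)/= /eqP h|-> i].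
    by apply/val_inj; case: b h => -[|x []]//= _ ->.
  by rewrite ord1.
have := uniq_partseqs 1; move: mem1; case: (partseqs 1) => [|a [|b s]] mem1.
- by have := mem1 [tuple 1%N]; rewrite eqxx in_nil.
- by move=> _; rewrite (_ : a = [tuple 1%N])//; apply/eqP; rewrite -mem1 mem_head.
- have a1 : a == [tuple 1%N] by rewrite -mem1 mem_head.
  have b1 : b == [tuple 1%N] by rewrite -mem1 !inE eqxx orbT.
  by rewrite (eqP a1) (eqP b1) cons_uniq mem_head.
Qed.

End partition_sequences.

Section tensors.
Context {R : realType} {dim : nat}.
Local Notation V := 'rV[R]_dim.

Lemma eq_tensor k (x y : nat -> V) :
  (forall i, (i < k)%N -> x i = y i) -> tensor k x = tensor k y.
Proof.
elim: k => [//|k IH] xy /=; rewrite xy// IH// => i ik.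
by apply: xy; rewrite ltnS ltnW.
Qed.

Lemma enorm_tensor k (x : nat -> V) :
  enorm (tensor k x) = \prod_(i < k) enorm (x i).
Proof.
elim: k => [|k IH]; last by rewrite big_ord_recr/= -IH enorm_tens.
by rewrite big_ord0 /enorm !big_ord1 mxE eqxx expr1n sqrtr1.
Qed.

(** [increment] on sequences of any size, since appending an entry to [a] changes
    the size [mseq a] of the tuples. *)
Definition incr k (a : seq nat) (w : seq (V * V)) : 'rV[R]_(tdim dim k) :=
  tensor k (fun i => let z := nth (0, 0) w (nth 0%N a i).-1 in z.2 - z.1).

Lemma incr_rcons k e (a : k.-tuple nat) x (w : seq (V * V))
    (L : 'M[R]_(tdim dim k.+1, e)) :
  incr k.+1 (rcons a x) w *m L =
  incr k a w *m slot L ((nth (0, 0) w x.-1).2 - (nth (0, 0) w x.-1).1).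
Proof.
rewrite mul_slot /incr /= nth_rcons size_tuple ltnn eqxx.
rewrite (@eq_tensor k _ (fun i => (nth (0, 0) w (nth 0%N a i).-1).2
  - (nth (0, 0) w (nth 0%N a i).-1).1))// => i ik.
by rewrite nth_rcons size_tuple ik.
Qed.

Lemma incr_cat k (a : k.-tuple nat) (w w' : seq (V * V)) : is_partseq a ->
  (mseq a <= size w)%N -> incr k a (w ++ w') = incr k a w.
Proof.
move=> aP aw; apply: eq_tensor => i ik; rewrite nth_cat.
by have /andP[a0 am] := partseq_entry aP ik; rewrite prednK// (leq_trans am).
Qed.

Definition span (w : seq (V * V)) : R := \sum_(z <- w) enorm (z.2 - z.1).

Lemma span_ge0 w : 0 <= span w.
Proof. by apply: sumr_ge0 => z _; exact: enorm_ge0. Qed.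

Lemma enorm_le_span w i :
  enorm ((nth (0, 0) w i).2 - (nth (0, 0) w i).1) <= span w.
Proof.
elim: w i => [|z w IH] i; first by rewrite nth_nil subrr enorm0 span_ge0.
rewrite /span big_cons; case: i => [|i] /=; first by rewrite lerDl span_ge0.
by rewrite (le_trans (IH i))// lerDr enorm_ge0.
Qed.

Lemma enorm_incr k a w : enorm (incr k a w) <= (1 + span w) ^+ k.
Proof.
rewrite enorm_tensor -[X in _ ^+ X](card_ord k) -prodr_const.
apply: ler_prod => i _; rewrite enorm_ge0/= (le_trans (enorm_le_span _ _))//.
by rewrite lerDr.
Qed.

End tensors.

(** * Integrability along the interpolation *)

Section interpolation.
Context {R : realType} {dim : nat} (Pi : probability ('rV[R]_dim * 'rV[R]_dim)%type R).
Local Notation V := 'rV[R]_dim.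
Context (N : nat).
Hypothesis N2 : (2 <= N)%N.
Hypothesis m0 : finite_moment N (interp_law Pi 0).
Hypothesis m1 : finite_moment N (interp_law Pi 1).

Lemma interpB s t (z : V * V) :
  interp t z - interp s z = (t - s) *: (z.2 - z.1).
Proof. by rewrite /interp opprD addrACA subrr add0r -scalerBl. Qed.

Lemma finite_moment_interp t : finite_moment N (interp_law Pi t).
Proof.
have := finite_moment_lin (1 - t) t m0 m1.
apply: eq_borel_finite_moment; apply: eq_borel_law => z /=.
by rewrite /interp; apply/rowP => l; rewrite !mxE; ring.
Qed.

Lemma finite_moment2_interp t : finite_moment 2 (interp_law Pi t).
Proof. exact: (finite_momentW N2 (finite_moment_interp t)). Qed.

Lemma integrable_length q : (q <= N)%N ->
  Pi.-integrable setT (EFin \o (fun z => enorm (z.2 - z.1) ^+ q)).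
Proof.
move=> qN; have := integrable_dist (finite_momentW qN m1) (finite_momentW qN m0).
apply: eq_integrable => // z _ /=.
by rewrite interpB subr0 scale1r.
Qed.

Definition mean_length : R := \int[Pi]_z enorm (z.2 - z.1).

Lemma mean_length_ge0 : 0 <= mean_length.
Proof. by apply: Rintegral_ge0 => z _; exact: enorm_ge0. Qed.

Lemma measurable_increment i : measurable_fun setT (fun z : V * V => (z.2 - z.1) 0 i).
Proof.
rewrite (_ : (fun _ => _) = fun z : V * V => z.2 0 i - z.1 0 i).
  by apply: measurable_funB; apply: (measurableT_comp (measurable_coord _ _)).
by apply/funext => z; rewrite !mxE.
Qed.

(** [interp s] and [interp t] are coupled by [Pi] itself. *)
Lemma wasserstein_interp s t :
  (wasserstein 1 (interp_law Pi s) (interp_law Pi t) <=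
   (`|t - s| * mean_length)%:E)%E.
Proof.
apply: le_trans (wasserstein1_law _ _ _) _.
have i1 : Pi.-integrable setT (EFin \o (fun z : V * V => enorm (z.2 - z.1))).
  by apply: eq_integrable (integrable_length (ltnW N2)).
rewrite EFinM EFin_Rintegral// -integralZl//.
rewrite le_eqVlt; apply/orP; left; apply/eqP; apply: eq_integral => z _.
by rewrite -EFinM interpB enormZ distrC.
Qed.

Lemma measurable_nth m j :
  measurable_fun [set: m.-tuple (V * V)] (fun w => nth (0, 0) w j).
Proof.
have [jm|mj] := ltnP j m.
  rewrite (_ : (fun _ => _) = @tnth _ _ ^~ (Ordinal jm)).
    exact: measurable_tnth.
  by apply/funext => w; rewrite (tnth_nth (0, 0)).
rewrite (_ : (fun _ => _) = cst (0, 0))//.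
by apply/funext => w; rewrite nth_default// size_tuple.
Qed.

Lemma measurable_incr m k (a : seq nat) l :
  measurable_fun [set: m.-tuple (V * V)] (fun w => incr k a w 0 l).
Proof.
elim: k l => [|k IH] l; first exact: measurable_cst.
under eq_fun do rewrite /incr /= tens_rowE.
apply: measurable_funM; first exact: IH.
exact: (measurableT_comp (measurable_increment _) (@measurable_nth m _)).
Qed.

Lemma measurable_incr_mul m k e (a : seq nat)
    (F : m.-tuple (V * V) -> 'M[R]_(tdim dim k, e)) c :
  (forall i j, measurable_fun setT (fun w => F w i j)) ->
  measurable_fun setT
    (fun w : m.-tuple (V * V) => (incr k a w *m F w) 0 c).
Proof.
move=> mF; under eq_fun do rewrite mxE.
by apply: measurable_sum => l; apply: measurable_funM => //; exact: measurable_incr.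
Qed.

Lemma span_tuple m (w : m.-tuple (V * V)) :
  span w = \sum_(i < m) enorm ((tnth w i).2 - (tnth w i).1).
Proof. by rewrite /span big_tuple. Qed.

Lemma measurable_length q : measurable_fun setT (fun z : V * V => enorm (z.2 - z.1) ^+ q).
Proof.
by apply/measurable_funX/measurable_enorm => // i j; rewrite ord1; exact: measurable_increment.
Qed.

Lemma measurable_span m : measurable_fun setT (fun w : m.-tuple (V * V) => span w).
Proof.
under eq_fun do rewrite span_tuple.
apply: measurable_sum => i.
apply: (measurableT_comp (f := fun z : V * V => enorm (z.2 - z.1) ^+ 1)).
  exact: measurable_length.
exact: measurable_tnth.
Qed.

Lemma ler_sumX m (x : 'I_m -> R) p : (forall i, 0 <= x i) ->
  (\sum_i x i) ^+ p.+1 <= m%:R ^+ p.+1 * \sum_i x i ^+ p.+1.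
Proof.
case: m x => [|m] x x0; first by rewrite !big_ord0 expr0n mulr0.
pose i0 := [arg max_(i > ord0 : 'I_m.+1) x i]%O.
have x_le i : x i <= x i0.
  by rewrite /i0; case: arg_maxP => // j _ jmax; exact: jmax.
have s0 : 0 <= \sum_i x i by exact: sumr_ge0.
apply: (@le_trans _ _ ((m.+1%:R * x i0) ^+ p.+1)).
  rewrite lerXn2r ?nnegrE ?mulr_ge0//.
  have -> : m.+1%:R * x i0 = \sum_(i < m.+1) x i0.
    by rewrite sumr_const card_ord mulr_natl.
  exact: ler_sum.
rewrite exprMn ler_wpM2l ?exprn_ge0// (bigD1 i0)//= lerDl.
by apply: sumr_ge0 => i _; rewrite exprn_ge0.
Qed.

Lemma integrable_power_tnth m (i : 'I_m) q : (q <= N)%N ->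
  (power_prob Pi m).-integrable setT
    (EFin \o (fun w : m.-tuple (V * V) => enorm ((tnth w i).2 - (tnth w i).1) ^+ q)).
Proof.
move=> qN; have /integrableP[_ h] := integrable_length qN.
have mt : measurable_fun setT (fun w : m.-tuple (V * V) =>
    enorm ((tnth w i).2 - (tnth w i).1) ^+ q).
  exact: (measurableT_comp (measurable_length q) (measurable_tnth i)).
apply/integrableP; split; first exact/measurable_EFinP.
rewrite (@ge0_integral_power_tnth _ _ _ Pi m i
  (fun z => `|(enorm (z.2 - z.1) ^+ q)%:E|%E))//.
by apply: measurableT_comp => //; apply/measurable_EFinP; exact: measurable_length.
Qed.

(** The sum of the displacements has as many moments as [Pi], for any number of
    independent copies; all integrands below are dominated by one of its powers. *)
Lemma integrable_span m q : (q <= N)%N ->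
  (power_prob Pi m).-integrable setT (EFin \o (fun w : m.-tuple (V * V) => (1 + span w) ^+ q)).
Proof.
move=> qN; apply: (@integrable_expW _ _ _ _ (fun w : m.-tuple (V * V) => 1 + span w) q N) => //.
- by apply: measurable_funD => //; exact: measurable_span.
- by move=> w; rewrite addr_ge0// span_ge0.
have N0 : N = N.-1.+1 by rewrite prednK// ltnW.
apply: (@integrable_dominated _ _ _ _ _ _ (fun w : m.-tuple (V * V) =>
  2 ^+ N * (1 + m%:R ^+ N *
    \sum_i enorm ((tnth w i).2 - (tnth w i).1) ^+ N))) => //.
- by apply: measurable_funX; apply: measurable_funD => //; exact: measurable_span.
- move=> w _; have s0 := span_ge0 w.
  rewrite ger0_norm ?exprn_ge0 ?addr_ge0// (le_trans (ler_addX _ _ _))//.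
  rewrite ler_wpM2l// expr1n lerD2l span_tuple N0 ler_sumX// => i.
  exact: enorm_ge0.
- apply: integrable_mulr => //; apply: integrable_addr => //.
    exact: finite_measure_integrable_cst.
  apply: integrable_mulr => //; apply: integrable_sumr => // i.
  exact: integrable_power_tnth.
Qed.

Lemma integrable_incr_mul m k e (a : seq nat)
    (F : m.-tuple (V * V) -> 'M[R]_(tdim dim k, e)) c K : (k <= N)%N ->
  (forall i j, measurable_fun setT (fun w => F w i j)) ->
  (forall w, enorm (F w) <= K) ->
  (power_prob Pi m).-integrable setT
    (EFin \o (fun w : m.-tuple (V * V) => (incr k a w *m F w) 0 c)).
Proof.
move=> kN mF FK.
apply: (@integrable_dominated _ _ _ _ _ _
  (fun w : m.-tuple (V * V) => K * (1 + span w) ^+ k)) => //.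
- exact: measurable_incr_mul.
- move=> w _; rewrite (le_trans (ler_norm_enorm _ _ _))//.
  rewrite (le_trans (enorm_mulmx _ _))// mulrC ler_pM ?enorm_ge0//.
  exact: enorm_incr.
- by apply: integrable_mulr => //; exact: integrable_span.
Qed.

Section lipschitz_kernel.
Context (m q e : nat) (D : probability V R -> 'M[R]_(m, dim) -> 'M[R]_(q, e)).
Context (K : R).
Hypothesis K_ge0 : 0 <= K.
Hypothesis D_lip : forall mu nu u v, finite_moment 2 mu -> finite_moment 2 nu ->
  ((enorm (D mu u - D nu v))%:E <=
   K%:E * (wasserstein 1 mu nu
           + (\sum_(i < m) enorm (row i u - row i v))%:E))%E.

Lemma kernel_lip s t u v :
  enorm (D (interp_law Pi t) u - D (interp_law Pi s) v) <=
  K * (`|t - s| * mean_length + \sum_(i < m) enorm (row i u - row i v)).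
Proof.
rewrite -lee_fin (le_trans (D_lip _ _ (finite_moment2_interp _)
  (finite_moment2_interp _)))// EFinM lee_wpmul2l ?lee_fin// EFinD leeD2r//.
by rewrite distrC wasserstein_interp.
Qed.

Lemma row_points (w : m.-tuple (V * V)) s t i :
  row i (points w t) - row i (points w s) =
  (t - s) *: ((tnth w i).2 - (tnth w i).1).
Proof. by rewrite !rowK interpB. Qed.

Lemma sum_row_points (w : m.-tuple (V * V)) s t :
  \sum_(i < m) enorm (row i (points w t) - row i (points w s)) =
  `|t - s| * span w.
Proof.
rewrite span_tuple mulr_sumr; apply: eq_bigr => i _.
by rewrite row_points enormZ.
Qed.

Lemma kernel_lip_points (w : m.-tuple (V * V)) s t u v :
  enorm (D (interp_law Pi t) (points w u) - D (interp_law Pi s) (points w v)) <=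
  K * (`|t - s| * mean_length + `|u - v| * span w).
Proof. by rewrite (le_trans (kernel_lip _ _ _ _))// sum_row_points. Qed.

Lemma measurable_points (w_ : nat) t i j :
  measurable_fun [set: w_.-tuple (V * V)] (fun w => points w t i j).
Proof.
under eq_fun do rewrite mxE.
apply: (measurableT_comp (measurable_coord _ _)).
apply: (measurableT_comp (@measurable_interp R dim t)); exact: measurable_tnth.
Qed.

Lemma kernel_continuous s i j : continuous (fun A => D (interp_law Pi s) A i j).
Proof.
apply: (@continuous_coords _ _ _ _ K) => A B.
apply: (@le_trans _ _ (enorm (D (interp_law Pi s) A - D (interp_law Pi s) B))).
  by have := ler_norm_enorm (D (interp_law Pi s) A - D (interp_law Pi s) B) i j;
    rewrite !mxE.
rewrite (le_trans (kernel_lip _ _ _ _))// subrr normr0 mul0r add0r ler_wpM2l//.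
apply: ler_sum => k _; rewrite (le_trans (ler_enorm_l1 _))// big_ord1.
by apply: ler_sum => l _; rewrite !mxE.
Qed.

Lemma measurable_kernel d (T : measurableType d) s (F : T -> 'M[R]_(m, dim)) i j :
  (forall i j, measurable_fun setT (fun x => F x i j)) ->
  measurable_fun setT (fun x => D (interp_law Pi s) (F x) i j).
Proof.
move=> mF; exact: (measurable_continuous_mx (@kernel_continuous s i j) mF).
Qed.

End lipschitz_kernel.
End interpolation.

(** * Moving the points *)

Section expansion_in_the_points.
Context {R : realType} (m dim q e : nat).
Context (D : 'M[R]_(m, dim) -> 'M[R]_(q, e)).
Context (G : 'I_m -> 'M[R]_(m, dim) -> 'M[R]_(q * dim, e)) (K : R).
Hypothesis K_ge0 : 0 <= K.
Hypothesis D_diff : forall v, differentiable D v.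
Hypothesis D_partial : forall v (j : 'I_m) (h : 'rV[R]_dim),
  'd D v (delta_mx j 0 *m h) = slot (G j v) h.
Hypothesis G_lip : forall j u v,
  enorm (G j u - G j v) <= K * \sum_(i < m) enorm (row i u - row i v).

Lemma differential_rows v H : 'd D v H = \sum_j slot (G j v) (row j H).
Proof.
have {1}-> : H = \sum_j (delta_mx j 0 *m row j H).
  apply/matrixP => i c; rewrite summxE (bigD1 i)//= big1 ?addr0.
    by rewrite mxE big_ord1 !mxE !eqxx mul1r.
  by move=> j ji; rewrite mxE big_ord1 !mxE eq_sym (negbTE ji) mul0r.
by rewrite linear_sum; apply: eq_bigr => j _; exact: D_partial.
Qed.

Lemma derive_line X H i c (t : R) :
  is_derive t (1 : R) (fun s : R => D (X + s *: H) i c)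
    (\sum_j slot (G j (X + t *: H)) (row j H) i c).
Proof.
set v := X + t *: H.
have dv : derivable D v H by exact/diff_derivable.
have dE : 'D_H D v = 'd D v H by rewrite deriveE.
suff fl : h^-1 *: (D (X + (h *: 1 + t) *: H) i c - D v i c) @[h --> 0^'] -->
    \sum_j slot (G j v) (row j H) i c.
  have df : derivable (fun s : R => D (X + s *: H) i c) t (1 : R).
    by apply/cvg_ex; eexists; exact: fl.
  by apply: DeriveDef => //; exact/cvg_lim.
have -> : \sum_j slot (G j v) (row j H) i c = ('D_H D v) i c.
  by rewrite dE differential_rows summxE.
have -> : (fun h : R => h^-1 *: (D (X + (h *: 1 + t) *: H) i c - D v i c)) =
    (fun M : 'M[R]_(q, e) => M i c) \o
    (fun h : R => h^-1 *: (D (h *: H + v) - D v)).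
  apply/funext => h /=; rewrite !mxE; congr (_ * (D _ i c - _)).
  by rewrite /v addrCA scalerDl /GRing.scale/= mulr1.
apply: cvg_comp; first exact: dv.
exact: coord_continuous.
Qed.

(** Along a line the derivative of [D] is the sum of the partial derivatives
    applied to the rows of the direction, and it is Lipschitz. *)
Lemma expansion_in_points X H i c :
  `|(D (X + H) - D X - \sum_j slot (G j X) (row j H)) i c| <=
  K * (\sum_j enorm (row j H)) ^+ 2.
Proof.
have := @taylor1_bound R (fun s => D (X + s *: H) i c)
  (fun t => \sum_j slot (G j (X + t *: H)) (row j H) i c)
  (K * (\sum_j enorm (row j H)) ^+ 2) (derive_line X H i c).
rewrite scale1r scale0r addr0.
have -> : (D (X + H) - D X - \sum_j slot (G j X) (row j H)) i c =
  D (X + H) i c - D X i c - \sum_j slot (G j X) (row j H) i c.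
  by rewrite [LHS]mxE [X in X + _]mxE [X in _ + X + _]mxE [X in _ + X]mxE summxE.
apply=> t /andP[t0 t1]; rewrite -sumrB.
rewrite (le_trans (ler_norm_sum _ _ _))// expr2 mulrA mulr_sumr.
apply: ler_sum => j _; set L1 := G j _; set L2 := G j X.
have -> : slot L1 (row j H) i c - slot L2 (row j H) i c =
    slot (L1 - L2) (row j H) i c.
  by rewrite slotBl [RHS]mxE [X in _ = _ + X]mxE.
rewrite (le_trans (enorm_slot_coord _ _ _ _))// ler_wpM2r ?enorm_ge0//.
rewrite (le_trans (G_lip _ _ _))// ler_wpM2l//; apply: ler_sum => l _.
rewrite (_ : _ - _ = t *: row l H); last first.
  by apply/rowP => r; rewrite !mxE; ring.
by rewrite enormZ ger0_norm// ler_piMl// enorm_ge0.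
Qed.

End expansion_in_the_points.

Section tuple_variables.
Context {R : realType} {dim e : nat}.
Local Notation V := 'rV[R]_dim.
Context (Df : derivatives R dim e) (Pi : probability (V * V)%type R).

(** Along the interpolation, the k-th derivative of the path
    [t |-> f (Pi_t)] is the sum of these integrals over [a \in partseqs k]. *)
Definition flow_int k (a : k.-tuple nat) (t : R) : 'rV[R]_e :=
  mxint (power_prob Pi (mseq a)) setT
    (fun w => increment w *m @Df k a (interp_law Pi t) (points w t)).

(** The integrand of [flow_int], on tuples whose size is only provably [mseq a]. *)
Definition flow_fun k (a : k.-tuple nat) m (E : mseq a = m) (t : R)
    (w : m.-tuple (V * V)) : 'rV[R]_e :=
  incr k a w *m @Df k a (interp_law Pi t) (castmx (esym E, erefl) (points w t)).

Lemma flow_int_cast k (a : k.-tuple nat) m (E : mseq a = m) t c :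
  flow_int a t 0 c = \int[power_prob Pi m]_w flow_fun E t w 0 c.
Proof. by case: m / E; rewrite mxE. Qed.

Lemma integrable_flow_cast k (a : k.-tuple nat) m (E : mseq a = m) t c :
  (power_prob Pi (mseq a)).-integrable setT
    (EFin \o (fun w => flow_fun (erefl (mseq a)) t w 0 c)) ->
  (power_prob Pi m).-integrable setT (EFin \o (fun w => flow_fun E t w 0 c)).
Proof. by case: m / E. Qed.

Lemma Rintegral_power_rcons m (h : m.+1.-tuple (V * V) -> R) :
  (power_prob Pi m.+1).-integrable setT (EFin \o h) ->
  (forall w, Pi.-integrable setT (EFin \o (fun z => h (trcons (w, z))))) ->
  (power_prob Pi m).-integrable setT
    (EFin \o (fun w => \int[Pi]_z h (trcons (w, z)))) /\
  \int[power_prob Pi m.+1]_w h w =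
  \int[power_prob Pi m]_w \int[Pi]_z h (trcons (w, z)).
Proof.
move=> hi hw; have [hi' hE] := integral_power_rcons hi.
have FE : fubini_F Pi (EFin \o (fun w => h (trcons w))) =
    (fun w : m.-tuple (V * V) => (\int[Pi]_z h (trcons (w, z)))%:E).
  by apply/funext => w; rewrite EFin_Rintegral.
split; first by have := integrable_fubini_F hi'; rewrite FE.
by rewrite /Rintegral hE -(integral12_prod_meas1 hi') FE.
Qed.

(** A transport along [mseq a + 1 = (mseq a).+1] is needed since [power_prob] and
    [trcons] compute on successors. *)
Definition mseq_newS k (a : k.-tuple nat) :
  mseq (rcons_tuple a (mseq a).+1) = (mseq a).+1 :=
  etrans (mseq_new a) (addn1 (mseq a)).

(** Appending an old value to [a] contracts the last slot with the displacement of
    a point that is already present. *)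
Lemma flow_fun_old k (a : k.-tuple nat) (j : 'I_(mseq a)) t w :
  flow_fun (mseq_old j) t w =
  incr k a w *m slot (@Df k.+1 (rcons_tuple a j.+1) (interp_law Pi t)
    (castmx (esym (mseq_old j), erefl) (points w t)))
    ((tnth w j).2 - (tnth w j).1).
Proof. by rewrite /flow_fun incr_rcons (tnth_nth (0, 0)). Qed.

(** Appending the new value contracts the last slot with the displacement of an
    additional independent point. *)
Lemma flow_fun_new k (a : k.-tuple nat) t (w : (mseq a).-tuple (V * V)) z :
  is_partseq a ->
  flow_fun (mseq_newS a) t (trcons (w, z)) =
  incr k a w *m slot (@Df k.+1 (rcons_tuple a (mseq a).+1) (interp_law Pi t)
    (castmx (esym (mseq_new a), erefl) (col_mx (points w t) (interp t z))))
    (z.2 - z.1).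
Proof.
move=> aP; rewrite /flow_fun incr_rcons.
have -> : incr k a (trcons (w, z)) = incr k a w :> 'rV[R]__.
  by rewrite /= -cats1 incr_cat// size_tuple.
have -> : nth (0, 0) (trcons (w, z)) (mseq a).+1.-1 = z.
  by rewrite /= nth_rcons size_tuple ltnn eqxx.
have -> // : castmx (esym (mseq_newS a), erefl) (points (trcons (w, z)) t) =
  castmx (esym (mseq_new a), erefl) (col_mx (points w t) (interp t z)).
apply/matrixP => i j; rewrite !castmxE/= !cast_ord_id mxE.
rewrite (tnth_nth (0, 0))/= nth_rcons size_tuple.
rewrite [RHS]mxE; case: splitP => /= l il; rewrite il.
  by rewrite ltn_ord [RHS]mxE (tnth_nth (0, 0)).
by rewrite ltnNge leq_addr /= ord1 addn0 eqxx.
Qed.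

End tuple_variables.

(** * The derivative of the iterated integrals *)

Section row_distances.
Context {R : realType} {dim : nat}.

Lemma sum_row_castmx m m' (E : m = m') (u v : 'M[R]_(m, dim)) :
  \sum_i enorm (row i (castmx (E, erefl) u) - row i (castmx (E, erefl) v)) =
  \sum_i enorm (row i u - row i v).
Proof. by case: m' / E; rewrite !castmx_id. Qed.

Lemma sum_row_col_mx m (u v : 'M[R]_(m, dim)) (x y : 'rV[R]_dim) :
  \sum_i enorm (row i (col_mx u x) - row i (col_mx v y)) =
  \sum_i enorm (row i u - row i v) + enorm (x - y).
Proof.
rewrite big_split_ord big_ord1/= !rowKd !row_id; congr (_ + _).
by apply: eq_bigr => i _; rewrite !rowKu.
Qed.

End row_distances.

Section flow_derivative.
Context d (Omega : measurableType d) (R : realType) (P : probability Omega R).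
Context {dim e : nat} (Df : derivatives R dim e) (K : R).
Local Notation V := 'rV[R]_dim.
Context (Pi : probability (V * V)%type R) (N : nat).
Hypothesis rP : rich P.
Hypothesis N2 : (2 <= N)%N.
Hypothesis m0 : finite_moment N (interp_law Pi 0).
Hypothesis m1 : finite_moment N (interp_law Pi 1).
Hypothesis K_ge0 : 0 <= K.

Let m2 := finite_moment2_interp N2 m0 m1.

Lemma lipschitz_eq_borel k (a : k.-tuple nat) mu nu v :
  lipschitz_by Df K a -> finite_moment 2 mu -> eq_borel mu nu ->
  @Df k a mu v = @Df k a nu v.
Proof.
move=> aL mmu munu; apply/eqP; rewrite -subr_eq0; apply/eqP/matrixP => i j.
rewrite [RHS]mxE; apply/eqP; rewrite -normr_le0.
rewrite (le_trans (ler_norm_enorm _ _ _))// -lee_fin.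
rewrite (le_trans (aL _ _ _ _ mmu (eq_borel_finite_moment munu mmu)))//.
rewrite big1 ?adde0; last by move=> l _; rewrite subrr enorm0.
by rewrite mule_ge0_le0// wasserstein1_eq_borel.
Qed.

Section integrability.
Context k (a : k.-tuple nat).
Hypothesis aB : bounded_by Df K a.
Hypothesis aL : lipschitz_by Df K a.

Lemma measurable_flow_kernel t i j :
  measurable_fun setT (fun w : (mseq a).-tuple (V * V) =>
    @Df k a (interp_law Pi t) (points w t) i j).
Proof.
apply: (measurable_kernel N2 m0 m1 K_ge0 aL) => i' j'.
exact: measurable_points.
Qed.

Lemma integrable_flow t c : (k <= N)%N ->
  (power_prob Pi (mseq a)).-integrable setT
    (EFin \o (fun w => flow_fun Df Pi (erefl (mseq a)) t w 0 c)).
Proof.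
move=> kN; apply: (@integrable_incr_mul _ _ _ N N2 m0 m1 _ _ _ _ _ _ K) => //.
  by move=> i j; under eq_fun do rewrite castmx_id; exact: measurable_flow_kernel.
by move=> w; apply: aB; exact: m2.
Qed.

End integrability.

Section one_step.
Context k (a : k.-tuple nat).
Hypothesis aP : is_partseq a.
Hypothesis kN : (k.+2 <= N)%N.
Hypothesis aB : bounded_by Df K a.
Hypothesis aL : lipschitz_by Df K a.
Hypothesis bB : forall j, (j < (mseq a).+1)%N ->
  bounded_by Df K (rcons_tuple a j.+1).
Hypothesis bL : forall j, (j < (mseq a).+1)%N ->
  lipschitz_by Df K (rcons_tuple a j.+1).
Hypothesis a_diff : forall mu v, finite_moment 2 mu ->
  differentiable (@Df k a mu) v /\
  forall (j : 'I_(mseq a)) (h : V),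
    'd (@Df k a mu) v (delta_mx j 0 *m h) =
    slot (@Df k.+1 (rcons_tuple a j.+1) mu
           (castmx (esym (mseq_old j), erefl) v)) h.
Hypothesis a_lions : forall mu v, finite_moment 2 mu ->
  is_lions_derivative P (fun mu' => @Df k a mu' v) mu
    (fun x => @Df k.+1 (rcons_tuple a (mseq a).+1) mu
               (castmx (esym (mseq_new a), erefl) (col_mx v x))).

Let Gold s (j : 'I_(mseq a)) v := @Df k.+1 (rcons_tuple a j.+1) (interp_law Pi s)
  (castmx (esym (mseq_old j), erefl) v).
Let Gnew s v x := @Df k.+1 (rcons_tuple a (mseq a).+1) (interp_law Pi s)
  (castmx (esym (mseq_new a), erefl) (col_mx v x)).
Let D1 := mean_length Pi.
Let D2 := \int[Pi]_z enorm (z.2 - z.1) ^+ 2.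

Let i1 : Pi.-integrable setT (EFin \o (fun z : V * V => enorm (z.2 - z.1))).
Proof. by apply: eq_integrable (integrable_length m0 m1 (ltnW N2)). Qed.

Let Gnew_slot_measurable s t v i j :
  measurable_fun setT (fun z => slot (Gnew s v (interp s z))
    (interp t z - interp s z) i j).
Proof.
exact: (@measurable_slot _ _ _ P _ _ _ (fun mu' => @Df k a mu' v)
  (fun mu x => @Df k.+1 (rcons_tuple a (mseq a).+1) mu
               (castmx (esym (mseq_new a), erefl) (col_mx v x)))
  (fun mu mmu => a_lions v mmu) _ _ _ (interp s) (interp t) i j (m2 s)).
Qed.

Let Gnew_slot_integrable s t v i j :
  Pi.-integrable setT (EFin \o (fun z => slot (Gnew s v (interp s z))
    (interp t z - interp s z) i j)).
Proof.
apply: (@integrable_dominated _ _ _ _ _ _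
  (fun z : V * V => K * (`|t - s| * enorm (z.2 - z.1)))) => //.
- move=> z _; rewrite -enormZ -interpB (le_trans (enorm_slot_coord _ _ _ _))//.
  by rewrite ler_wpM2r ?enorm_ge0//; apply: bB (ltnSn _) _ _ (m2 s).
- by apply: integrable_mulr => //; exact: integrable_mulr.
Qed.

(** The points are frozen and the law moves. *)
Let move_measure s t v i j :
  `|(@Df k a (interp_law Pi t) v - @Df k a (interp_law Pi s) v -
     mxint Pi setT (fun z => slot (Gnew s v (interp s z))
       (interp t z - interp s z))) i j| <= K * (t - s) ^+ 2 * (D1 ^+ 2 + D2).
Proof.
have := @lions_expansion _ _ _ P _ _ _ (fun mu' => @Df k a mu' v)
  (fun mu x => @Df k.+1 (rcons_tuple a (mseq a).+1) mu
               (castmx (esym (mseq_new a), erefl) (col_mx v x)))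
  K rP _ (fun mu mmu => a_lions v mmu) _ K_ge0 _ _ _ Pi
  (interp s) (interp t) i j (m2 s) (m2 t).
have -> : \int[Pi]_z enorm (interp t z - interp s z) = `|t - s| * D1.
  by rewrite -RintegralZl//; apply: eq_Rintegral => z _; rewrite interpB enormZ.
have -> : \int[Pi]_z enorm (interp t z - interp s z) ^+ 2 = (t - s) ^+ 2 * D2.
  rewrite -RintegralZl//; last exact: (integrable_length m0 m1 N2).
  by apply: eq_Rintegral => z _; rewrite interpB enormZ exprMn real_normK ?num_real.
have -> : (`|t - s| * D1) ^+ 2 + (t - s) ^+ 2 * D2 = (t - s) ^+ 2 * (D1 ^+ 2 + D2).
  by rewrite exprMn real_normK ?num_real// mulrDr.
rewrite mulrA; apply.
- by move=> mu nu mmu; exact: lipschitz_eq_borel.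
- by move=> mu x mmu; exact: bB (ltnSn _) _ _ mmu.
- move=> mu nu x y mmu mnu; apply: le_trans (bL (ltnSn _) _ _ mmu mnu) _.
  rewrite sum_row_castmx sum_row_col_mx big1 ?add0r// => l _.
  by rewrite subrr enorm0.
Qed.

(** The law is frozen and the points move. *)
Let move_points s (X Y : 'M[R]_(mseq a, dim)) i j :
  `|(@Df k a (interp_law Pi s) Y - @Df k a (interp_law Pi s) X -
     \sum_l slot (Gold s l X) (row l (Y - X))) i j| <=
  K * (\sum_l enorm (row l (Y - X))) ^+ 2.
Proof.
have := @expansion_in_points R _ _ _ _ (@Df k a (interp_law Pi s)) (Gold s) K K_ge0
  (fun v => (a_diff v (m2 s)).1) (fun v l h => (a_diff v (m2 s)).2 l h) _
  X (Y - X) i j.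
rewrite [X + _]addrC subrK; apply=> l u v.
have lm : (l < (mseq a).+1)%N by rewrite ltnW// ltnS ltn_ord.
have := kernel_lip N2 m0 m1 K_ge0 (bL lm) s s
  (castmx (esym (mseq_old l), erefl) u) (castmx (esym (mseq_old l), erefl) v).
by rewrite subrr normr0 mul0r add0r sum_row_castmx.
Qed.

Let Gnew_lip s (u v : 'M[R]_(mseq a, dim)) x :
  enorm (Gnew s u x - Gnew s v x) <= K * \sum_l enorm (row l u - row l v).
Proof.
have := kernel_lip N2 m0 m1 K_ge0 (bL (ltnSn _)) s s
  (castmx (esym (mseq_new a), erefl) (col_mx u x))
  (castmx (esym (mseq_new a), erefl) (col_mx v x)).
by rewrite subrr normr0 mul0r add0r sum_row_castmx sum_row_col_mx subrr enorm0 addr0.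
Qed.

(** The linear term of the motion of the law, taken at the moved points, differs
    from the one at the initial points by a term of second order. *)
Let move_field s t (X Y : 'M[R]_(mseq a, dim)) i j :
  `|mxint Pi setT (fun z => slot (Gnew s Y (interp s z))
       (interp t z - interp s z)) i j -
    mxint Pi setT (fun z => slot (Gnew s X (interp s z))
       (interp t z - interp s z)) i j| <=
  K * (\sum_l enorm (row l Y - row l X)) * (`|t - s| * D1).
Proof.
rewrite !mxE -RintegralB//.
have iB := integrable_subr measurableT (Gnew_slot_integrable s t Y i j)
  (Gnew_slot_integrable s t X i j).
rewrite (le_trans (le_normr_Rintegral _ iB))//.
rewrite /D1 /mean_length -!RintegralZl//; last exact: integrable_mulr.
apply: le_Rintegral => //.
- by apply: integrable_norm iB.
- by apply: integrable_mulr => //; exact: integrable_mulr.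
- move=> z _; rewrite -enormZ -interpB.
  set L1 := Gnew s Y _; set L2 := Gnew s X _.
  set h := interp t z - interp s z.
  have -> : slot L1 h i j - slot L2 h i j = slot (L1 - L2) h i j.
    by rewrite slotBl [RHS]mxE [X in _ = _ + X]mxE.
  rewrite (le_trans (enorm_slot_coord _ _ _ _))// ler_wpM2r ?enorm_ge0//.
  exact: Gnew_lip.
Qed.

Let C0 := K * (1 + D1 + D1 ^+ 2 + D2).

Let D1_ge0 : 0 <= D1. Proof. exact: mean_length_ge0. Qed.

Let D2_ge0 : 0 <= D2.
Proof. by apply: Rintegral_ge0 => z _; rewrite exprn_ge0 ?enorm_ge0. Qed.

Let C0_ge0 : 0 <= C0.
Proof. by rewrite mulr_ge0// !addr_ge0// exprn_ge0. Qed.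

(** The second-order error between the integrand at times [s] and [t]: the last two
    terms are the contributions of the old values and of the new value. *)
Let err s t (w : (mseq a).-tuple (V * V)) : 'M[R]_(tdim dim k, e) :=
  @Df k a (interp_law Pi t) (points w t) - @Df k a (interp_law Pi s) (points w s)
  - \sum_l slot (Gold s l (points w s)) (row l (points w t - points w s))
  - mxint Pi setT (fun z => slot (Gnew s (points w s) (interp s z))
       (interp t z - interp s z)).

Let err_bound s t w i j :
  `|err s t w i j| <= C0 * (t - s) ^+ 2 * (1 + span w) ^+ 2.
Proof.
pose T1 := @Df k a (interp_law Pi t) (points w t) -
  @Df k a (interp_law Pi s) (points w t) -
  mxint Pi setT (fun z => slot (Gnew s (points w t) (interp s z))
       (interp t z - interp s z)).
pose T2 := @Df k a (interp_law Pi s) (points w t) -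
  @Df k a (interp_law Pi s) (points w s) -
  \sum_l slot (Gold s l (points w s)) (row l (points w t - points w s)).
pose T3 := mxint Pi setT (fun z => slot (Gnew s (points w t) (interp s z))
       (interp t z - interp s z)) i j -
    mxint Pi setT (fun z => slot (Gnew s (points w s) (interp s z))
       (interp t z - interp s z)) i j.
have -> : err s t w i j = T1 i j + T2 i j + T3.
  rewrite /err /T1 /T2 /T3; set a1 := @Df _ _ _ _; set a2 := @Df _ _ _ _.
  set a3 := @Df _ _ _ _; set b1 := mxint _ _ _; set b2 := mxint _ _ _.
  set s1 := \sum_l _; clearbody a1 a2 a3 b1 b2 s1.
  by rewrite !mxE; ring.
have S0 := span_ge0 w.
have h1 := move_measure s t (points w t) i j.
have h2 := move_points s (points w s) (points w t) i j.
have h3 := move_field s t (points w s) (points w t) i j.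
have rE : \sum_l enorm (row l (points w t - points w s)) = `|t - s| * span w.
  rewrite -sum_row_points; apply: eq_bigr => l _; congr enorm.
  by rewrite raddfB.
rewrite rE in h2; rewrite sum_row_points in h3.
rewrite (le_trans (ler_normD _ _))// (@le_trans _ _ (K * (t - s) ^+ 2 *
  (D1 ^+ 2 + D2) + K * (`|t - s| * span w) ^+ 2 +
  K * (`|t - s| * span w) * (`|t - s| * D1)))//.
  by rewrite lerD// (le_trans (ler_normD _ _))// lerD.
have -> : K * (`|t - s| * span w) * (`|t - s| * D1) =
    K * (t - s) ^+ 2 * (span w * D1).
  by rewrite -[(t - s) ^+ 2]real_normK ?num_real//; ring.
have -> : K * (`|t - s| * span w) ^+ 2 = K * (t - s) ^+ 2 * span w ^+ 2.
  by rewrite exprMn real_normK ?num_real// mulrA.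
rewrite -!mulrDr /C0 [K * _ * (t - s) ^+ 2]mulrAC -[leRHS]mulrA.
have Kts : 0 <= K * (t - s) ^+ 2 by apply: mulr_ge0 => //; exact: sqr_ge0.
rewrite ler_wpM2l//.
set S := span w in S0 *; have S2 : 0 <= S ^+ 2 by exact: sqr_ge0.
rewrite -subr_ge0 (_ : _ - _ = 1 + 2 * S + D1 * (1 + S + S ^+ 2) +
  (D1 ^+ 2 + D2) * (2 * S + S ^+ 2)); last by ring.
by rewrite !(addr_ge0, mulr_ge0, sqr_ge0).
Qed.

Let flow_new_integrable s (w : (mseq a).-tuple (V * V)) c :
  Pi.-integrable setT
    (EFin \o (fun z => flow_fun Df Pi (mseq_newS a) s (trcons (w, z)) 0 c)).
Proof.
have -> : (fun z => flow_fun Df Pi (mseq_newS a) s (trcons (w, z)) 0 c) =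
    (fun z => \sum_l incr k a w 0 l * slot (Gnew s (points w s) (interp s z))
       (interp (s + 1) z - interp s z) l c).
  apply/funext => z; rewrite flow_fun_new// mxE; apply: eq_bigr => l _.
  by rewrite interpB addrAC subrr add0r scale1r.
by apply: integrable_sumr => // l; apply: integrable_mulr.
Qed.

(** The linear terms of [err] are, up to the factor [t - s], the integrands of the
    sequences that extend [a] by one entry. *)
Let err_flow s t (w : (mseq a).-tuple (V * V)) c :
  (incr k a w *m err s t w) 0 c =
  flow_fun Df Pi (erefl (mseq a)) t w 0 c - flow_fun Df Pi (erefl (mseq a)) s w 0 c
  - (t - s) * (\sum_(j < mseq a) flow_fun Df Pi (mseq_old j) s w 0 c +
     \int[Pi]_z flow_fun Df Pi (mseq_newS a) s (trcons (w, z)) 0 c).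
Proof.
have -> : incr k a w *m err s t w =
  flow_fun Df Pi (erefl (mseq a)) t w - flow_fun Df Pi (erefl (mseq a)) s w
  - (t - s) *: (\sum_(j < mseq a) flow_fun Df Pi (mseq_old j) s w)
  - incr k a w *m mxint Pi setT (fun z => slot (Gnew s (points w s) (interp s z))
       (interp t z - interp s z)).
  rewrite /err !mulmxBr {1 2}/flow_fun !castmx_id; congr (_ - _ - _).
  rewrite mulmx_sumr scaler_sumr; apply: eq_bigr => l _.
  by rewrite flow_fun_old raddfB row_points slotZ scalemxAr.
have entryE (A1 A2 A3 A4 : 'rV[R]_e) :
    (A1 - A2 - (t - s) *: A3 - A4) 0 c =
    A1 0 c - A2 0 c - (t - s) * A3 0 c - A4 0 c by rewrite !mxE.
rewrite entryE summxE mulrDr [in RHS]opprD addrA; congr (_ - _).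
rewrite -RintegralZl// mxE.
under eq_bigr do rewrite [mxint _ _ _ _ _]mxE -RintegralZl//.
rewrite -Rintegral_sum//; last by move=> l; exact: integrable_mulr.
apply: eq_Rintegral => z _; rewrite flow_fun_new// mxE mulr_sumr.
by apply: eq_bigr => l _; rewrite interpB slotZ [X in _ * X]mxE mulrCA.
Qed.

(** Differentiating in time moves the law and the points at once. The motion of the
    point [j] contributes the sequence [a] extended by [j], the motion of the law
    the sequence extended by [mseq a + 1]. The quadratic estimate, of size
    [(1 + span w) ^+ 2], integrates against the [k] displacements in [incr]. *)
Lemma flow_int_expansion c : exists C, forall s t,
  `|flow_int Df Pi a t 0 c - flow_int Df Pi a s 0 c -
    (t - s) * \sum_(j < (mseq a).+1) flow_int Df Pi (rcons_tuple a j.+1) s 0 c|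
  <= C * (t - s) ^+ 2.
Proof.
pose C1 := (tdim dim k * e)%:R * C0.
pose M := \int[power_prob Pi (mseq a)]_w (1 + span w) ^+ k.+2.
exists (C1 * M) => s t.
have kN' : (k <= N)%N by rewrite (leq_trans _ kN)// ltnW.
have kN1 : (k.+1 <= N)%N by exact: ltnW.
have fE u : flow_int Df Pi a u 0 c = \int[power_prob Pi (mseq a)]_w
    flow_fun Df Pi (erefl (mseq a)) u w 0 c by exact: flow_int_cast.
have fi u := integrable_flow aB aL u c kN'.
have lj (j : 'I_(mseq a)) : (j < (mseq a).+1)%N by rewrite ltnW// ltnS.
have oldi (j : 'I_(mseq a)) := integrable_flow_cast (mseq_old j)
  (integrable_flow (bB (lj j)) (bL (lj j)) s c kN1).
have newi := integrable_flow_cast (mseq_newS a)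
  (integrable_flow (bB (ltnSn _)) (bL (ltnSn _)) s c kN1).
have [newi2 newE] := Rintegral_power_rcons newi (fun w => flow_new_integrable s w c).
have sumi := integrable_sumr (index_enum 'I_(mseq a)) measurableT oldi.
have -> : \sum_(j < (mseq a).+1) flow_int Df Pi (rcons_tuple a j.+1) s 0 c =
    \int[power_prob Pi (mseq a)]_w (\sum_(j < mseq a)
       flow_fun Df Pi (mseq_old j) s w 0 c +
     \int[Pi]_z flow_fun Df Pi (mseq_newS a) s (trcons (w, z)) 0 c).
  rewrite RintegralD// Rintegral_sum// big_ord_recr/=.
  rewrite (flow_int_cast _ _ (mseq_newS a)) newE; congr (_ + _).
  by apply: eq_bigr => j _; rewrite (flow_int_cast _ _ (mseq_old j)).
have ai := integrable_addr measurableT sumi newi2.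
rewrite !fE -RintegralB// -RintegralZl// -RintegralB//; last 2 first.
- exact: integrable_subr.
- exact: integrable_mulr.
have ei := integrable_subr measurableT (integrable_subr measurableT (fi t) (fi s))
  (integrable_mulr (t - s) measurableT ai).
rewrite (le_trans (le_normr_Rintegral _ ei))//.
have si := integrable_span N2 m0 m1 (mseq a) kN.
rewrite [leRHS]mulrAC -RintegralZl//.
apply: le_Rintegral => //.
- exact: integrable_norm ei.
- exact: integrable_mulr.
move=> w _; rewrite -err_flow (le_trans (ler_norm_enorm _ _ _))//.
rewrite (le_trans (enorm_mulmx _ _))//.
have S0 := span_ge0 w.
apply: (@le_trans _ _ ((1 + span w) ^+ k *
  ((tdim dim k * e)%:R * (C0 * (t - s) ^+ 2 * (1 + span w) ^+ 2)))).
  apply: ler_pM; rewrite ?enorm_ge0 ?enorm_incr//.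
  by apply: enorm_le_coord => i j; exact: err_bound.
by rewrite /C1 -[k.+2]addn2 exprD le_eqVlt; apply/orP; left; apply/eqP; ring.
Qed.

End one_step.
End flow_derivative.

(** * Taylor's formula in time *)

Section taylor.
Context {R : realType}.

Lemma is_derive_subX n (x : R) :
  is_derive x (1 : R) (fun t : R => (1 - t) ^+ n.+1)
    (- (n.+1%:R * (1 - x) ^+ n)).
Proof.
have d1 : is_derive x (1 : R) (fun t : R => 1 - t) (-1).
  have := is_deriveB (is_derive_cst (1 : R) x (1 : R)) (is_derive_id x (1 : R)).
  by rewrite sub0r.
have := is_deriveX n.+1 d1; rewrite exprfctE => d2.
by apply: (is_derive_eq d2); rewrite /GRing.scale/= mulrN1.
Qed.

(** The sum telescopes: the term [k] of the derivative of one factor cancels the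
    term [k + 1] of the derivative of the other. *)
Lemma is_derive_taylor_sum (F : nat -> R -> R) n (x : R) :
  (forall k (t : R), (k <= n)%N -> is_derive t (1 : R) (F k) (F k.+1 t)) ->
  is_derive x (1 : R) (fun t : R => \sum_(k < n.+1) (k`!%:R)^-1 * (F k t * (1 - t) ^+ k))
    ((n`!%:R)^-1 * (F n.+1 x * (1 - x) ^+ n)).
Proof.
elim: n => [|n IH] dF.
  under eq_fun do rewrite big_ord1 fact0 invr1 mul1r expr0 mulr1.
  by rewrite fact0 invr1 mul1r expr0 mulr1; exact: dF.
under eq_fun do rewrite big_ord_recr/=.
have d1 := IH (fun k t kn => dF k t (leqW kn)).
have d2 := dF n.+1 x (leqnn _).
have d4 := is_derive_subX n x.
have d5 := is_deriveM d2 d4.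
have d6 := is_deriveZ ((n.+1`!%:R)^-1 : R) d5.
apply: (is_derive_eq (is_deriveD d1 d6)).
rewrite /GRing.scale/= factS natrM.
have n1 : (n.+1%:R : R) != 0 by rewrite pnatr_eq0.
have n2 : (n`!%:R : R) != 0 by rewrite pnatr_eq0 -lt0n fact_gt0.
move: (n.+1%:R : R) (n`!%:R : R) n1 n2 => N1 N2 n1 n2; field.
by rewrite n1 n2.
Qed.

(** The term of order [n + 1] at [0] is also the integral of the constant
    [F n.+1 0], hence the difference under the integral. It is the fundamental
    theorem of calculus for [H]. *)
Lemma taylor_integral (F : nat -> R -> R) n :
  (forall k (t : R), (k <= n)%N -> is_derive t (1 : R) (F k) (F k.+1 t)) ->
  continuous (F n.+1) ->
  F 0%N 1 - F 0%N 0 = \sum_(1 <= k < n.+2) (k`!%:R)^-1 * F k 0 +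
    (n`!%:R)^-1 *
    \int[lebesgue_measure]_(x in `[0, 1]) ((1 - x) ^+ n * (F n.+1 x - F n.+1 0)).
Proof.
move=> dF cF.
pose h0 x := (1 - x) ^+ n * (F n.+1 x - F n.+1 0).
pose h x := (n`!%:R)^-1 * h0 x.
pose H t := \sum_(k < n.+1) (k`!%:R)^-1 * (F k t * (1 - t) ^+ k) +
  (n.+1`!%:R)^-1 * (F n.+1 0 * (1 - t) ^+ n.+1).
have dH (x : R) : is_derive x (1 : R) H (h x).
  have d1 := is_derive_taylor_sum x dF.
  have d4 := is_deriveZ ((n.+1`!%:R)^-1 * F n.+1 0 : R) (is_derive_subX n x).
  rewrite (_ : H = (fun t : R => \sum_(k < n.+1) (k`!%:R)^-1 * (F k t * (1 - t) ^+ k))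
    \+ (((n.+1`!%:R)^-1 * F n.+1 0 : R) \*: (fun t : R => (1 - t) ^+ n.+1))); last first.
    by apply/funext => t; rewrite /H /= /GRing.scale/= mulrA.
  apply: (is_derive_eq (is_deriveD d1 d4)).
  rewrite /GRing.scale/= /h /h0 factS natrM.
  have n1 : (n.+1%:R : R) != 0 by rewrite pnatr_eq0.
  have n2 : (n`!%:R : R) != 0 by rewrite pnatr_eq0 -lt0n fact_gt0.
  move: (n.+1%:R : R) (n`!%:R : R) n1 n2 => N1 N2 n1 n2; field.
  by rewrite n1 n2.
have cH : continuous H.
  by move=> x; apply/differentiable_continuous/derivable1_diffP; have [] := dH x.
have ch0 : continuous h0.
  move=> x; apply: cvgM; last by apply: cvgB; [exact: cF|exact: cvg_cst].
  apply: (cvg_comp _ (fun y : R => y ^+ n)); last exact: exprn_continuous.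
  by apply: cvgB; [exact: cvg_cst|exact: cvg_id].
have ch : continuous h by move=> x; apply: cvgMl_tmp; exact: ch0.
have ftc : (\int[lebesgue_measure]_(x in `[0%R, 1%R]) (h x)%:E = (H 1)%:E - (H 0)%:E)%E.
  apply: continuous_FTC2.
  - exact: ltr01.
  - exact: continuous_subspaceT.
  - split.
    + by move=> x _; have [] := dH x.
    + by apply: cvg_at_right_filter; exact: cH.
    + by apply: cvg_at_left_filter; exact: cH.
  - by move=> x _; rewrite derive1E; have := dH x => -[].
have ih : (@lebesgue_measure R).-integrable `[0, 1] (EFin \o h0).
  apply: continuous_compact_integrable; first exact: segment_compact.
  exact: continuous_subspaceT.
rewrite -RintegralZl// -/(h _) /Rintegral ftc /= /H !subrr !subr0.
rewrite [in RHS]big_add1/= big_mkord big_ord_recr/=.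
rewrite expr0n/= !mulr0 addr0 expr1n mulr1.
have -> : \sum_(k < n.+1) (k`!%:R)^-1 * (F k 1 * 0 ^+ k) = F 0%N 1.
  rewrite big_ord_recl/= fact0 invr1 mul1r expr0 mulr1 big1 ?addr0// => i _.
  by rewrite /bump expr0n !mulr0.
have -> : \sum_(k < n.+1) (k`!%:R)^-1 * (F k 0 * 1 ^+ k) =
    F 0%N 0 + \sum_(i < n) (i.+1`!%:R)^-1 * F i.+1 0.
  rewrite big_ord_recl/= fact0 invr1 mul1r expr0 mulr1; congr (_ + _).
  by apply: eq_bigr => i _; rewrite expr1n mulr1.
by ring.
Qed.

End taylor.

Section flow_steps.
Context d (Omega : measurableType d) (R : realType) (P : probability Omega R).
Context {dim e : nat} (Df : derivatives R dim e) (K : R).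
Local Notation V := 'rV[R]_dim.
Context (Pi : probability (V * V)%type R) (N : nat).
Hypothesis rP : rich P.
Hypothesis N2 : (2 <= N)%N.
Hypothesis m0 : finite_moment N (interp_law Pi 0).
Hypothesis m1 : finite_moment N (interp_law Pi 1).
Hypothesis K_ge0 : 0 <= K.

Let m2 := finite_moment2_interp N2 m0 m1.
Let i1 : Pi.-integrable setT (EFin \o (fun z : V * V => enorm (z.2 - z.1))).
Proof. by apply: eq_integrable (integrable_length m0 m1 (ltnW N2)). Qed.

Let G1 s (x : V) : 'M[R]_(1 * dim, e) :=
  @Df 1%N [tuple 1%N] (interp_law Pi s) (castmx (esym mseq1, erefl) x).

Let G1_integrable s c : bounded_by Df K [tuple 1%N] ->
  lipschitz_by Df K [tuple 1%N] ->
  Pi.-integrable setT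
    (EFin \o (fun z : V * V => slot (G1 s (interp s z)) (z.2 - z.1) 0 c)).
Proof.
move=> aB aL; apply: (@integrable_dominated _ _ _ _ _ _
  (fun z : V * V => K * enorm (z.2 - z.1))) => //.
- under eq_fun do rewrite slotE; apply: measurable_sum => l.
  apply: measurable_funM; first exact: measurable_increment.
  apply: (measurable_kernel N2 m0 m1 K_ge0 aL) => i j.
  under eq_fun do rewrite castmxE/=.
  exact: (measurableT_comp (measurable_coord _ _) (@measurable_interp R dim s)).
- move=> z _; rewrite (le_trans (enorm_slot_coord _ _ _ _))//.
  by rewrite ler_wpM2r ?enorm_ge0//; exact: aB (m2 s).
- exact: integrable_mulr.
Qed.

Let flow_int1 s c : bounded_by Df K [tuple 1%N] ->
  lipschitz_by Df K [tuple 1%N] ->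
  flow_int Df Pi [tuple 1%N] s 0 c =
  \int[Pi]_z slot (G1 s (interp s z)) (z.2 - z.1) 0 c.
Proof.
move=> aB aL; rewrite (flow_int_cast _ _ mseq1).
have fi := integrable_flow_cast mseq1
  (integrable_flow N2 m0 m1 K_ge0 aB aL s c (ltnW N2)).
have fE (w : 0.-tuple (V * V)) z :
    flow_fun Df Pi mseq1 s (trcons (w, z)) = slot (G1 s (interp s z)) (z.2 - z.1).
  rewrite /flow_fun; have -> : points (trcons (w, z)) s = interp s z.
    by apply/matrixP => i j; rewrite mxE (tnth_nth (0, 0)) (tuple0 w) !ord1.
  by rewrite /incr /= (tuple0 w) /= -mul_slot mul1mx.
have [|_ ->] := Rintegral_power_rcons fi.
  move=> w; under [X in EFin \o X]eq_fun do rewrite fE; exact: G1_integrable.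
under eq_Rintegral do under eq_Rintegral do rewrite fE.
rewrite Rintegral_cst// -[RHS]mulr1; congr (_ * _).
exact: (congr1 fine (@probability_setT _ _ _ (power_prob Pi 0))).
Qed.

(** The first derivative in time of the function itself involves a single
    additional point, which is the only entry of the sequence [(1)]. *)
Lemma zeroth_expansion (f : probability V R -> 'rV[R]_e) c :
  (forall mu nu, finite_moment 2 mu -> eq_borel mu nu -> f mu = f nu) ->
  (forall mu, finite_moment 2 mu -> is_lions_derivative P f mu
     (fun x => @Df 1%N [tuple 1%N] mu (castmx (esym mseq1, erefl) x))) ->
  bounded_by Df K [tuple 1%N] -> lipschitz_by Df K [tuple 1%N] ->
  exists C, forall s t,
  `|f (interp_law Pi t) 0 c - f (interp_law Pi s) 0 c -
    (t - s) * flow_int Df Pi [tuple 1%N] s 0 c| <= C * (t - s) ^+ 2.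
Proof.
move=> f_borel f_lions aB aL.
pose D1 := mean_length Pi; pose D2 := \int[Pi]_z enorm (z.2 - z.1) ^+ 2.
exists (K * (D1 ^+ 2 + D2)) => s t.
have g_lip mu nu (x y : V) : finite_moment 2 mu -> finite_moment 2 nu ->
  ((enorm (@Df 1%N [tuple 1%N] mu (castmx (esym mseq1, erefl) x) -
           @Df 1%N [tuple 1%N] nu (castmx (esym mseq1, erefl) y)))%:E <=
   K%:E * (wasserstein 1 mu nu + (enorm (x - y))%:E))%E.
  move=> mmu mnu; apply: le_trans (aL _ _ _ _ mmu mnu) _.
  by rewrite sum_row_castmx big_ord1 !row_id.
have := @lions_expansion _ _ _ P dim 1 e f
  (fun mu x => @Df 1%N [tuple 1%N] mu (castmx (esym mseq1, erefl) x)) K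
  rP f_borel f_lions (fun mu x mmu => aB mu _ mmu) K_ge0 g_lip _ _ Pi
  (interp s) (interp t) 0 c (m2 s) (m2 t).
have -> : \int[Pi]_z enorm (interp t z - interp s z) = `|t - s| * D1.
  by rewrite -RintegralZl//; apply: eq_Rintegral => z _; rewrite interpB enormZ.
have -> : \int[Pi]_z enorm (interp t z - interp s z) ^+ 2 = (t - s) ^+ 2 * D2.
  rewrite -RintegralZl//; last exact: (integrable_length m0 m1 N2).
  by apply: eq_Rintegral => z _; rewrite interpB enormZ exprMn real_normK ?num_real.
have -> : K * ((`|t - s| * D1) ^+ 2 + (t - s) ^+ 2 * D2) =
    K * (D1 ^+ 2 + D2) * (t - s) ^+ 2.
  by rewrite exprMn real_normK ?num_real//; ring.
rewrite flow_int1//; congr (`|_| <= _).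
have entryE (A1 A2 A3 : 'rV[R]_e) :
  (A1 - A2 - A3) 0 c = A1 0 c - A2 0 c - A3 0 c by rewrite !mxE.
rewrite entryE; congr (_ - _ - _); rewrite mxE -RintegralZl//; last exact: G1_integrable.
by apply: eq_Rintegral => z _; rewrite interpB slotZ mxE.
Qed.

Lemma flow_int_lip k (a : k.-tuple nat) c : (k < N)%N ->
  bounded_by Df K a -> lipschitz_by Df K a ->
  exists C, forall s t,
  `|flow_int Df Pi a t 0 c - flow_int Df Pi a s 0 c| <= C * `|t - s|.
Proof.
move=> kN aB aL; pose D1 := mean_length Pi.
pose M := \int[power_prob Pi (mseq a)]_w (1 + span w) ^+ k.+1.
exists (K * (1 + D1) * M) => s t.
have fi u := integrable_flow N2 m0 m1 K_ge0 aB aL u c (ltnW kN).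
rewrite !(flow_int_cast _ _ (erefl (mseq a))) -RintegralB//.
have ei := integrable_subr measurableT (fi t) (fi s).
have si := integrable_span N2 m0 m1 (mseq a) kN.
rewrite (le_trans (le_normr_Rintegral _ ei))// [leRHS]mulrAC -RintegralZl//.
apply: le_Rintegral => //; [exact: integrable_norm ei|exact: integrable_mulr|].
move=> w _.
have -> : flow_fun Df Pi (erefl (mseq a)) t w 0 c -
    flow_fun Df Pi (erefl (mseq a)) s w 0 c =
  (incr k a w *m (@Df k a (interp_law Pi t) (points w t) -
    @Df k a (interp_law Pi s) (points w s))) 0 c.
  rewrite mulmxBr /flow_fun !castmx_id; set A1 := _ *m _; set A2 := _ *m _.
  by clearbody A1 A2; rewrite !mxE.
rewrite (le_trans (ler_norm_enorm _ _ _))// (le_trans (enorm_mulmx _ _))//.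
have S0 := span_ge0 w; have D0 : 0 <= D1 by exact: mean_length_ge0.
apply: (@le_trans _ _ ((1 + span w) ^+ k *
    (K * (`|t - s| * D1 + `|t - s| * span w)))).
  apply: ler_pM; rewrite ?enorm_ge0 ?enorm_incr//.
  exact: (kernel_lip_points N2 m0 m1 K_ge0 aL).
rewrite -mulrDr exprSr -subr_ge0 (_ : _ - _ =
  (1 + span w) ^+ k * (K * (`|t - s| * (1 + D1 * span w)))); last by ring.
by rewrite !mulr_ge0 ?exprn_ge0 ?addr_ge0 ?mulr_ge0.
Qed.

End flow_steps.

(** * The remainder as an integral over time *)

Section product_integrability.
Context d1 d2 (T1 : measurableType d1) (T2 : measurableType d2) (R : realType).
Context (mu1 : {sigma_finite_measure set T1 -> \bar R}).
Context (mu2 : {sigma_finite_measure set T2 -> \bar R}).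

(** Tonelli's theorem for a bound by a product of functions of one variable each. *)
Lemma integrable_product (u : T1 -> R) (v : T2 -> R) (h : T1 * T2 -> R) :
  mu1.-integrable setT (EFin \o u) -> mu2.-integrable setT (EFin \o v) ->
  measurable_fun setT h -> (forall x, `|h x| <= `|u x.1| * `|v x.2|) ->
  (mu1 \x mu2)%E.-integrable setT (EFin \o h).
Proof.
move=> /integrableP[mu_u iu] /integrableP[mv iv] mh huv.
have mu' : measurable_fun setT u by exact/measurable_EFinP.
have mv' : measurable_fun setT v by exact/measurable_EFinP.
apply/integrableP; split; first exact/measurable_EFinP.
pose b x := (`|u x.1| * `|v x.2|)%:E.
have mb : measurable_fun setT b.
  apply/measurable_EFinP; apply: measurable_funM.
    by apply: measurableT_comp => //; exact: (measurableT_comp mu' measurable_fst).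
  by apply: measurableT_comp => //; exact: (measurableT_comp mv' measurable_snd).
apply: (@le_lt_trans _ _ (\int[(mu1 \x mu2)%E]_x b x)%E).
  apply: ge0_le_integral => //.
  - by apply: measurableT_comp => //; exact/measurable_EFinP.
  - by move=> x _ /=; rewrite lee_fin.
rewrite fubini_tonelli1//; last by move=> x; rewrite lee_fin mulr_ge0.
rewrite (eq_integral (fun x => `|(u x)%:E| * \int[mu2]_y `|(v y)%:E|)%E); last first.
  move=> x _; rewrite /fubini_F /b /=; under eq_integral do rewrite EFinM.
  by rewrite ge0_integralZl//; do 2 apply: measurableT_comp => //.
rewrite ge0_integralZr//.
- by rewrite lte_mul_pinfty// ?integral_ge0// ge0_fin_numE ?integral_ge0.
- by do 2 apply: measurableT_comp => //.
- exact: integral_ge0.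
Qed.

End product_integrability.

Section remainder_integrals.
Context {R : realType} {dim e : nat} (Df : derivatives R dim e) (K : R).
Local Notation V := 'rV[R]_dim.
Context (Pi : probability (V * V)%type R) (N : nat).
Hypothesis N2 : (2 <= N)%N.
Hypothesis m0 : finite_moment N (interp_law Pi 0).
Hypothesis m1 : finite_moment N (interp_law Pi 1).
Hypothesis K_ge0 : 0 <= K.
Context k (a : k.-tuple nat).
Hypothesis kN : (k < N)%N.
Hypothesis aB : bounded_by Df K a.
Hypothesis aL : lipschitz_by Df K a.
Local Notation m := (mseq a).
Local Notation D1 := (mean_length Pi).
Local Notation leb := (@lebesgue_measure R).

Let m2 := finite_moment2_interp N2 m0 m1.

Definition kernel (x : R) (w : m.-tuple (V * V)) : 'M[R]_(tdim dim k, e) :=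
  @Df k a (interp_law Pi x) (points w x).

(** The pair [(x, A)] is encoded as the block matrix of [x] and [A], on which a
    Lipschitz function is continuous, hence Borel measurable. *)
Lemma measurable_kernel_joint i j :
  measurable_fun [set: measurableTypeR R * m.-tuple (V * V)]
    (fun p => kernel p.1 p.2 i j).
Proof.
pose h (B : 'M[R]_(1 + m, 1 + dim)) :=
  @Df k a (interp_law Pi (ulsubmx B 0 0)) (drsubmx B) i j.
have ch : continuous h.
  apply: (@continuous_coords _ _ _ _ (K * (1 + D1))) => A B.
  apply: (@le_trans _ _ (enorm (@Df k a (interp_law Pi (ulsubmx A 0 0)) (drsubmx A) -
      @Df k a (interp_law Pi (ulsubmx B 0 0)) (drsubmx B)))).
    have := ler_norm_enorm (@Df k a (interp_law Pi (ulsubmx A 0 0)) (drsubmx A) -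
      @Df k a (interp_law Pi (ulsubmx B 0 0)) (drsubmx B)) i j.
    rewrite /h; set A1 := @Df _ _ _ _; set A2 := @Df _ _ _ _.
    by clearbody A1 A2; rewrite !mxE.
  rewrite (le_trans (kernel_lip N2 m0 m1 K_ge0 aL _ _ _ _))// -mulrA ler_wpM2l//.
  set s1 := \sum_(i < m) _.
  have s1_le : s1 <= \sum_(i < m) \sum_(j < dim) `|A (rshift 1 i) (rshift 1 j) -
      B (rshift 1 i) (rshift 1 j)|.
    apply: ler_sum => i' _; rewrite (le_trans (ler_enorm_l1 _))// big_ord1.
    by apply: ler_sum => j' _; rewrite !mxE.
  have s1_ge : 0 <= s1 by apply: sumr_ge0 => i' _; exact: enorm_ge0.
  set s2 := \sum_i \sum_j _.
  have s2_ge : `|ulsubmx A 0 0 - ulsubmx B 0 0| + s1 <= s2.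
    rewrite /s2 big_split_ord/= big_ord1 big_split_ord/= big_ord1 !mxE.
    rewrite -addrA lerD2l; apply: (le_trans s1_le).
    apply: (@le_trans _ _ (\sum_(i < m) \sum_(j < 1 + dim) `|A (rshift 1 i) j -
      B (rshift 1 i) j|)); last by rewrite lerDr; exact: sumr_ge0.
    apply: ler_sum => i' _; rewrite [leRHS]big_split_ord/= lerDr.
    exact: sumr_ge0.
  have D0 := mean_length_ge0 Pi.
  apply: (@le_trans _ _ ((1 + D1) * (`|ulsubmx A 0 0 - ulsubmx B 0 0| + s1))).
    have := normr_ge0 (ulsubmx A 0 0 - ulsubmx B 0 0).
    set r := `|_| => r0; rewrite -subr_ge0 (_ : _ - _ = r + D1 * s1); last by ring.
    by rewrite addr_ge0// mulr_ge0.
  by rewrite ler_wpM2l// addr_ge0.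
have -> : (fun p : measurableTypeR R * m.-tuple (V * V) => kernel p.1 p.2 i j) =
  h \o (fun p => block_mx (p.1)%:M 0 0 (points p.2 p.1)).
  by apply/funext => p; rewrite /= /h block_mxKul block_mxKdr mxE eqxx mulr1n.
apply: measurable_continuous_mx ch _ => i' j'.
have mfst : measurable_fun [set: measurableTypeR R * m.-tuple (V * V)]
    (fun p => p.1 : R).
  move=> mD B mB; exact: (@measurable_fst _ _ (measurableTypeR R) _ mD B mB).
case: (split_ordP i') => i'' ->; case: (split_ordP j') => j'' ->.
- rewrite (_ : (fun _ => _) =
    (fun p : measurableTypeR R * m.-tuple (V * V) =>
      if i'' == j'' then (p.1 : R) else 0)).
    by case: (i'' == j'').
  by apply/funext => p; rewrite block_mxEul mxE; case: (i'' == j'').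
- rewrite (_ : (fun _ => _) = cst 0)//.
  by apply/funext => p; rewrite block_mxEur mxE.
- rewrite (_ : (fun _ => _) = cst 0)//.
  by apply/funext => p; rewrite block_mxEdl mxE.
have mt1 : measurable_fun [set: measurableTypeR R * m.-tuple (V * V)]
    (fun p => (tnth p.2 i'').1 0 j'').
  apply: (measurableT_comp (measurable_coord _ _)).
  apply: (measurableT_comp measurable_fst).
  exact: (measurableT_comp (measurable_tnth _) measurable_snd).
have mt2 : measurable_fun [set: measurableTypeR R * m.-tuple (V * V)]
    (fun p => (tnth p.2 i'').2 0 j'').
  apply: (measurableT_comp (measurable_coord _ _)).
  apply: (measurableT_comp measurable_snd).
  exact: (measurableT_comp (measurable_tnth _) measurable_snd).
rewrite (_ : (fun _ => _) = (fun p : measurableTypeR R * m.-tuple (V * V) =>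
    (tnth p.2 i'').1 0 j'' + (p.1 : R) *
    ((tnth p.2 i'').2 0 j'' - (tnth p.2 i'').1 0 j''))).
  by apply: measurable_funD => //; apply: measurable_funM => //; exact: measurable_funB.
by apply/funext => p; rewrite block_mxEdr mxE /interp !mxE.
Qed.

Lemma kernel_bound x w : enorm (kernel x w) <= K.
Proof. exact: aB (m2 x). Qed.

Let ind (x : measurableTypeR R) : R := \1_(`[0, 1]%classic : set R) x.
Let wgt (x : measurableTypeR R) : R := ind x * (1 - x) ^+ k.-1.
Let dker (x : R) w := kernel x w - kernel 0 w.

Let dkerE x w i j : dker x w i j = kernel x w i j - kernel 0 w i j.
Proof.
rewrite /dker; set A1 := kernel _ _; set A2 := kernel _ _.
by clearbody A1 A2; rewrite !mxE.
Qed.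

Let ind_ge0 x : 0 <= ind x. Proof. by rewrite /ind indicE. Qed.

Let mwgt : measurable_fun setT wgt.
Proof.
apply: measurable_funM.
  by apply: measurable_indic; exact: measurable_itv.
by apply: measurable_funX; apply: measurable_funB.
Qed.

Let wgt_le x : `|wgt x| <= ind x.
Proof.
rewrite /wgt normrM ger0_norm// /ind indicE.
case: (boolP (x \in _)) => [|_]; last by rewrite mul0r.
rewrite inE/= in_itv/= mul1r => /andP[x0 x1].
rewrite ger0_norm ?exprn_ge0 ?subr_ge0// exprn_ile1 ?subr_ge0//.
by rewrite lerBlDr lerDl.
Qed.

Let iind : leb.-integrable setT (EFin \o ind).
Proof.
apply/integrableP; split.
  by apply/measurable_EFinP; apply: measurable_indic; exact: measurable_itv.
under eq_integral do rewrite /= ger0_norm//.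
rewrite integral_indic//= ?setIT.
by rewrite lebesgue_measure_itv/= lte_fin ltr01 -EFinB ltry.
Qed.

Let dker_bound x w : enorm (dker x w) <= 2 * K.
Proof.
by rewrite (le_trans (ler_enormB _ _))// mulr_natl mulr2n lerD// kernel_bound.
Qed.

Let dker_lip x w : 0 <= x <= 1 -> enorm (dker x w) <= K * (D1 + span w).
Proof.
move=> /andP[x0 x1]; have S0 := span_ge0 w; have D0 := mean_length_ge0 Pi.
rewrite (le_trans (kernel_lip_points N2 m0 m1 K_ge0 aL w 0 x x 0))//.
by rewrite subr0 ger0_norm// ler_wpM2l// lerD// ler_piMl.
Qed.

Let mdker i j : measurable_fun [set: measurableTypeR R * m.-tuple (V * V)]
  (fun p => dker p.1 p.2 i j).
Proof.
under eq_fun do rewrite dkerE; apply: measurable_funB.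
  exact: measurable_kernel_joint.
have mk0 : measurable_fun setT (fun w : m.-tuple (V * V) => kernel 0 w i j).
  exact: (measurable_fun_pair2 (0 : measurableTypeR R) (measurable_kernel_joint i j)).
exact: (measurableT_comp mk0 measurable_snd).
Qed.

Let mwgt1 : measurable_fun [set: measurableTypeR R * m.-tuple (V * V)]
  (fun p => wgt p.1).
Proof. exact: (measurableT_comp mwgt measurable_fst). Qed.

Let wgt_section_integrable w i j :
  leb.-integrable setT (EFin \o (fun x => wgt x * dker x w i j)).
Proof.
apply: (@integrable_dominated _ _ _ _ _ _ (fun x => 2 * K * ind x)) => //.
- apply: measurable_funM => //.
  exact: (measurable_fun_pair1 w (mdker i j)).
- move=> x _; rewrite normrM mulrC ler_pM//.
  by rewrite (le_trans (ler_norm_enorm _ _ _)).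
- exact: integrable_mulr.
Qed.

Section with_start.
Context (mu : probability V R).
Hypothesis mmu : finite_moment 2 mu.
Hypothesis mu0 : eq_borel mu (interp_law Pi 0).
Local Notation fint_a w := (@fint R dim e Df k a mu Pi w).

(** The measure [mu] and the law of the starting points are equal on Borel sets
    only, and a Lipschitz derivative does not distinguish them. *)
Lemma kernel_start w : @Df k a mu (starts w) = kernel 0 w.
Proof.
rewrite /kernel (lipschitz_eq_borel K_ge0 _ aL mmu mu0); congr (@Df _ _ _ _).
by apply/matrixP => i j; rewrite !mxE mul0r addr0.
Qed.

Let fintE w i j : fint_a w i j = \int[leb]_x (wgt x * dker x w i j).
Proof.
rewrite mxE Rintegral_mkcond; apply: eq_Rintegral => x _.
rewrite patchE /wgt /ind indicE kernel_start -/(kernel x w) -/(dker x w).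
by case: ifPn => _; [rewrite mxE mul1r|rewrite !mul0r].
Qed.

Lemma measurable_fint i j : measurable_fun setT (fun w => fint_a w i j).
Proof.
have ip : (leb \x power_prob Pi m)%E.-integrable setT
    (EFin \o (fun p => wgt p.1 * dker p.1 p.2 i j)).
  apply: (@integrable_product _ _ _ _ _ _ _ ind (cst (2 * K))) => //.
  - exact: finite_measure_integrable_cst.
  - exact: measurable_funM.
  - move=> p; rewrite normrM ler_pM ?(ger0_norm (ind_ge0 _))//.
    by rewrite (le_trans (ler_norm_enorm _ _ _))// (le_trans (dker_bound _ _))// ler_norm.
have := measurable_fubini_G ip; rewrite /fubini_G => mG.
apply/measurable_EFinP; apply: eq_measurable_fun mG => w _ /=.
by rewrite fintE EFin_Rintegral.
Qed.

(** The displacement up to time [x <= 1] of the law and of the points is at most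
    their total displacement. Against the bound by a constant this gains one power
    of the displacement. *)
Lemma fint_bound w : enorm (fint_a w) <= K * (D1 + span w).
Proof.
have S0 := span_ge0 w; have D0 := mean_length_ge0 Pi.
pose I : set (measurableTypeR R) := `[0, 1]%classic.
have m01 : measurable I by exact: measurable_itv.
pose F (x : measurableTypeR R) : 'M[R]_(tdim dim k, e) :=
  (1 - x) ^+ k.-1 *: (@Df k a (interp_law Pi x) (points w x) - @Df k a mu (starts w)).
have FE x : F x = (1 - x) ^+ k.-1 *: dker x w by rewrite /F kernel_start.
have mF i j : measurable_fun I (fun x => F x i j).
  apply: measurable_funTS; under eq_fun do rewrite FE mxE.
  apply: measurable_funM; last exact: (measurable_fun_pair1 w (mdker i j)).
  by apply: measurable_funX; apply: measurable_funB.
have Fle x : x \in `[0, 1] -> enorm (F x) <= K * (D1 + span w).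
  rewrite in_itv/= => /andP[x0 x1]; rewrite FE enormZ.
  have x01 : 0 <= x <= 1 by rewrite x0 x1.
  apply: le_trans (dker_lip w x01).
  rewrite ler_piMl ?enorm_ge0// ger0_norm ?exprn_ge0 ?subr_ge0//.
  by rewrite exprn_ile1 ?subr_ge0// lerBlDr lerDl.
have ci : leb.-integrable I (EFin \o cst (K * (D1 + span w))).
  apply: continuous_compact_integrable; first exact: segment_compact.
  by apply: continuous_subspaceT => y; exact: cvg_cst.
have iF : leb.-integrable I (EFin \o (fun x => enorm (F x))).
  apply: integrable_dominated ci => //; first exact: measurable_enorm.
  by move=> x x01; rewrite ger0_norm ?enorm_ge0// Fle.
rewrite (le_trans (enorm_mxint m01 mF iF))//.
apply: (@le_trans _ _ (\int[leb]_(x in I) (K * (D1 + span w)))).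
  by apply: le_Rintegral => // x x01; exact: Fle.
rewrite Rintegral_cst//= (_ : fine _ = 1) ?mulr1//.
by rewrite lebesgue_measure_itv/= lte_fin ltr01 -EFinB subr0.
Qed.

Let Psi c (p : measurableTypeR R * m.-tuple (V * V)) : R :=
  wgt p.1 * (incr k a p.2 *m dker p.1 p.2) 0 c.

Let Psi_integrable c :
  (leb \x power_prob Pi m)%E.-integrable setT (EFin \o Psi c).
Proof.
apply: (@integrable_product _ _ _ _ _ _ _ ind
  (fun w : m.-tuple (V * V) => 2 * K * (1 + span w) ^+ k)) => //.
- by apply: integrable_mulr => //; exact: (integrable_span N2 m0 m1 m (ltnW kN)).
- apply: measurable_funM => //; under eq_fun do rewrite mxE.
  apply: measurable_sum => l; apply: measurable_funM => //.
  exact: (measurableT_comp (@measurable_incr R dim m k a l) measurable_snd).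
- move=> p; have S0 := span_ge0 p.2.
  rewrite normrM ler_pM ?(ger0_norm (ind_ge0 _))//.
  rewrite (le_trans (ler_norm_enorm _ _ _))// (le_trans (enorm_mulmx _ _))//.
  rewrite (le_trans _ (ler_norm _))// mulrC ler_pM ?enorm_ge0//.
  exact: enorm_incr.
Qed.

Let PsiE (w : m.-tuple (V * V)) c :
  (incr k a w *m fint_a w) 0 c = \int[leb]_x Psi c (x, w).
Proof.
rewrite mxE; under eq_bigr do rewrite fintE -RintegralZl//.
rewrite -Rintegral_sum//; last by move=> l; exact: integrable_mulr.
apply: eq_Rintegral => x _; rewrite /Psi mxE mulr_sumr.
by apply: eq_bigr => l _; rewrite mulrCA.
Qed.

Let Psi_section_integrable (w : m.-tuple (V * V)) c :
  leb.-integrable setT (EFin \o (fun x => Psi c (x, w))).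
Proof.
have -> : (fun x => Psi c (x, w)) =
    (fun x => \sum_l incr k a w 0 l * (wgt x * dker x w l c)).
  apply/funext => x; rewrite /Psi mxE mulr_sumr.
  by apply: eq_bigr => l _; rewrite mulrCA.
by apply: integrable_sumr => // l; exact: integrable_mulr.
Qed.

(** Fubini's theorem exchanges the integral over time in [fint] with the one
    over the points, and identifies the remainder of the theorem with the remainder
    of Taylor's formula for the path [flow_int]. *)
Lemma remainder_fubini c :
  mxint (power_prob Pi m) setT (fun w => increment w *m fint_a w) 0 c =
  \int[leb]_(x in `[0, 1]) ((1 - x) ^+ k.-1 *
    (flow_int Df Pi a x 0 c - flow_int Df Pi a 0 0 c)).
Proof.
have FG := Fubini (Psi_integrable c).
rewrite mxE [in RHS]Rintegral_mkcond; congr fine.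
transitivity (\int[power_prob Pi m]_w \int[leb]_x (Psi c (x, w))%:E)%E.
  apply: eq_integral => w _; transitivity ((\int[leb]_x Psi c (x, w))%:E).
    by congr (_%:E); exact: PsiE.
  by rewrite EFin_Rintegral//; exact: Psi_section_integrable.
rewrite -FG; apply: eq_integral => x _.
have flowi u := integrable_flow N2 m0 m1 K_ge0 aB aL u c (ltnW kN).
have bi := integrable_subr measurableT (flowi x) (flowi 0).
have PsiX (w : m.-tuple (V * V)) : Psi c (x, w) = wgt x *
    (flow_fun Df Pi (erefl m) x w 0 c - flow_fun Df Pi (erefl m) 0 w 0 c).
  rewrite /Psi /dker mulmxBr /flow_fun !castmx_id.
  set A1 := _ *m _; set A2 := _ *m _; clearbody A1 A2.
  by rewrite [X in _ * X]mxE [X in _ * (_ + X)]mxE.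
rewrite patchE -EFin_Rintegral//; last first.
  by under [X in EFin \o X]eq_fun do rewrite PsiX; exact: integrable_mulr.
congr (_%:E); under eq_Rintegral do rewrite PsiX.
rewrite RintegralZl// RintegralB// -!(flow_int_cast _ _ (erefl m)).
by rewrite /wgt /ind indicE; case: ifPn => _; rewrite ?mul1r ?mul0r.
Qed.

End with_start.
End remainder_integrals.

(** * The bound of the remainder *)

Section remainder_bound.
Context {R : realType} {dim e : nat} (Df : derivatives R dim e) (K : R).
Local Notation V := 'rV[R]_dim.
Context (Pi : probability (V * V)%type R) (k : nat) (a : k.-tuple nat).
Hypothesis k_gt0 : (0 < k)%N.
Hypothesis m0 : finite_moment k.+1 (interp_law Pi 0).
Hypothesis m1 : finite_moment k.+1 (interp_law Pi 1).
Hypothesis K_ge0 : 0 <= K.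
Hypothesis aP : is_partseq a.
Hypothesis aB : bounded_by Df K a.
Hypothesis aL : lipschitz_by Df K a.
Context (mu : probability V R).
Hypothesis mmu : finite_moment 2 mu.
Hypothesis mu0 : eq_borel mu (interp_law Pi 0).
Local Notation m := (mseq a).
Local Notation fint_a w := (@fint R dim e Df k a mu Pi w).
Let M := \int[Pi]_z enorm (z.2 - z.1) ^+ k.+1.
Let x (w : m.-tuple (V * V)) (j : 'I_m) := enorm ((tnth w j).2 - (tnth w j).1).

Let N2 : (2 <= k.+1)%N. Proof. by rewrite ltnS. Qed.

Lemma prod_mul_le_sumX n (y : nat -> R) (t : R) :
  (forall i, 0 <= y i) -> 0 <= t ->
  (\prod_(i < n) y i) * t <= \sum_(i < n) y i ^+ n.+1 + t ^+ n.+1.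
Proof.
move=> y0 t0; pose g (i : 'I_n.+1) := if (i < n)%N then y i else t.
have gy (i : 'I_n) : g (widen_ord (leqnSn n) i) = y i by rewrite /g /= (ltn_ord i).
have gt : g ord_max = t by rewrite /g /= ltnn.
have g0 i : 0 <= g i by rewrite /g; case: ifP.
have := @prod_le_sumX _ n.+1 g isT g0; rewrite !big_ord_recr/= gt.
rewrite (eq_bigr _ (fun i _ => gy i)).
by rewrite (eq_bigr _ (fun i _ => congr1 (fun u => u ^+ n.+1) (gy i))).
Qed.

Let idx i := (nth 0%N a i).-1.

Let idx_lt i : (i < k)%N -> (idx i < m)%N.
Proof.
by move=> /(partseq_entry aP)/andP[a0 am]; rewrite /idx prednK.
Qed.

Let y (w : m.-tuple (V * V)) i :=
  enorm ((nth (0, 0) w (idx i)).2 - (nth (0, 0) w (idx i)).1).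

Let y_ge0 w i : 0 <= y w i. Proof. exact: enorm_ge0. Qed.

Let yE w i (ik : (i < k)%N) : y w i = x w (Ordinal (idx_lt ik)).
Proof. by rewrite /x !(tnth_nth (0, 0)). Qed.

Let ix j : (power_prob Pi m).-integrable setT (EFin \o (fun w => x w j ^+ k.+1)).
Proof. exact: (integrable_power_tnth m0 m1). Qed.

Let iM : Pi.-integrable setT (EFin \o (fun z : V * V => enorm (z.2 - z.1) ^+ k.+1)).
Proof. exact: (integrable_length m0 m1). Qed.

Let xE j : \int[power_prob Pi m]_w x w j ^+ k.+1 = M.
Proof.
congr fine; apply: (@ge0_integral_power_tnth _ _ _ Pi m j
  (fun z => (enorm (z.2 - z.1) ^+ k.+1)%:E)).
  by apply/measurable_EFinP; exact: measurable_length.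
by move=> z; rewrite lee_fin exprn_ge0// enorm_ge0.
Qed.

Let Y (w : m.-tuple (V * V)) := \sum_(i < k) y w i ^+ k.+1.

Let iy (i : 'I_k) :
  (power_prob Pi m).-integrable setT (EFin \o (fun w => y w i ^+ k.+1)).
Proof. by under [X in EFin \o X]eq_fun do rewrite (yE _ (ltn_ord i)). Qed.

Let iY : (power_prob Pi m).-integrable setT (EFin \o Y).
Proof. exact: integrable_sumr. Qed.

Let YE : \int[power_prob Pi m]_w Y w = k%:R * M.
Proof.
rewrite Rintegral_sum// (eq_bigr (fun=> M)).
  by rewrite sumr_const card_ord mulr_natl.
by move=> i _; under eq_Rintegral do rewrite (yE _ (ltn_ord i)).
Qed.

(** [mean_length] is an integral over one further independent pair, so the product of
    [k] lengths with [D1] is again an average of products of [k + 1] lengths. *)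
Let prod_mean_le w : (\prod_(i < k) y w i) * mean_length Pi <= Y w + M.
Proof.
have i1 : Pi.-integrable setT (EFin \o (fun z : V * V => enorm (z.2 - z.1))).
  by apply: eq_integrable (integrable_length m0 m1 (ltnW N2)).
have ic : Pi.-integrable setT (EFin \o (fun=> Y w)).
  exact: finite_measure_integrable_cst.
have -> : Y w + M = \int[Pi]_z (Y w + enorm (z.2 - z.1) ^+ k.+1).
  rewrite RintegralD// Rintegral_cst// (_ : fine _ = 1) ?mulr1//.
  exact: (congr1 fine (@probability_setT _ _ _ Pi)).
rewrite -RintegralZl//; apply: le_Rintegral => //.
- exact: integrable_mulr.
- exact: integrable_addr.
- by move=> z _; rewrite prod_mul_le_sumX ?enorm_ge0.
Qed.

Let B w := K * ((m.+1)%:R * Y w + M + \sum_(j < m) x w j ^+ k.+1).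

Let le_B (w : m.-tuple (V * V)) : enorm (increment w *m fint_a w) <= B w.
Proof.
rewrite (le_trans (enorm_mulmx _ _))// enorm_tensor.
have pr0 : 0 <= \prod_(i < k) y w i by exact: prodr_ge0.
apply: (@le_trans _ _ ((\prod_(i < k) y w i) * (K * (mean_length Pi + span w)))).
  rewrite ler_wpM2l//.
  exact: (fint_bound N2 m0 m1 K_ge0 aL mmu mu0).
rewrite mulrCA ler_wpM2l// mulrDr span_tuple mulr_sumr.
have -> : m.+1%:R * Y w + M + \sum_(j < m) x w j ^+ k.+1 =
    Y w + M + \sum_(j < m) (Y w + x w j ^+ k.+1).
  by rewrite big_split/= sumr_const card_ord -natr1 -mulr_natl; ring.
apply: lerD; first exact: prod_mean_le.
by apply: ler_sum => j _; rewrite prod_mul_le_sumX// enorm_ge0.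
Qed.

Let iB : (power_prob Pi m).-integrable setT (EFin \o B).
Proof.
apply: integrable_mulr => //; apply: integrable_addr => //; last first.
  exact: integrable_sumr.
apply: integrable_addr => //; first exact: integrable_mulr.
exact: finite_measure_integrable_cst.
Qed.

Let BE : \int[power_prob Pi m]_w B w = K * ((k.+1)%:R * (m.+1)%:R) * M.
Proof.
have iYm : (power_prob Pi m).-integrable setT (EFin \o (fun w => m.+1%:R * Y w)).
  exact: integrable_mulr.
have ic : (power_prob Pi m).-integrable setT (EFin \o (fun=> M)).
  exact: finite_measure_integrable_cst.
have iX : (power_prob Pi m).-integrable setT
    (EFin \o (fun w => \sum_(j < m) x w j ^+ k.+1)).
  exact: integrable_sumr.
have iYM := integrable_addr measurableT iYm ic.
rewrite RintegralZl//; last exact: integrable_addr.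
rewrite RintegralD// RintegralD// RintegralZl// YE Rintegral_cst//.
rewrite (_ : fine _ = 1); last first.
  exact: (congr1 fine (@probability_setT _ _ _ (power_prob Pi m))).
rewrite Rintegral_sum// (eq_bigr (fun=> M)) ?sumr_const ?card_ord => [|j _//].
by rewrite -mulr_natl -!natr1; ring.
Qed.

(** The integrand is at most a product of [k] displacements times [K] times a sum
    of [m + 1] displacements, and a product of [k + 1] nonnegative numbers is at most
    the sum of their [k + 1]-st powers, each of which integrates to the moment of
    [Pi]. *)
Lemma enorm_remainder_term :
  enorm (mxint (power_prob Pi m) setT (fun w => increment w *m fint_a w)) <=
  K * ((k.+1)%:R * (m.+1)%:R) * M.
Proof.
have mF i c : measurable_fun setT
    (fun w : m.-tuple (V * V) => (increment w *m fint_a w) i c).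
  rewrite ord1; apply: (@measurable_incr_mul R dim m k e a) => i' j.
  exact: (measurable_fint N2 m0 m1 K_ge0 aB aL mmu mu0).
have iF : (power_prob Pi m).-integrable setT
    (EFin \o (fun w => enorm (increment w *m fint_a w))).
  apply: integrable_dominated iB => //; first exact: measurable_enorm.
  by move=> w _; rewrite ger0_norm ?enorm_ge0.
rewrite (le_trans (enorm_mxint measurableT mF iF))// -BE.
exact: le_Rintegral.
Qed.

End remainder_bound.

(** * The expansion of the function *)

Section finite_families.
Context {R : realType}.

Lemma is_derive_sum_seq (T : eqType) (s : seq T) (g g' : T -> R -> R) (t : R) :
  (forall a, a \in s -> is_derive t (1 : R) (g a) (g' a t)) ->
  is_derive t (1 : R) (fun x : R => \sum_(a <- s) g a x) (\sum_(a <- s) g' a t).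
Proof.
elim: s => [_|a s IH dg].
  under eq_fun do rewrite big_nil.
  by rewrite big_nil; exact: is_derive_cst.
under eq_fun do rewrite big_cons.
rewrite big_cons; apply: is_deriveD; first by apply: dg; rewrite mem_head.
by apply: IH => b bs; apply: dg; rewrite in_cons bs orbT.
Qed.

Lemma continuous_sum_seq (T : eqType) (s : seq T) (g : T -> R -> R) :
  (forall a, a \in s -> continuous (g a)) ->
  continuous (fun x : R => \sum_(a <- s) g a x).
Proof.
elim: s => [_|a s IH dg].
  by under eq_fun do rewrite big_nil; move=> x; exact: cvg_cst.
under eq_fun do rewrite big_cons.
move=> x; apply: cvgD; first by apply: dg; rewrite mem_head.
by apply: IH => b bs; apply: dg; rewrite in_cons bs orbT.
Qed.

Lemma continuous_lipschitz (g : R -> R) C :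
  (forall s t, `|g t - g s| <= C * `|t - s|) -> continuous g.
Proof.
move=> gL x; apply/cvgrPdist_le => e e0.
have C0 : 0 < 1 + `|C| by rewrite ltr_pwDl.
near=> t; rewrite (le_trans (gL _ _))//.
apply: (@le_trans _ _ ((1 + `|C|) * `|x - t|)).
  by rewrite ler_wpM2r// (le_trans (ler_norm _))// lerDr.
rewrite mulrC -ler_pdivlMr//; near: t.
by apply: (@cvgr_dist_le _ _ _ _ _ (fun y => y)) => //; rewrite divr_gt0.
Unshelve. all: by end_near. Qed.

Lemma common_bound (T : eqType) (s : seq T) (Q : T -> R -> Prop) :
  (forall t x y, x <= y -> Q t x -> Q t y) ->
  (forall t, t \in s -> exists x, Q t x) ->
  exists2 x, 0 <= x & forall t, t \in s -> Q t x.
Proof.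
move=> Qm; elim: s => [_|a s IH Qs]; first by exists 0.
have [|x x0 xQ] := IH; first by move=> t ts; apply: Qs; rewrite in_cons ts orbT.
have [y yQ] := Qs a (mem_head _ _).
exists (x + `|y|) => [|t]; first by rewrite addr_ge0.
rewrite in_cons => /predU1P[->|ts].
  by apply: Qm yQ; rewrite (le_trans (ler_norm y))// lerDr.
by apply: (Qm _ x); [rewrite lerDl|exact: xQ].
Qed.

End finite_families.

Lemma mseq_le k (a : k.-tuple nat) : is_partseq a -> (mseq a <= k)%N.
Proof.
rewrite -mem_partseqs mem_filter => /andP[_ /mapP[t _ ->]].
by apply/bigmax_leqP_seq => i /mapP[j _ ->] _; rewrite -ltnS.
Qed.

Section monotone_bounds.
Context {R : realType} {dim e : nat} (Df : derivatives R dim e).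
Context k (a : k.-tuple nat) (K K' : R).
Hypothesis KK' : K <= K'.

Lemma bounded_by_le : bounded_by Df K a -> bounded_by Df K' a.
Proof. by move=> aB mu v mmu; rewrite (le_trans _ KK')// aB. Qed.

Lemma lipschitz_by_le : lipschitz_by Df K a -> lipschitz_by Df K' a.
Proof.
move=> aL mu nu u v mmu mnu; rewrite (le_trans (aL _ _ _ _ mmu mnu))//.
rewrite lee_wpmul2r ?lee_fin// adde_ge0//.
  by apply: le_ereal_inf_tmp => _ [G _ <-]; exact: poweR_ge0.
by rewrite lee_fin sumr_ge0// => i _; exact: enorm_ge0.
Qed.

End monotone_bounds.

Section coupling_flow.
Context {R : realType} {dim : nat}.
Local Notation V := 'rV[R]_dim.
Context (mu nu : probability V R) (Pi : probability (V * V)%type R).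
Hypothesis cPi : coupling mu nu Pi.

Lemma eq_borel_interp0 : eq_borel mu (interp_law Pi 0).
Proof.
move=> A mA; rewrite -(cPi.1 A mA); congr (Pi _).
by apply/seteqP; split => z /=; rewrite /interp scale0r addr0 => // -[].
Qed.

Lemma eq_borel_interp1 : eq_borel nu (interp_law Pi 1).
Proof.
move=> A mA; rewrite -(cPi.2 A mA); congr (Pi _).
by apply/seteqP; split => z /=; rewrite /interp scale1r addrC subrK => // -[].
Qed.

End coupling_flow.

Section expansion.
Context d (Omega : measurableType d) (R : realType) (P : probability Omega R).
Context {dim e n : nat} (f : probability 'rV[R]_dim R -> 'rV[R]_e).
Context (Df : derivatives R dim e).
Local Notation V := 'rV[R]_dim.
Context (mu nu : probability V R) (Pi : probability (V * V)%type R).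
Hypothesis rP : rich P.
Hypothesis fC : Cb P n.+1 f Df.
Hypothesis mmu : finite_moment n.+2 mu.
Hypothesis mnu : finite_moment n.+2 nu.
Hypothesis cPi : coupling mu nu Pi.

Let mu0 := eq_borel_interp0 cPi.
Let nu1 := eq_borel_interp1 cPi.
Let m0 : finite_moment n.+2 (interp_law Pi 0).
Proof. exact: eq_borel_finite_moment mu0 mmu. Qed.
Let m1 : finite_moment n.+2 (interp_law Pi 1).
Proof. exact: eq_borel_finite_moment nu1 mnu. Qed.
Let N2 : (2 <= n.+2)%N. Proof. by []. Qed.
Let mmu2 : finite_moment 2 mu. Proof. exact: finite_momentW mmu. Qed.

(** There are finitely many partition sequences of length at most [n + 1], hence a
    common constant. *)
Let bounds : exists2 K, 0 <= K & forall k (a : k.-tuple nat), (0 < k < n.+2)%N ->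
  is_partseq a -> bounded_by Df K a /\ lipschitz_by Df K a.
Proof.
pose Q k (a : k.-tuple nat) K := bounded_by Df K a /\ lipschitz_by Df K a.
have Qm k (a : k.-tuple nat) x y : x <= y -> Q k a x -> Q k a y.
  by move=> xy [aB aL]; split; [exact: bounded_by_le aB|exact: lipschitz_by_le aL].
have [|k|K K0 KQ] := @common_bound R _ (index_iota 1 n.+2)
    (fun k K => forall a : k.-tuple nat, a \in partseqs k -> Q k a K).
- by move=> k x y xy xQ a aP; apply: Qm (xQ a aP).
- rewrite mem_index_iota => kn.
  have [||K _ KQ] := @common_bound R _ (partseqs k) (Q k); [exact: Qm| |by exists K].
  move=> a; rewrite mem_partseqs => aP.
  by have [_ _ h _ _] := fC; exact: h kn aP.
- exists K => // k a kn aP; apply: KQ; rewrite ?mem_index_iota//.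
  by rewrite mem_partseqs.
Qed.

(** The [k]-th derivative in time of the function along the interpolation. *)
Let path c k (x : R) : R := if k is k'.+1 then
  \sum_(a <- partseqs k'.+1) flow_int Df Pi a x 0 c else f (interp_law Pi x) 0 c.

Let path_derive c k t : (k <= n)%N ->
  is_derive t (1 : R) (path c k) (path c k.+1 t).
Proof.
have [f_borel f_lions _ f_diff f_flow] := fC.
have [K K0 KQ] := bounds.
case: k => [_|k kn] /=.
  have aP : is_partseq [tuple 1%N] by rewrite -mem_partseqs partseqs1 mem_head.
  have [aB aL] := KQ 1%N _ isT aP.
  rewrite partseqs1 big_seq1.
  have [C hC] := zeroth_expansion rP N2 m0 m1 K0 c f_borel f_lions aB aL.
  exact: is_derive_quadratic (hC t).
rewrite sum_partseqsS; apply: (@is_derive_sum_seq R _ (partseqs k.+1)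
  (fun a x => flow_int Df Pi a x 0 c) (fun a x => \sum_(j < (mseq a).+1)
     flow_int Df Pi (rcons_tuple a j.+1) x 0 c)) => a; rewrite mem_partseqs => aP.
have kn1 : (1 <= k.+1 <= n)%N by [].
have [aB aL] := KQ _ a (ltnW kn : (0 < k.+1 < n.+2)%N) aP.
have bP j : (j < (mseq a).+1)%N ->
    bounded_by Df K (rcons_tuple a j.+1) /\ lipschitz_by Df K (rcons_tuple a j.+1).
  move=> jm; apply: KQ; first exact: kn.
  by rewrite is_partseq_rcons aP.
have [C hC] := flow_int_expansion rP N2 m0 m1 K0 aP (kn : (k.+3 <= n.+2)%N) aB aL
  (fun j jm => (bP j jm).1) (fun j jm => (bP j jm).2)
  (f_diff _ a kn1 aP) (f_flow _ a kn1 aP) c.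
exact: is_derive_quadratic (hC t).
Qed.

Let flow_continuous c (a : n.+1.-tuple nat) : is_partseq a ->
  continuous (fun x : R => flow_int Df Pi a x 0 c).
Proof.
move=> aP; have [K K0 KQ] := bounds.
have [aB aL] := KQ _ a (ltnSn _) aP.
have [C hC] := flow_int_lip N2 m0 m1 K0 c (ltnSn _) aB aL.
exact: continuous_lipschitz hC.
Qed.

(** Outside of the partition sequences there is no control of the integrands; [h]
    vanishes there, so that the exchange of sum and integral applies to all tuples. *)
Let remainderE c : remainder Df n.+1 mu Pi 0 c = (n`!%:R)^-1 *
  \int[lebesgue_measure]_(x in `[0, 1]) ((1 - x) ^+ n * (path c n.+1 x - path c n.+1 0)).
Proof.
have [K K0 KQ] := bounds.
rewrite /remainder mxE summxE; congr (_ * _).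
pose h (a : n.+1.-tuple nat) x := if is_partseq a then
  (1 - x) ^+ n * (flow_int Df Pi a x 0 c - flow_int Df Pi a 0 0 c) else 0.
transitivity (\sum_(a <- partseqs n.+1) \int[lebesgue_measure]_(x in `[0, 1]) h a x).
  apply: eq_big_seq => a aP; rewrite mem_partseqs in aP; rewrite /h aP.
  have [aB aL] := KQ _ a (ltnSn _) aP.
  exact: (remainder_fubini N2 m0 m1 K0 (ltnSn _) aB aL mmu2 mu0).
rewrite -Rintegral_sum//; last first.
  move=> a; apply: continuous_compact_integrable; first exact: segment_compact.
  apply: continuous_subspaceT; rewrite /h; case: (is_partseq a) (@flow_continuous c a) => fcont.
    move=> x; apply: cvgM; last by apply: cvgB; [exact: fcont|exact: cvg_cst].
    apply: (cvg_comp _ (fun y : R => y ^+ n)); last exact: exprn_continuous.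
    by apply: cvgB; [exact: cvg_cst|exact: cvg_id].
  by move=> x; exact: cvg_cst.
apply: eq_Rintegral => x _; rewrite /path -sumrB mulr_sumr.
by apply: eq_big_seq => a; rewrite mem_partseqs /h => ->.
Qed.

Lemma DintE k (a : k.-tuple nat) : (0 < k < n.+2)%N -> is_partseq a ->
  Dint Df a mu Pi = flow_int Df Pi a 0.
Proof.
move=> kn aP; have [K K0 KQ] := bounds; have [_ aL] := KQ _ a kn aP.
congr mxint; apply/funext => w; congr (_ *m _).
exact: (kernel_start K0 aL mmu2 mu0).
Qed.

Lemma taylor_expansion : f nu - f mu =
  \sum_(1 <= k < n.+2) \sum_(a <- partseqs k) (k`!%:R)^-1 *: Dint Df a mu Pi
  + remainder Df n.+1 mu Pi.
Proof.
have [f_borel _ _ _ _] := fC; have [K K0 KQ] := bounds.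
rewrite (f_borel _ _ mmu2 mu0) (f_borel _ _ (finite_momentW N2 mnu) nu1).
apply/rowP => c.
have := @taylor_integral R (path c) n (path_derive c) _.
rewrite -remainderE -/(path c 0 1) => tE.
rewrite [LHS]mxE [X in _ + X]mxE tE; last first.
  by apply: continuous_sum_seq => a; rewrite mem_partseqs; exact: flow_continuous.
rewrite [RHS]mxE; congr (_ + _); rewrite summxE; apply: eq_big_nat => -[//|k] kn.
rewrite summxE mulr_sumr; apply: eq_big_seq => a; rewrite mem_partseqs => aP.
by rewrite [RHS]mxE DintE.
Qed.

Lemma enorm_remainder K : 
  (forall a : n.+1.-tuple nat, is_partseq a ->
     bounded_by Df K a /\ lipschitz_by Df K a) ->
  enorm (remainder Df n.+1 mu Pi) <=
  (n`!%:R)^-1 * (`|K| * (n.+2)%:R ^+ 2 * (size (partseqs n.+1))%:R) *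
  \int[Pi]_z enorm (z.1 - z.2) ^+ n.+2.
Proof.
move=> KQ; rewrite enormZ ger0_norm ?invr_ge0// -mulrA ler_wpM2l ?invr_ge0//.
set M := Rintegral _ _ _.
have ME : M = \int[Pi]_z enorm (z.2 - z.1) ^+ n.+2.
  by apply: eq_Rintegral => z _; rewrite enormB.
have M0 : 0 <= M.
  by apply: Rintegral_ge0 => z _; rewrite exprn_ge0 ?enorm_ge0.
apply: le_trans (ler_enorm_sum _ _) _.
apply: (@le_trans _ _ (\sum_(a <- partseqs n.+1) `|K| * (n.+2)%:R ^+ 2 * M)); last first.
  by rewrite big_const_seq count_predT iter_addr addr0 -[_ *+ size _]mulr_natr mulrAC.
rewrite big_seq [leRHS]big_seq; apply: ler_sum => a; rewrite mem_partseqs => aP.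
have [aB aL] := KQ a aP.
apply: le_trans (enorm_remainder_term (ltn0Sn n) m0 m1 (normr_ge0 K) aP
  (bounded_by_le (ler_norm K) aB) (lipschitz_by_le (ler_norm K) aL) mmu2 mu0) _.
rewrite -ME; apply: ler_wpM2r; first exact: M0.
apply: ler_wpM2l; first exact: normr_ge0.
rewrite expr2; apply: ler_wpM2l; first exact: ler0n.
by rewrite ler_nat ltnS mseq_le.
Qed.

End expansion.

Theorem theorem2p8 (R : realType) (n : nat) (n_gt0 : (0 < n)%N) :
  exists C : R -> R,
  forall (dim e : nat)
    (dO : measure_display) (Omega : measurableType dO)
    (P : probability Omega R)
    (f : probability 'rV[R]_dim R -> 'rV[R]_e) (Df : derivatives R dim e),
  rich P -> Cb P n f Df ->
  forall (mu nu : probability 'rV[R]_dim R)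
    (Pi : probability ('rV[R]_dim * 'rV[R]_dim)%type R),
  finite_moment n.+1 mu -> finite_moment n.+1 nu -> coupling mu nu Pi ->
  f nu - f mu =
    \sum_(1 <= k < n.+1) \sum_(a <- partseqs k)
      (k`!%:R)^-1 *: Dint Df a mu Pi
    + remainder Df n mu Pi
  /\
  forall K : R,
    (forall (k : nat) (a : k.-tuple nat), (1 <= k <= n)%N -> is_partseq a ->
       bounded_by Df K a /\ lipschitz_by Df K a) ->
    ((enorm (remainder Df n mu Pi))%:E <=
     (C K)%:E * \int[Pi]_z (enorm (z.1 - z.2) ^+ n.+1)%:E)%E.
Proof.
case: n n_gt0 => // {}n _.
(* There is one term for each sequence. It is bounded by a sum of at most n + 2
   products, one for the law and one for each point, of n + 2 displacements. *)
exists (fun K => (n`!%:R)^-1 * (`|K| * (n.+2)%:R ^+ 2 * (size (partseqs n.+1))%:R)).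
move=> dim e dO Omega P f Df rP fC mu nu Pi mmu mnu cPi; split.
  exact: taylor_expansion rP fC mmu mnu cPi.
move=> K KQ.
have m0 := eq_borel_finite_moment (eq_borel_interp0 cPi) mmu.
have m1 := eq_borel_finite_moment (eq_borel_interp1 cPi) mnu.
have iM : Pi.-integrable setT
    (EFin \o (fun z : 'rV[R]_dim * 'rV[R]_dim => enorm (z.1 - z.2) ^+ n.+2)).
  apply: eq_integrable (integrable_length m0 m1 (leqnn _)) => // z _ /=.
  by rewrite enormB.
rewrite -EFin_Rintegral// -EFinM lee_fin.
apply: (enorm_remainder mmu mnu cPi) => a aP; apply: KQ => //.
by rewrite leqnn.
Qed.
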